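(* Suppose that $F\in C_p^\infty(\mathbb{R}^m)$ and that there exist constants $C_1,C_2,C_3>0$, $\epsilon>0$ and integers $l_1,\dots,l_m\ge 1$ such that for all $y\in\mathbb{R}^m$ $$-C_3+C_1\sum_{i=1}^m|y_i|^{2l_i}\le F(y)\le C_2\sum_{i=1}^m|y_i|^{2l_i}+C_3,\qquad \|\nabla^2F(y)\|\le C_2\sum_{i=1}^m|y_i|^{2l_i-\epsilon}+C_3 .$$ Suppose also that at least $m$ of the vectors $\sigma_1,\dots,\sigma_d$ are linearly independent. Then for any $n\in\{2,\dots,N^h\}$, the law of $X_n$ is absolutely continuous with respect to the Lebesgue measure on $\mathbb{R}^{2m}$.
   Context: Setting. Let $m,d\ge1$, $T>0$, $v>0$, $\sigma=[\sigma_1,\dots,\sigma_d]$ with constant vectors $\sigma_k\in\mathbb{R}^m$, and let $W=(W^1,\dots,W^d)^\top$ be a $d$-dimensional standard Wiener process on a filtered complete probability space $(\Omega,\mathscr F,\{\mathscr F_t\}_{t\ge0},\mathbb P)$ (taken to be the Wiener space). The initial value $X(0)=(P(0)^\top,Q(0)^\top)^\top\in\mathbb{R}^{2m}$ is deterministic. Standing assumptions on $F$: $F\in C^2(\mathbb{R}^m)$; there is a constant $C_0$ with $F(y)+C_0>0$ for all $y$; $\limsup_{r\downarrow0}\sup_{y\in\mathbb{R}^m}\frac{\|y\|^r}{C_0+F(y)}<\infty$; and there is $K\ge0$ with $\lambda_{\min}(\nabla^2F(y))\ge-K$ for all $y\in\mathbb{R}^m$. When the polynomial bounds in the claim are assumed,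 it is also supposed that for every multi-index $a$ with $|a|\ge1$ one has $|\partial^aF(y)|\le C(1+\|y\|^{2\max_i l_i})$ for all $y$, with $C$ possibly depending on $a$. $C_p^\infty(\mathbb{R}^m)$ denotes smooth functions which, with all their partial derivatives, have at most polynomial growth. Scheme (splitting AVF scheme for the Langevin equation $dP=-\nabla F(Q)\,dt-vP\,dt+\sigma\,dW_t$, $dQ=P\,dt$). Let $h=T/N^h$ with $N^h\in\mathbb{N}$, $t_n=nh$, $h<2/\sqrt K$ (no restriction if $K=0$), so that the scheme is solvable. $X_n=(P_n^\top,Q_n^\top)^\top$ is defined by $X_0=X(0)$ and, for $n=0,\dots,N^h-1$, $$\bar P_{n+1}=P_n-h\int_0^1\nabla F(Q_n+\tau(\bar Q_{n+1}-Q_n))\,d\tau,\qquad \bar Q_{n+1}=Q_n+\tfrac h2(\bar P_{n+1}+P_n),$$ $$P_{n+1}=e^{-vh}\bar P_{n+1}+\sum_{k=1}^d\int_{t_n}^{t_{n+1}}e^{-v(t_{n+1}-t)}\sigma_k\,dW^k_t,\qquad Q_{n+1}=\bar Q_{n+1}.$$ *)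

(* Defs.v *)
From HB Require Import structures.
From mathcomp Require Import all_boot all_order all_algebra.
From mathcomp Require Import all_classical all_reals all_analysis.

Set Implicit Arguments.
Unset Strict Implicit.
Unset Printing Implicit Defensive.

Import Order.TTheory GRing.Theory Num.Theory.
Import numFieldNormedType.Exports.

Local Open Scope classical_set_scope.
Local Open Scope ring_scope.

(* Vectors of R^n are row vectors 'rV[R]_n. *)

(* The Euclidean (for matrices: Frobenius) norm; the library's `|x| is the
   sup norm. *)
Definition enorm {R : realType} {p q : nat} (A : 'M[R]_(p, q)) : R :=
  Num.sqrt (\sum_i \sum_j A i j ^+ 2).

Section Derivatives.
Context {R : realType} {m : nat}.
Implicit Types (F : 'rV[R]_m -> R) (s : seq 'I_m) (a : 'I_m -> nat).

Definition partial (i : 'I_m) F : 'rV[R]_m -> R := 'D_(delta_mx 0 i) F.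

(* pderivs [:: i1; ...; ik] F = d_i1 (... (d_ik F)) *)
Definition pderivs s F : 'rV[R]_m -> R := foldr partial F s.

Definition multideriv a F : 'rV[R]_m -> R :=
  pderivs (flatten [seq nseq (a i) i | i <- enum 'I_m]) F.

Definition grad F (y : 'rV[R]_m) : 'rV[R]_m := \row_i partial i F y.

Definition hessian F (y : 'rV[R]_m) : 'M[R]_m :=
  \matrix_(i, j) pderivs [:: i; j] F y.

(* F is of class C^k: all iterated partial derivatives of order at most k exist
   and are continuous.  'D_v is total, so existence is stated separately. *)
Definition class_C (k : nat) F : Prop :=
  forall s, (size s <= k)%N ->
    continuous (pderivs s F) /\
    ((size s < k)%N ->
      forall i y, derivable (pderivs s F) y (delta_mx 0 i)).

Definition class_Cpinfty F : Prop :=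
  (forall k, class_C k F) /\
  (forall a, exists C q, forall y,
      `|multideriv a F y| <= C * (1 + enorm y ^+ q)).

End Derivatives.

(* Smallest eigenvalue of a real symmetric matrix. *)
Definition lambda_min {R : realType} {m : nat} (A : 'M[R]_m) : R :=
  inf [set x | eigenvalue A x].

Definition standing_assumptions {R : realType} {m : nat}
    (F : 'rV[R]_m -> R) (C0 K : R) : Prop :=
  [/\ class_C 2 F,
      forall y, 0 < F y + C0,
      (limf_esup (fun r : R =>
         ereal_sup [set (enorm y `^ r / (C0 + F y))%:E | y in [set: 'rV[R]_m]])
         0^'+ < +oo)%E,
      0 <= K &
      forall y, - K <= lambda_min (hessian F y)].

(* The power x^r of x >= 0 with the convention 0^r = +oo for r < 0
   (the library has 0 `^ r = 0 there). *)
Definition epow {R : realType} (x r : R) : \bar R :=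
  if (x == 0) && (r < 0) then +oo%E else (x `^ r)%:E.

Definition growth_conditions {R : realType} {m : nat} (F : 'rV[R]_m -> R)
    (C1 C2 C3 eps : R) (l : 'I_m -> nat) : Prop :=
  forall y : 'rV[R]_m,
  [/\ - C3 + C1 * \sum_i `|y 0 i| ^+ (2 * l i) <= F y,
      F y <= C2 * \sum_i `|y 0 i| ^+ (2 * l i) + C3 &
      ((enorm (hessian F y))%:E <=
        C2%:E * (\sum_i epow (`|y 0 i|)%R ((2 * l i)%:R - eps)%R) + C3%:E)%E].

Definition derivative_bounds {R : realType} {m : nat} (F : 'rV[R]_m -> R)
    (l : 'I_m -> nat) : Prop :=
  forall a : 'I_m -> nat, (1 <= \sum_i a i)%N ->
    exists C : R, forall y,
      `|multideriv a F y| <= C * (1 + enorm y ^+ (2 * \max_i l i)).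

Section Wiener.
Context {R : realType} {dis : measure_display} {Omega : measurableType dis}.
Variable P : probability Omega R.

(* Time is indexed by R; only times t >= 0 are constrained. *)
Definition filtration (Ft : R -> set_system Omega) : Prop :=
  (forall t, 0 <= t -> sigma_algebra [set: Omega] (Ft t) /\
                       Ft t `<=` measurable) /\
  (forall s t, 0 <= s -> s <= t -> Ft s `<=` Ft t).

Section WienerProcess.
Variables (d : nat) (W : 'I_d -> R -> {RV P >-> R}).

Definition increment (s t : R) (w : Omega) : d.-tuple R :=
  [tuple W k t w - W k s w | k < d].

Definition wiener_process (Ft : R -> set_system Omega) : Prop :=
  [/\ forall t k (A : set R), 0 <= t -> measurable A -> Ft t (W k t @^-1` A),
      {ae P, forall w, forall k, W k 0 w = 0},
      {ae P, forall w, forall k,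
         {within [set t | 0 <= t], continuous (fun t => W k t w)}},
      forall s t (B : set Omega) (A : set (d.-tuple R)),
        0 <= s -> s < t -> Ft s B -> measurable A ->
        (P (B `&` increment s t @^-1` A) =
         P B * P (increment s t @^-1` A))%E &
      (* increments have law N(0, (t - s) Id) *)
      forall s t (A : 'I_d -> set R),
        0 <= s -> s < t -> (forall k, measurable (A k)) ->
        P [set w | forall k, A k (tnth (increment s t w) k)] =
        (\prod_(k < d) normal_prob 0 (Num.sqrt (t - s)) (A k))%E].

End WienerProcess.

(* A step function is a linear combination of indicators of intervals
   ]u, v] included in [a, b], encoded by the list of the (c, (u, v)). *)
Definition step := seq (R * (R * R)).

Definition step_on (a b : R) (p : step) : bool :=
  all (fun q => [&& a <= q.2.1, q.2.1 <= q.2.2 & q.2.2 <= b]) p.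

Definition step_fun (p : step) (t : R) : R :=
  \sum_(q <- p) q.1 * \1_(`]q.2.1, q.2.2] : set R) t.

Definition step_integral (B : R -> Omega -> R) (p : step) (w : Omega) : R :=
  \sum_(q <- p) q.1 * (B q.2.2 w - B q.2.1 w).

(* I is (a version of) the Wiener integral of the deterministic f against B
   over [a, b]: the limit in L^2(P) of the integrals of step functions
   converging to f in L^2([a, b]). *)
Definition is_wiener_integral (B : R -> Omega -> R) (a b : R) (f : R -> R)
    (I : Omega -> R) : Prop :=
  exists p : nat -> step,
  [/\ forall j, step_on a b (p j),
      (\int[lebesgue_measure]_(t in `[a, b]) ((f t - step_fun (p j) t) ^+ 2)%:E
         @[j --> \oo] --> 0)%E &
      ('E_P[fun w => ((I w - step_integral B (p j) w) ^+ 2)%R]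
         @[j --> \oo] --> 0)%E].

End Wiener.

(* [avf_step F v h p q xi p' q'] : one step of the scheme, from (P_n, Q_n) to
   (P_(n+1), Q_(n+1)), with stochastic term xi. *)
Definition avf_step {R : realType} {m : nat} (F : 'rV[R]_m -> R) (v h : R)
    (p q xi p' q' : 'rV[R]_m) : Prop :=
  exists pbar qbar : 'rV[R]_m,
  [/\ pbar = p - h *: \row_i (\int[lebesgue_measure]_(tau in `[0%R, 1%R])
                                grad F (q + tau *: (qbar - q)) 0 i)%R,
      qbar = q + (h / 2) *: (pbar + p),
      p' = expR (- v * h) *: pbar + xi &
      q' = qbar].

(* X n = (P_n, Q_n); [J n k] is the integral over [t_n, t_(n+1)] of
   exp (- v (t_(n+1) - t)) against the k-th component of W. *)
Definition splitting_avf {R : realType} {dis : measure_display}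
    {Omega : measurableType dis} (P : probability Omega R) {m d : nat}
    (W : 'I_d -> R -> {RV P >-> R}) (F : 'rV[R]_m -> R) (v : R)
    (sigma : 'I_d -> 'rV[R]_m) (h : R) (N : nat) (X0 : 'rV[R]_(m + m))
    (X : nat -> Omega -> 'rV[R]_(m + m)) : Prop :=
  exists J : nat -> 'I_d -> {RV P >-> R},
  (forall n k, (n < N)%N ->
     is_wiener_integral P (W k) (n%:R * h) (n.+1%:R * h)
       (fun t => expR (- v * (n.+1%:R * h - t))) (J n k)) /\
  {ae P, forall w, X 0%N w = X0 /\
     forall n, (n < N)%N ->
       avf_step F v h (lsubmx (X n w)) (rsubmx (X n w))
         (\sum_k J n k w *: sigma k)
         (lsubmx (X n.+1 w)) (rsubmx (X n.+1 w))}.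

(* Coordinates; n.-tuple R carries the library's product (= Borel)
   sigma-algebra. *)
Definition row_tuple {R : realType} {n : nat} (x : 'rV[R]_n) : n.-tuple R :=
  [tuple x 0 i | i < n].

Definition random_vector {R : realType} {dis : measure_display}
    {Omega : measurableType dis} {n : nat} (Y : Omega -> 'rV[R]_n) : Prop :=
  measurable_fun [set: Omega] (fun w => row_tuple (Y w)).

Definition law {R : realType} {dis : measure_display}
    {Omega : measurableType dis} (P : probability Omega R) {n : nat}
    (Y : Omega -> 'rV[R]_n) : set (n.-tuple R) -> \bar R :=
  pushforward P (fun w => row_tuple (Y w)).

(* Lebesgue measure on R^n, as an iterated product measure. *)
Fixpoint lebesgue_tuple (R : realType) (n : nat) :
    set (n.-tuple R) -> \bar R :=
  match n with
  | 0 => \d_([tuple] : 0.-tuple R)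
  | n'.+1 => pushforward (@lebesgue_measure R \x @lebesgue_tuple R n')%E
               (fun x : R * n'.-tuple R => [tuple of x.1 :: x.2])
  end.

(* Main.v *)
Require Import Defs.
From HB Require Import structures.
From mathcomp Require Import all_boot all_order all_algebra.
From mathcomp Require Import all_classical all_reals all_analysis.
From mathcomp Require Import measurable_realfun.
From mathcomp Require Import ring lra zify.

Import Order.TTheory GRing.Theory Num.Theory.
Import numFieldNormedType.Exports.
Import HBNNSimple.

Local Open Scope classical_set_scope.
Local Open Scope ring_scope.

Set Implicit Arguments.
Unset Strict Implicit.
Unset Printing Implicit Defensive.

(** Write X_k = (P_k, Q_k). The law of X_n is compared with Lebesgue measure on
    dyadic cubes: it is enough to show that a cube of side r, localised to an
    event where everything is bounded, has probability O(r^(2m))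
    ([dominates_lebesgue_tuple]). The power 2m is gained from the noise of two
    successive steps, m from each.

    The implicit equation is explicit when read backwards. With
    Phi(q, a) = a - q + (h^2 / 2) * (mean of grad F over the segment [q, a]),
    the scheme says that h P_k = Phi(Q_k, Q_(k+1)) and that
    P_(k+1) is e^(-vh) ((2 / h) (Q_(k+1) - Q_k) - P_k) plus the noise of the step
    ([avf_step_momentum]). Suppose that X_n lies within r of (a, c). As Q_n is
    within r of c and Phi is locally Lipschitz ([momentum_map_lipschitz]),
    P_(n-1) is within O(r) of Phi(Q_(n-1), c) / h, a variable determined by
    X_(n-2), because Q_(n-1) is; hence the noise of the step n-2 is within O(r) of
    a variable that is known at time t_(n-2), which has probability O(r^m).
    Then P_n is within r of a, so the noise of the step n-1 is within r of a
    variable known at time t_(n-1), which costs another factor O(r^m)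
    ([two_step_small_ball]).

    The small ball estimate ([wiener_integral_small_ball]) is conditional on the
    past and uniform in the centre. The indicator of a ball is bounded by a
    Gaussian bump, and the integral of a bump composed with the integral of a
    step function is computed exactly, one increment after the other
    ([integral_bump_chain]); Wiener integrals are limits of these. When there
    are more than m noise vectors, the remaining components, which are confined to
    a bounded set, are cut into cells of size r ([vector_small_ball]).

    It remains to see that these variables are known at the times claimed. As
    - K bounds the Hessian from below, Phi(q, .) is monotone with constant
    1 - h^2 K / 4; for h^2 K < 4 it therefore expands distances up to a constant
    ([momentum_map_expansive]), and Q_(k+1) depends continuously on X_k
    ([position_update_continuous]). A variable that depends continuously on
    adapted ones is adapted ([adapted_continuous_dependence]). *)

(** * Absolute continuity from small cubes *)

Section DyadicCubes.
Context {R : realType} {n : nat}.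
Implicit Types (x : n.-tuple R) (z : n.-tuple int) (S : set (n.-tuple int)).

Definition dyadic_code (j : nat) x : n.-tuple int :=
  [tuple Num.floor (2 ^+ j * tnth x i) | i < n].

Definition dyadic_cube (j : nat) z : set (n.-tuple R) :=
  [set x | forall i, (tnth z i)%:~R <= 2 ^+ j * tnth x i < (tnth z i + 1)%:~R].

Lemma dyadic_codeP j x z : dyadic_cube j z x <-> dyadic_code j x = z.
Proof.
split=> [xz|<- i]; last by rewrite tnth_mktuple floor_itv.
by apply: eq_from_tnth => i; rewrite tnth_mktuple; apply/floor_def.
Qed.

Lemma measurable_dyadic_cube j z : measurable (dyadic_cube j z).
Proof.
have -> : dyadic_cube j z = \bigcap_(i in [set: 'I_n])
  ((fun x => tnth x i) @^-1` `[(tnth z i)%:~R / 2 ^+ j, (tnth z i + 1)%:~R / 2 ^+ j[).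
  apply/seteqP; split=> x /= xz i.
    by move=> _ /=; rewrite in_itv/= ler_pdivrMr ?ltr_pdivlMr ?exprn_gt0// mulrC.
  have := xz i I.
  by rewrite /= in_itv/= ler_pdivrMr ?ltr_pdivlMr ?exprn_gt0// mulrC.
apply: fin_bigcap_measurable => // i _.
by rewrite -[X in measurable X]setTI; apply: measurable_tnth => //; exact: measurable_itv.
Qed.

Lemma preimage_dyadic_code j S :
  dyadic_code j @^-1` S = \bigcup_(z in S) dyadic_cube j z.
Proof.
apply/seteqP; split=> [x Sx|x [z Sz /dyadic_codeP]]; last by move=> /= ->.
by exists (dyadic_code j x) => //; exact/dyadic_codeP.
Qed.

Lemma measurable_preimage_dyadic_code j S : measurable (dyadic_code j @^-1` S).
Proof.
rewrite preimage_dyadic_code bigcup_mkcond.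
apply: countable_bigcupT_measurable; first exact: countableP.
by move=> z; case: ifP => // _; exact: measurable_dyadic_cube.
Qed.

Lemma measure_preimage_dyadic_code (mu : {measure set (n.-tuple R) -> \bar R}) j S :
  (mu (dyadic_code j @^-1` S) =
   \sum_(k <oo) if pickle_inv k is Some z then
                  if z \in S then mu (dyadic_cube j z) else 0 else 0)%E.
Proof.
pose F k := if pickle_inv k is Some z then
  if z \in S then dyadic_cube j z else set0 else set0.
have -> : dyadic_code j @^-1` S = \bigcup_k F k.
  rewrite preimage_dyadic_code; apply/seteqP; split=> x.
    move=> [z Sz zx]; exists (pickle z) => //.
    by rewrite /F pickleK_inv mem_set.
  move=> [k _]; rewrite /F; case: pickle_inv => // z.
  by case: ifPn => // /set_mem Sz zx; exists z.
rewrite measure_bigcup//.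
- under eq_eseriesl do rewrite in_setT.
  apply: eq_eseriesr => k _.
  rewrite /F; case: pickle_inv => [z|]; last by rewrite measure0.
  by case: ifP => //; rewrite measure0.
- move=> k _; rewrite /F; case: pickle_inv => // z.
  by case: ifP => // _; exact: measurable_dyadic_cube.
- move=> k k' _ _ [x []]; rewrite /F.
  have := @pickle_invK (n.-tuple int) k; have := @pickle_invK (n.-tuple int) k'.
  case: pickle_inv => //= z' <-; case: pickle_inv => //= z <-.
  by case: ifP => // _; case: ifP => // _ /dyadic_codeP <- /dyadic_codeP <-.
Qed.

Lemma dyadic_code_refine j j' x y : (j <= j')%N ->
  dyadic_code j' x = dyadic_code j' y -> dyadic_code j x = dyadic_code j y.
Proof.
move=> /subnK <-; set e := (j' - j)%N => xy.
apply: eq_from_tnth => i; rewrite !tnth_mktuple.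
have := congr1 (fun z => tnth z i) xy; rewrite !tnth_mktuple exprD -!mulrA.
set a := 2 ^+ j * _; set b := 2 ^+ j * _ => ab.
suff main (c : R) : Num.floor c = (Num.floor (2 ^+ e * c) %/ (2 ^ e)%N%:Z)%Z.
  by rewrite main ab -main.
have e0 : (0 : int) < (2 ^ e)%N%:Z by rewrite ltz_nat expn_gt0.
have E2 : ((2 ^ e)%N%:Z)%:~R = 2 ^+ e :> R by rewrite -pmulrn natrX.
set q := (_ %/ _)%Z; apply: floor_def.
have /andP[f1 f2] := floor_itv (2 ^+ e * c).
have qe := divz_eq (Num.floor (2 ^+ e * c)) (2 ^ e)%N%:Z.
have r0 := modz_ge0 (Num.floor (2 ^+ e * c)) (lt0r_neq0 e0).
have r1 := ltz_pmod (Num.floor (2 ^+ e * c)) e0.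
apply/andP; split.
  rewrite -(@ler_pM2l _ (2 ^+ e)) ?exprn_gt0//; apply: le_trans f1.
  by rewrite -[X in X * _]E2 -intrM ler_int [leRHS]qe -/q mulrC; lia.
rewrite -(@ltr_pM2l _ (2 ^+ e)) ?exprn_gt0//; apply: lt_le_trans f2 _.
by rewrite -[X in _ <= X * _]E2 -intrM ler_int [in leLHS]qe -/q mulrDr mulr1 (mulrC q); lia.
Qed.

(** Unions of cubes of one size. They form a ring and generate the Borel sets, so
    that an inequality between measures on the cubes propagates by the monotone
    class theorem. *)
Definition dyadic_ring : set (set (n.-tuple R)) :=
  [set A | exists j S, A = dyadic_code j @^-1` S].

Lemma dyadic_ring_common A B : dyadic_ring A -> dyadic_ring B ->
  exists j S S', A = dyadic_code j @^-1` S /\ B = dyadic_code j @^-1` S'.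
Proof.
have refine j j' S : (j <= j')%N -> exists S', dyadic_code j @^-1` S = dyadic_code j' @^-1` S'.
  move=> jj'; exists [set z | exists2 x, dyadic_code j' x = z & S (dyadic_code j x)].
  apply/seteqP; split=> x /=; first by exists x.
  by move=> [y /(dyadic_code_refine jj') ->].
move=> [j [S ->]] [j' [S' ->]]; case/orP: (leq_total j j') => jj'.
  by have [S0 E] := refine _ _ S jj'; exists j', S0, S'.
by have [S0 E] := refine _ _ S' jj'; exists j, S, S0.
Qed.

Lemma setring_dyadic_ring : setring dyadic_ring.
Proof.
split.
- by exists 0%N, set0; rewrite preimage_set0.
- move=> A B dA dB; have [j [S [S' [-> ->]]]] := dyadic_ring_common dA dB.
  by exists j, (S `|` S').
- move=> A B dA dB; have [j [S [S' [-> ->]]]] := dyadic_ring_common dA dB.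
  by exists j, (S `\` S').
Qed.

Lemma measurable_sub_dyadic_ring (A : set (n.-tuple R)) :
  measurable A -> <<sr dyadic_ring >> A.
Proof.
move=> mA.
have sT : <<sr dyadic_ring>> setT.
  by apply: sub_g_sigma_ring; exists 0%N, setT; rewrite preimage_setT.
have [sr0 srD srU] := smallest_sigma_ring dyadic_ring.
have sa : sigma_algebra setT <<sr dyadic_ring>>.
  by split=> // B sB; exact: srD.
pose T' := g_sigma_algebraType dyadic_ring.
suff mid : measurable_fun setT (fun x : T' => x : n.-tuple R).
  have : <<s dyadic_ring>> A by have := mid measurableT _ mA; rewrite setTI.
  by apply: smallest_sub => //; exact: sub_g_sigma_ring.
apply/measurable_fun_tnthP => i.
apply: (measurability (@measurable_realfun.RGenCInfty.G R)).
  exact: measurable_realfun.RGenCInfty.measurableE.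
move=> _ [_ [a ->] <-]; rewrite setTI.
have -> : (@tnth n R ^~ i \o (fun x : T' => x : n.-tuple R)) @^-1` `[a, +oo[ =
  \bigcap_j (dyadic_code j @^-1` [set z | Num.floor (2 ^+ j * a) <= tnth z i]).
  apply/seteqP; split=> x /=; rewrite in_itv/= andbT => ax.
    by move=> j _ /=; rewrite tnth_mktuple le_floor// ler_pM2l// exprn_gt0.
  rewrite leNgt; apply/negP => xa.
  have [j] : exists j, 2 ^+ j * (a - tnth x i) >= 1.
    exists (Num.truncn ((a - tnth x i)^-1)).+1.
    have h := truncnS_gt (a - tnth x i)^-1.
    rewrite -ler_pdivrMr ?subr_gt0// mul1r (le_trans (ltW h))//.
    by rewrite -natrX ler_nat ltnW// ltn_expl.
  rewrite mulrBr lerBrDr addrC => ja.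
  have := ax j I; rewrite /= tnth_mktuple; apply/negP; rewrite -ltNge.
  apply: lt_le_trans (le_floor ja).
  by rewrite floorDrz ?rpred1// floor1 ltrDl.
by apply: bigcap_measurable => // j _; apply: sub_sigma_algebra; exists j; eexists.
Qed.

(** The inequality holds on the ring by countable additivity. The monotone class
    argument needs finite measures for decreasing limits, hence is run inside
    each unit cube. *)
Lemma null_of_dyadic_cubes (mu nu : {measure set (n.-tuple R) -> \bar R})
    (C : R) (A : set (n.-tuple R)) : 0 <= C ->
  (forall j z, nu (dyadic_cube j z) <= C%:E * mu (dyadic_cube j z))%E ->
  (forall j z, mu (dyadic_cube j z) < +oo)%E ->
  measurable A -> mu A = 0%E -> nu A = 0%E.
Proof.
move=> C0 numu mufin mA muA.
have mring B : dyadic_ring B -> measurable B.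
  by move=> [j [S ->]]; exact: measurable_preimage_dyadic_code.
have mcube j z := measurable_dyadic_cube j z.
(* inequality on the ring, where each member is a countable union of disjoint cubes *)
have numu_ring B : dyadic_ring B -> (nu B <= C%:E * mu B)%E.
  move=> [j [S ->]]; rewrite !measure_preimage_dyadic_code -nneseriesZl; last first.
    by move=> k _; case: pickle_inv => // z; case: ifP.
  apply: lee_nneseries => k _; case: pickle_inv => [z|] //; rewrite ?mule0//.
  - by case: ifP.
  - by case: ifP => // _; rewrite mule0.
pose G := [set B | measurable B /\
  forall z, (nu (B `&` dyadic_cube 0 z) <= C%:E * mu (B `&` dyadic_cube 0 z))%E].
have ringG : dyadic_ring `<=` G.
  move=> B dB; split=> [|z]; first exact: mring.
  have dz : dyadic_ring (dyadic_cube 0 z).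
    by exists 0%N, [set z]; apply/seteqP; split=> x /dyadic_codeP.
  have [j [S [S' [-> ->]]]] := dyadic_ring_common dB dz.
  by apply: numu_ring; exists j, (S `&` S'); rewrite preimage_setI.
have numu_lim (F : (set (n.-tuple R))^nat) B :
    (forall k, (nu (F k) <= C%:E * mu (F k))%E) ->
    (nu \o F) x @[x --> \oo] --> nu B -> (mu \o F) x @[x --> \oo] --> mu B ->
    (nu B <= C%:E * mu B)%E.
  move=> nuF cnu cmu.
  have cCmu : (C%:E * (mu \o F) x)%E @[x --> \oo] --> (C%:E * mu B)%E.
    by apply: cvgeZl.
  rewrite -(cvg_lim _ cnu)// -(cvg_lim _ cCmu)//.
  apply: lee_lim; [by apply/cvg_ex; eexists; exact: cnu|by apply/cvg_ex; eexists; exact: cCmu|].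
  by apply: nearW => k; exact: nuF.
have monoG : monotone G.
  split=> F Fmono GF.
  - have mF i : measurable (F i) by have [] := GF i.
    split=> [|z]; first exact: bigcupT_measurable.
    rewrite setI_bigcupl; apply: (numu_lim (fun k => F k `&` dyadic_cube 0 z)).
    + by move=> k; have [_] := GF k.
    + apply: nondecreasing_cvg_mu => [i||i j ij]; first exact: measurableI.
        by apply: bigcupT_measurable => i; exact: measurableI.
      by apply/subsetPset; apply: setSI; apply/subsetPset; exact: Fmono.
    + apply: nondecreasing_cvg_mu => [i||i j ij]; first exact: measurableI.
        by apply: bigcupT_measurable => i; exact: measurableI.
      by apply/subsetPset; apply: setSI; apply/subsetPset; exact: Fmono.
  - have mF i : measurable (F i) by have [] := GF i.
    split=> [|z]; first exact: bigcapT_measurable.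
    have fin0 : (mu (F 0%N `&` dyadic_cube 0 z) < +oo)%E.
      apply: le_lt_trans (mufin 0%N z); apply: le_measure; rewrite ?inE//.
      exact: measurableI.
    rewrite -bigcapIl//; apply: (numu_lim (fun k => F k `&` dyadic_cube 0 z)).
    + by move=> k; have [_] := GF k.
    + apply: nonincreasing_cvg_mu => [|i||i j ij]; last 3 first.
      * exact: measurableI.
      * by apply: bigcapT_measurable => i; exact: measurableI.
      * by apply/subsetPset; apply: setSI; apply/subsetPset; exact: Fmono.
      have [_ /(_ z) h] := GF 0%N; apply: le_lt_trans h _.
      by rewrite lte_mul_pinfty.
    + apply: nonincreasing_cvg_mu => [//|i||i j ij].
      * exact: measurableI.
      * by apply: bigcapT_measurable => i; exact: measurableI.
      * by apply/subsetPset; apply: setSI; apply/subsetPset; exact: Fmono.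
have [_ GA] : G A.
  apply: (monotone_setring_sub_g_sigma_ring monoG setring_dyadic_ring ringG).
  exact: measurable_sub_dyadic_ring.
have -> : A = \bigcup_(z in [set: n.-tuple int]) (A `&` dyadic_cube 0 z).
  by rewrite -setI_bigcupr -preimage_dyadic_code preimage_setT setIT.
have nuz z : nu (A `&` dyadic_cube 0 z) = 0%E.
  apply/eqP; rewrite eq_le measure_ge0 andbT; apply: le_trans (GA z) _.
  have -> : mu (A `&` dyadic_cube 0 z) = 0%E.
    apply/eqP; rewrite eq_le measure_ge0 andbT -[leRHS]muA.
    by apply: le_measure; rewrite ?inE//; exact: measurableI.
  by rewrite mule0.
have -> : \bigcup_z (A `&` dyadic_cube 0 z) =
    \bigcup_k (if pickle_inv k is Some z then A `&` dyadic_cube 0 z else set0).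
  apply/seteqP; split=> x [].
    by move=> z _ xz; exists (pickle z) => //; rewrite pickleK_inv.
  by move=> k _; case: pickle_inv => // z xz; exists z.
apply/negligibleP.
  apply: bigcupT_measurable => k; case: pickle_inv => // z.
  exact: measurableI.
apply: negligible_bigcup => k; case: pickle_inv => [z|]; last exact: negligible_set0.
by apply/negligibleP; [exact: measurableI|exact: nuz].
Qed.

End DyadicCubes.

Section LebesgueTuple.
Context {R : realType}.

Let cons_pair n (x : measurableTypeR R * n.-tuple R) : n.+1.-tuple R :=
  [tuple of x.1 :: x.2].

Let measurable_cons_pair n : measurable_fun setT (@cons_pair n).
Proof. by apply: measurable_cons; [exact: measurable_fst|exact: measurable_snd]. Qed.

Lemma sigma_finite_dyadic n (mu : {measure set (n.-tuple R) -> \bar R}) :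
  (forall z, mu (dyadic_cube 0 z) < +oo)%E -> sigma_finite setT mu.
Proof.
move=> mufin.
exists (fun k => if pickle_inv k is Some z then dyadic_cube 0 z else set0).
  apply/esym/seteqP; split=> // x _.
  exists (pickle (dyadic_code 0 x)) => //.
  by rewrite pickleK_inv; exact/dyadic_codeP.
move=> k; case: pickle_inv => [z|]; last by rewrite measure0.
by split=> //; exact: measurable_dyadic_cube.
Qed.

(** The iterated product is declared as a bare set function: that it is a
    sigma-finite measure and its value on cubes are obtained together, by
    induction, because each product step needs the sigma-finiteness of the
    previous one. *)
Lemma lebesgue_tuple_measure n :
  exists2 mu : {sigma_finite_measure set (n.-tuple R) -> \bar R},
    (@lebesgue_tuple R n = mu :> (set (n.-tuple R) -> \bar R)) &
    forall j z, mu (dyadic_cube j z) = ((2 ^- j) ^+ n)%:E.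
Proof.
elim: n => [|n [mu muE muc]].
  exists (\d_([tuple] : 0.-tuple R)) => // j z.
  by rewrite expr0 /= diracE mem_set// => -[].
pose prod : {measure set (measurableTypeR R * n.-tuple R)%type -> \bar R} :=
  (@lebesgue_measure R \x mu)%E.
pose nu : {measure set (n.+1.-tuple R) -> \bar R} :=
  measure_function_pushforward__canonical__measure_function_Measure
    prod (@measurable_cons_pair n).
have nuc j z : nu (dyadic_cube j z) = ((2 ^- j) ^+ n.+1)%:E.
  rewrite /= /pushforward; case/tupleP: z => z0 z.
  have -> : (@cons_pair n) @^-1` dyadic_cube j [tuple of z0 :: z] =
      `[z0%:~R / 2 ^+ j, (z0 + 1)%:~R / 2 ^+ j[%classic `*`
      dyadic_cube j z.
    apply/seteqP; split=> [[x y] /= xz|[x y] /= [xz yz] i].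
    - split=> [|i].
        have := xz ord0; rewrite /cons_pair /= !tnth0 in_itv/=.
        by rewrite ler_pdivrMr ?ltr_pdivlMr ?exprn_gt0// mulrC.
      have := xz (lift ord0 i).
      by rewrite /cons_pair /= !tnthS.
    - have [<-|i0] := eqVneq ord0 i.
        move: xz; rewrite /cons_pair /= !tnth0 in_itv/=.
        by rewrite ler_pdivrMr ?ltr_pdivlMr ?exprn_gt0// mulrC.
      have [k -> _] := unlift_some i0.
      have := yz k.
      by rewrite /cons_pair /= !tnthS.
  rewrite product_measure1E//; last exact: measurable_dyadic_cube.
  rewrite muc exprS EFinM; congr (_ * _)%E.
  apply: etrans (lebesgue_measure_itv _) _ => /=; rewrite lte_fin.
  rewrite ltr_pM2r ?invr_gt0 ?exprn_gt0// ltr_int ltrDl ltr01.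
  by rewrite -EFinD -mulrBl -intrB addrAC subrr add0r mul1r.
have sf : sigma_finite setT nu.
  by apply: sigma_finite_dyadic => z; rewrite nuc ltry.
pose H1 := @isSFinite.Build _ _ _ nu (sfinite_measure_sigma_finite sf).
pose H2 := @isSigmaFinite.Build _ _ _ nu sf.
pose nu' := HB.pack_for (sigma_finite_measure (n.+1.-tuple R) R)
  (Measure.sort nu) H1 H2.
exists nu' => //.
by apply/funext => A; rewrite /= muE.
Qed.

(** The criterion through which absolute continuity is reached: no density has to
    be exhibited, only a bound for the probability of small cubes. *)
Lemma dominates_lebesgue_tuple n (nu : {measure set (n.-tuple R) -> \bar R})
    (C : R) : 0 <= C ->
  (forall j z, nu (dyadic_cube j z) <= (C * (2 ^- j) ^+ n)%:E)%E ->
  nu `<< @lebesgue_tuple R n.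
Proof.
move=> C0 nuC A.
have [mu -> muc] := lebesgue_tuple_measure n.
move=> nA B mB BA.
apply: (@null_of_dyadic_cubes _ _ mu nu C) => //.
- by move=> j z; rewrite [X in (_ * X)%E](muc j z) -EFinM.
- by move=> j z; rewrite [X in (X < _)%E](muc j z) ltry.
- exact: nA.
Qed.

End LebesgueTuple.

(** * Integration against laws of independent variables *)

Section WeightedTransfer.
Local Open Scope ereal_scope.
Context {d1 d2} {X : measurableType d1} {Y : measurableType d2} {R : realType}.
Variables (mu : {measure set X -> \bar R}) (nu : {measure set Y -> \bar R}).
Variables (phi : X -> Y) (w : X -> R).
Hypotheses (mphi : measurable_fun setT phi) (mw : measurable_fun setT w).
Hypothesis w0 : forall x, (0 <= w x)%R.
Hypothesis wphi : forall A, measurable A ->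
  \int[mu]_x ((w x)%:E * (\1_A (phi x))%:E) = nu A.

(** A change of variables in which the image measure carries a weight: integrating
    out one factor of a product against the law of one component. *)
Lemma integral_weighted_transfer (f : Y -> \bar R) :
  measurable_fun setT f -> (forall y, 0 <= f y) ->
  \int[mu]_x ((w x)%:E * f (phi x)) = \int[nu]_y f y.
Proof.
move=> mf f0.
pose f_ := nnsfun_approx measurableT mf.
have mf_ n : measurable_fun setT (EFin \o f_ n).
  by apply/measurable_EFinP/measurable_funP.
transitivity (limn (fun n => \int[nu]_y (f_ n y)%:E)); last first.
  rewrite -monotone_convergence//.
  - apply: eq_integral => y _; apply/cvg_lim => //.
    by apply: cvg_nnsfun_approx.
  - by move=> n y _; rewrite lee_fin.
  - by move=> y _ m n mn; rewrite lee_fin; exact/lefP/nd_nnsfun_approx.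
transitivity (limn (fun n => \int[mu]_x ((w x)%:E * (f_ n (phi x))%:E))).
  rewrite -monotone_convergence//.
  - apply: eq_integral => x _; apply/esym/cvg_lim => //.
    by apply: cvgeZl => //; exact: cvg_nnsfun_approx.
  - move=> n; apply: emeasurable_funM; first exact/measurable_EFinP.
    exact: (measurableT_comp (mf_ n) mphi).
  - by move=> n x _; rewrite mule_ge0 ?lee_fin.
  - move=> x _ m n mn; apply: lee_wpmul2l; first by rewrite lee_fin.
    by rewrite lee_fin; exact/lefP/nd_nnsfun_approx.
congr (limn _); apply/funext => n.
transitivity (\sum_(k \in range (f_ n))
    \int[mu]_x ((w x)%:E * (k * \1_(f_ n @^-1` [set k]) (phi x))%:E)).
  rewrite -ge0_integral_fsum//; last 2 first.
  - move=> y; apply: emeasurable_funM; apply/measurable_EFinP => //.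
    apply: measurable_funM => //; apply: (measurableT_comp _ mphi).
    exact: measurable_indic.
  - by move=> y x _; rewrite mule_ge0 ?lee_fin ?w0// -lee_fin EFinM nnfun_muleindic_ge0.
  apply: eq_integral => x _; rewrite fimfunE -fsumEFin// ge0_mule_fsumr// => y.
  by rewrite EFinM nnfun_muleindic_ge0.
transitivity (\sum_(k \in range (f_ n))
    \int[nu]_y (k * \1_(f_ n @^-1` [set k]) y)%:E); last first.
  rewrite -ge0_integral_fsum//.
  - by apply: eq_integral => x _; rewrite fsumEFin// -fimfunE.
  - by move=> y; exact/measurable_EFinP/measurable_funM.
  - by move=> y x _; rewrite EFinM nnfun_muleindic_ge0.
apply: eq_fsbigr => r /set_mem[y _ <-].
rewrite [RHS]integralZl_indic_nnsfun// integral_indic// setIT.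
rewrite -wphi//.
under eq_integral do rewrite EFinM muleCA.
rewrite ge0_integralZl ?lee_fin//.
- apply: emeasurable_funM; apply/measurable_EFinP => //.
  by apply: (measurableT_comp _ mphi); exact: measurable_indic.
- by move=> x _; rewrite mule_ge0 ?lee_fin.
Qed.

End WeightedTransfer.

Section ProductLaw.
Context {d1} {X : measurableType d1} {R : realType} {n : nat}.
Variables (mu : {measure set X -> \bar R}) (nu : probability (measurableTypeR R) R).
Variables (V : 'I_n -> X -> R).
Hypothesis mV : forall k, measurable_fun setT (V k).
Hypothesis lawV : forall A : 'I_n -> set R, (forall k, measurable (A k)) ->
  mu [set x | forall k, A k (V k x)] = (\prod_(k < n) nu (A k))%E.

(** The factors phi_k are put in place of the indicators 1_(A_k) one index at a
    time: with all the others fixed, the hypothesis for indicators identifies a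
    weighted image measure as a multiple of nu. *)
Lemma integral_prod_law (phi : 'I_n -> R -> R) (r : 'I_n -> R) :
  (forall k, measurable_fun setT (phi k)) -> (forall k x, 0 <= phi k x) ->
  (forall k, (\int[nu]_x (phi k x)%:E = (r k)%:E)%E) ->
  (\int[mu]_x (\prod_k phi k (V k x))%:E = (\prod_k r k)%:E)%E.
Proof.
move=> mphi phi0 phir.
have nufin (B : set R) : measurable B -> nu B \is a fin_num.
  by move=> mB; apply: fin_num_measure; exact: mB.
(* the first j factors are already the functions phi_k *)
pose psi (j : nat) (A : 'I_n -> set R) (k : 'I_n) : R -> R := if (k < j)%N then phi k else \1_(A k).
pose s (j : nat) (A : 'I_n -> set R) (k : 'I_n) : R := if (k < j)%N then r k else fine (nu (A k)).
have mpsi j A : (forall k, measurable (A k)) -> forall k, measurable_fun setT (psi j A k).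
  by move=> mA k; rewrite /psi; case: ifP => // _; exact: measurable_indic.
have psi0 j A k x : 0 <= psi j A k x by rewrite /psi; case: ifP.
have s0 j A k : 0 <= s j A k.
  rewrite /s; case: ifP => _; last exact: fine_ge0.
  by rewrite -lee_fin -phir; apply: integral_ge0 => x _; rewrite lee_fin.
suff main j A : (j <= n)%N -> (forall k, measurable (A k)) ->
    (\int[mu]_x (\prod_k psi j A k (V k x))%:E = (\prod_k s j A k)%:E)%E.
  have := main n (fun=> setT) (leqnn _) (fun=> measurableT).
  rewrite (eq_bigr r) => [<-|k _]; last by rewrite /s ltn_ord.
  by apply: eq_integral => x _; congr (_%:E); apply: eq_bigr => k _; rewrite /psi ltn_ord.
elim: j A => [A _ mA|j IH A jn mA].
  have -> : (\prod_k s 0 A k)%:E = (mu [set x | forall k, A k (V k x)])%E.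
    rewrite lawV// -prodEFin; apply: eq_bigr => k _.
    by rewrite /s ltn0 fineK// nufin.
  have mAV : measurable [set x | forall k, A k (V k x)].
    have -> : [set x | forall k, A k (V k x)] = \bigcap_(k in setT) (V k @^-1` A k).
      by apply/seteqP; split=> x /= h k; [move=> _; exact: h|exact: h].
    by apply: fin_bigcap_measurable => // k _; rewrite -[X in measurable X]setTI; exact: mV.
  transitivity (\int[mu]_x (\1_[set x | forall k, A k (V k x)] x)%:E)%E; last first.
    by rewrite integral_indic// setIT.
  apply: eq_integral => x _; congr (_%:E); rewrite /psi indicE.
  have [/set_mem h|/negP h] := boolP (x \in _).
    by rewrite big1// => k _; rewrite ?ltn0 indicE mem_set.
  apply/eqP/prodf_eq0.
  have [k Ak] : exists k, ~ A k (V k x).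
    by apply/existsNP => h'; apply: h; exact/mem_set.
  by exists k => //; rewrite ?ltn0 indicE memNset.
pose k0 := Ordinal jn.
have ltSj (k : 'I_n) : k != k0 -> (k < j.+1)%N = (k < j)%N.
  by move=> kk0; rewrite ltnS [RHS]ltn_neqAle (_ : (k : nat) != j).
pose w x := \prod_(k < n | k != k0) psi j A k (V k x).
pose c := \prod_(k < n | k != k0) s j A k.
have c0 : 0 <= c by apply: prodr_ge0.
have eqw B x : \prod_(k < n | k != k0) psi j (fun k => if k == k0 then B else A k) k (V k x) = w x.
  by apply: eq_bigr => k /negPf kk0; rewrite /psi kk0.
have eqc B : \prod_(k < n | k != k0) s j (fun k => if k == k0 then B else A k) k = c.
  by apply: eq_bigr => k /negPf kk0; rewrite /s kk0.
have := @integral_weighted_transfer _ _ _ _ R mu (mscale (NngNum c0) nu) (V k0) w (mV k0).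
move=> /(_ _ _ _ (EFin \o phi k0)) H.
transitivity (\int[mu]_x ((w x)%:E * (phi k0 (V k0 x))%:E))%E.
  apply: eq_integral => x _; rewrite (bigD1 k0)//= -EFinM mulrC; congr (_ * _)%:E.
    by apply: eq_bigr => k kk0; rewrite /psi ltSj.
  by rewrite /psi ltnSn.
have mphiE : measurable_fun setT (EFin \o phi k0) by exact/measurable_EFinP.
rewrite H.
- rewrite ge0_integral_mscale//=.
  + rewrite phir -EFinM (bigD1 k0)//= mulrC; congr (_ * _)%:E.
      by rewrite /s ltnSn.
    by apply: eq_bigr => k kk0; rewrite /s ltSj.
  + by move=> x _; rewrite lee_fin.
- have -> : w = fun x => \prod_(k < n) (if k != k0 then psi j A k (V k x) else 1).
    by apply/funext => x; rewrite /w big_mkcond.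
  apply: measurable_prod => k _; case: (k != k0) => //=.
  by apply: (measurableT_comp _ (mV k)); exact: mpsi.
- by move=> x; apply: prodr_ge0.
- move=> B mB.
  have := IH (fun k => if k == k0 then B else A k) (ltnW jn).
  rewrite (bigD1 k0)//= eqc {1}/s ltnn eqxx => IHB; rewrite /mscale/=.
  rewrite -(@fineK _ (nu B)) ?nufin// -EFinM mulrC -IHB.
    apply: eq_integral => x _; rewrite (bigD1 k0)//= eqw -EFinM mulrC.
    by rewrite /psi ltnn eqxx.
  by move=> k; case: ifP.
- exact: mphiE.
- by move=> x; rewrite lee_fin.
Qed.

End ProductLaw.

(** * Gaussian bumps *)

Section GaussianBump.
Context {R : realType}.

(** An unnormalised Gaussian of variance b. It dominates a multiple of the
    indicator of a ball of radius sqrt b, and Gaussian averaging maps bumps to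
    multiples of bumps. *)
Definition bump (b x : R) : R := expR (- x ^+ 2 / (2 * b)).

Lemma bump_ge0 b x : 0 <= bump b x. Proof. exact: expR_ge0. Qed.

Lemma bump_le1 b x : 0 < b -> bump b x <= 1.
Proof.
move=> b0; rewrite -expR0 ler_expR mulNr oppr_le0.
by rewrite divr_ge0 ?sqr_ge0// mulr_ge0// ltW.
Qed.

Lemma measurable_bump b : measurable_fun setT (bump b).
Proof.
apply: measurableT_comp; first exact: measurable_expR.
apply: measurable_funM => //; apply: measurableT_comp => //.
Qed.

(** Completing the square in x. *)
Lemma normal_pdf_bump (b c y t x : R) : 0 < b -> 0 < t ->
  normal_pdf 0 (Num.sqrt t) x * bump b (y + c * x) =
  Num.sqrt (b / (b + c ^+ 2 * t)) * bump (b + c ^+ 2 * t) y *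
  normal_pdf (- (c * y * t / (b + c ^+ 2 * t)))
    (Num.sqrt (b * t / (b + c ^+ 2 * t))) x.
Proof.
move=> b0 t0.
have B0 : 0 < b + c ^+ 2 * t by rewrite ltr_wpDr// mulr_ge0 ?sqr_ge0// ltW.
rewrite !normal_pdfE ?gt_eqF ?sqrtr_gt0 ?divr_gt0 ?mulr_gt0//.
rewrite /normal_peak /normal_fun /bump !sqr_sqrtr ?divr_ge0 ?mulr_ge0 ?ltW//.
rewrite subr0.
have -> : (Num.sqrt (b * t / (b + c ^+ 2 * t) * pi *+ 2))^-1 =
    (Num.sqrt (b / (b + c ^+ 2 * t)))^-1 * (Num.sqrt (t * pi *+ 2))^-1 :> R.
  rewrite -invfM -sqrtrM ?divr_ge0 ?ltW//; congr ((Num.sqrt _)^-1).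
  by rewrite -(mulr_natr (_ * pi)) -(mulr_natr (t * pi)) -!mulrA; congr (_ * _); rewrite mulrCA.
set S := Num.sqrt (b / _); set T := (Num.sqrt (t * _ *+ 2))^-1.
have S0 : S != 0 by rewrite gt_eqF// sqrtr_gt0 divr_gt0.
have -> a1 a2 : S * a1 * (S^-1 * T * a2) = T * (a1 * a2).
  by rewrite mulrACA [S * _]mulrA divff// mul1r.
rewrite -[LHS]mulrA -!expRD; congr (_ * expR _).
have Dn : b + c ^+ 2 * t != 0 by rewrite gt_eqF.
have bn : b != 0 by rewrite gt_eqF.
have tn : t != 0 by rewrite gt_eqF.
field.
by rewrite bn tn Dn.
Qed.

Lemma integral_normal_prob (m s : R) (f : R -> \bar R) :
  measurable_fun setT f -> (forall x, 0 <= f x)%E ->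
  (\int[normal_prob m s]_x f x =
   \int[lebesgue_measure]_x ((normal_pdf m s x)%:E * f x))%E.
Proof.
move=> mf f0.
rewrite -(@integral_weighted_transfer _ _ _ _ R lebesgue_measure (normal_prob m s) id
  (normal_pdf m s))//.
- exact: measurable_normal_pdf.
- exact: normal_pdf_ge0.
- move=> A mA; rewrite /= /normal_prob [RHS]integral_mkcond.
  by rewrite epatch_indic.
Qed.

Lemma integral_normal_bump (b c y t : R) : 0 < b -> 0 < t ->
  (\int[normal_prob 0 (Num.sqrt t)]_x (bump b (y + c * x))%:E =
   (Num.sqrt (b / (b + c ^+ 2 * t)) * bump (b + c ^+ 2 * t) y)%:E)%E.
Proof.
move=> b0 t0.
have mb : measurable_fun setT (fun x => bump b (y + c * x)).
  apply: (measurableT_comp (measurable_bump b)).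
  by apply: measurable_funD => //; exact: measurable_funM.
rewrite integral_normal_prob; last 2 first.
- exact/measurable_EFinP.
- by move=> x; rewrite lee_fin bump_ge0.
under eq_integral do rewrite -EFinM normal_pdf_bump// EFinM.
rewrite ge0_integralZl//; last 2 first.
- by move=> x _; rewrite lee_fin normal_pdf_ge0.
- by rewrite lee_fin mulr_ge0 ?bump_ge0// sqrtr_ge0.
- by rewrite integral_normal_pdf mule1.
- by apply/measurable_EFinP; exact: measurable_normal_pdf.
Qed.

End GaussianBump.

(** * Conditioning on the past *)

Section ApproximateSigmaAlgebra.
Context {R : realType} {dis : measure_display} {Omega : measurableType dis}.
Variable P : probability Omega R.
Implicit Types (G : set_system Omega) (D E : set Omega).

(** Wiener integrals are limits in L^2 and fixed only up to null sets, so they need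
    not be measurable for the filtration itself; they are for its closure in the
    pseudo-distance of symmetric differences. *)
Definition prob_closure G : set_system Omega :=
  [set E | measurable E /\
    forall e : R, 0 < e -> exists2 B, G B & (P (E `+` B) <= e%:E)%E].

Lemma sub_prob_closure G : G `<=` measurable -> G `<=` prob_closure G.
Proof.
move=> Gm E GE; split=> [|e e0]; first exact: Gm.
by exists E => //; rewrite setYK measure0 lee_fin ltW.
Qed.

Lemma sigma_algebra_prob_closure G : sigma_algebra setT G ->
  G `<=` measurable -> sigma_algebra setT (prob_closure G).
Proof.
move=> [G0 GC GU] Gm; split.
- exact: sub_prob_closure.
- move=> E [mE EG]; split=> [|e e0]; first exact: measurableD.
  have [B GB PB] := EG e e0; exists (setT `\` B); first exact: GC.
  suff -> : (setT `\` E) `+` (setT `\` B) = E `+` B by [].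
  rewrite /setY; apply/seteqP; split=> x /=; case=> -[].
  + by move=> [_ nE] nB; right; split=> //; apply: contrapT => ?; exact: nB.
  + by move=> [_ nE] nB; left; split=> //; apply: contrapT => ?; exact: nB.
  + by move=> ? ?; right; split=> // -[].
  + by move=> ? ?; left; split=> // -[].
- move=> E EG; split=> [|e e0]; first by apply: bigcupT_measurable => k; have [] := EG k.
  have ek k : 0 < e / (2 ^ k.+1)%:R by rewrite divr_gt0// ltr0n expn_gt0.
  have [B BP] := choice (fun k => let: ex_intro2 B GB PB := (EG k).2 _ (ek k) in
    ex_intro (fun B => G B /\ (P (E k `+` B) <= (e / (2 ^ k.+1)%:R)%:E)%E) B (conj GB PB)).
  exists (\bigcup_k B k); first by apply: GU => k; have [] := BP k.
  have mE k : measurable (E k) by have [] := EG k.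
  have mB k : measurable (B k) by apply: Gm; have [] := BP k.
  have mY k : measurable (E k `+` B k) by apply: measurableU; apply: measurableD.
  apply: le_trans (_ : P (\bigcup_k (E k `+` B k)) <= _)%E.
    apply: le_measure; rewrite ?inE//.
    - by apply: measurableU; apply: measurableD; exact: bigcupT_measurable.
    - exact: bigcupT_measurable.
    - move=> x [[[k _ xk] nB]|[[k _ xk] nE]]; exists k => //.
      + by left; split=> // Bk; apply: nB; exists k.
      + by right; split=> // Ek; apply: nE; exists k.
  apply: le_trans (measure_sigma_subadditive P mY _ (@subset_refl _ _)) _.
    exact: bigcupT_measurable.
  apply: le_trans (_ : \sum_(k <oo) (e / (2 ^ k.+1)%:R)%:E <= _)%E.
    by apply: lee_nneseries => // k _; have [] := BP k.
  exact/epsilon_trick0/ltW.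
Qed.

(** Both sides of the product formula are continuous for symmetric differences. *)
Lemma indep_prob_closure G D : measurable D -> G `<=` measurable ->
  (forall B, G B -> P (B `&` D) = P B * P D)%E ->
  forall E, prob_closure G E -> (P (E `&` D) = P E * P D)%E.
Proof.
move=> mD Gm ind E [mE EG].
have pE A : measurable A -> P A = (fine (P A))%:E.
  by move=> mA; rewrite fineK// fin_num_measure.
have mED : measurable (E `&` D) by exact: measurableI.
rewrite (pE _ mED) (pE _ mE) (pE _ mD) -EFinM; congr (_%:E).
apply/eqP; rewrite -subr_eq0 -normr_le0; apply/ler_addgt0Pl => e e0; rewrite addr0.
have e20 : 0 < e / 2 by rewrite divr_gt0.
have [B GB PB] := EG _ e20.
have mB := Gm _ GB.
have mBD : measurable (B `&` D) by exact: measurableI.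
have mY : measurable (E `+` B) by apply: measurableU; apply: measurableD.
have close A A' : measurable A -> measurable A' -> A `+` A' `<=` E `+` B ->
    `|fine (P A) - fine (P A')| <= e / 2.
  have one A1 A2 : measurable A1 -> measurable A2 -> A1 `\` A2 `<=` E `+` B ->
      fine (P A1) <= fine (P A2) + e / 2.
    move=> m1 m2 sub; rewrite -lee_fin EFinD -!pE//.
    apply: le_trans (_ : P (A2 `|` (E `+` B)) <= _)%E.
      apply: le_measure; rewrite ?inE//; first exact: measurableU.
      by move=> x xA1; case: (pselect (A2 x)) => xA2; [left|right; exact: sub].
    by apply: le_trans (measureU2 _ _ _) _ => //; exact: leeD2l.
  move=> mA mA' sub; rewrite ler_distlC; apply/andP; split.
    by rewrite lerBlDr; apply: one => // x xx; apply: sub; left.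
  by apply: one => // x xx; apply: sub; right.
have D1 : fine (P D) <= 1 by rewrite -lee_fin -pE// probability_le1.
have D0 : 0 <= fine (P D) by exact: fine_ge0.
have BD : fine (P (B `&` D)) = fine (P B) * fine (P D) by rewrite ind// fineM// fin_num_measure.
have h1 : `|fine (P (E `&` D)) - fine (P (B `&` D))| <= e / 2.
  by apply: close => // x [[[xE xD] nBD]|[[xB xD] nED]]; [left|right]; split=> // ?;
    [apply: nBD|apply: nED].
have h2 : `|fine (P E) - fine (P B)| <= e / 2 by apply: close.
rewrite (splitr e) (_ : _ - _ = (fine (P (E `&` D)) - fine (P (B `&` D))) -
   (fine (P E) - fine (P B)) * fine (P D)); last by rewrite BD; ring.
apply: le_trans (ler_normB _ _) _; apply: lerD => //.
by rewrite normrM (ger0_norm D0) (le_trans _ h2)// ler_piMr.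
Qed.

End ApproximateSigmaAlgebra.

Section Freezing.
Context {R : realType} {dis : measure_display} {Omega : measurableType dis}.
Variable P : probability Omega R.
Variable G : set_system Omega.
Hypothesis sG : sigma_algebra setT G.
Hypothesis Gm : G `<=` measurable.

Local Notation OG := (g_sigma_algebraType G).

Lemma measurable_gE (A : set OG) : measurable A <-> G A.
Proof. by rewrite /measurable/= sigma_algebra_id. Qed.

Lemma measurable_to_g : measurable_fun setT (id : Omega -> OG).
Proof. by move=> _ A /measurable_gE GA; rewrite setTI; exact: Gm. Qed.

Lemma measurable_fun_of_g d2 (T2 : measurableType d2) (f : Omega -> T2) :
  measurable_fun setT (f : OG -> T2) -> measurable_fun setT f.
Proof. by move=> mf; exact: (measurableT_comp mf measurable_to_g). Qed.

(** By independence the joint law of (w, V w), its first component being seen in the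
    sigma-algebra G, is a product measure; this is Tonelli for it. *)
Lemma integral_freeze d2 (T2 : measurableType d2) (V : Omega -> T2)
    (g : OG * T2 -> \bar R) :
  measurable_fun setT V ->
  (forall B A, G B -> measurable A ->
     P (B `&` V @^-1` A) = P B * P (V @^-1` A))%E ->
  measurable_fun setT g -> (forall x, 0 <= g x)%E ->
  (\int[P]_w g (w, V w) = \int[P]_w \int[P]_u g (w, V u))%E.
Proof.
move=> mV ind mg g0.
pose idm := mfun_Sub (mem_set measurable_to_g) : {mfun Omega >-> OG}.
pose Vm := mfun_Sub (mem_set mV) : {mfun Omega >-> T2}.
have mpair : measurable_fun setT (fun w => (w, V w) : OG * T2).
  exact: (measurable_fun_pair measurable_to_g mV).
pose pairm := mfun_Sub (mem_set mpair) : {mfun Omega >-> (OG * T2)%type}.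
have Hprod : forall A, measurable A ->
    (distribution P idm \x distribution P Vm)%E A = distribution P pairm A.
  move=> A mA; apply: product_measure_unique => //= B C mB mC.
  rewrite /distribution /pushforward /=.
  exact/ind/mC/measurable_gE.
transitivity (\int[distribution P pairm]_x g x)%E.
  by rewrite ge0_integral_distribution.
transitivity (\int[distribution P idm \x distribution P Vm]_x g x)%E.
  by apply: eq_measure_integral => A mA _; exact/esym/Hprod.
rewrite fubini_tonelli1//= /fubini_F ge0_integral_distribution//=.
- apply: eq_integral => w _.
  rewrite ge0_integral_distribution//.
  exact: measurableT_comp.
- exact: (measurable_fun_fubini_tonelli_F (m2 := distribution P Vm)).
- by move=> w; apply: integral_ge0.
Qed.

End Freezing.

Section BumpIncrement.
Context {R : realType} {dis : measure_display} {Omega : measurableType dis}.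
Variable P : probability Omega R.

Lemma integral_bump_increment (G : set_system Omega) d (V : Omega -> d.-tuple R)
    (t : R) (E : set Omega) (Y : 'I_d -> Omega -> R) (b c : 'I_d -> R) :
  sigma_algebra setT G -> G `<=` measurable ->
  0 < t -> measurable_fun setT V ->
  (forall B A, G B -> measurable A ->
     P (B `&` V @^-1` A) = P B * P (V @^-1` A))%E ->
  (forall A : 'I_d -> set R, (forall k, measurable (A k)) ->
     P [set w | forall k, A k (tnth (V w) k)] =
     (\prod_(k < d) normal_prob 0 (Num.sqrt t) (A k))%E) ->
  G E -> (forall k, measurable_fun setT (Y k : g_sigma_algebraType G -> R)) ->
  (forall k, 0 < b k) ->
  (\int[P]_w (\1_E w * \prod_k bump (b k) (Y k w + c k * tnth (V w) k))%:E =
   (\prod_k Num.sqrt (b k / (b k + c k ^+ 2 * t)))%:E *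
   \int[P]_w (\1_E w * \prod_k bump (b k + c k ^+ 2 * t) (Y k w))%:E)%E.
Proof.
move=> sG Gm t0 mV ind lawV GE mY b0.
pose OG := g_sigma_algebraType G.
pose g (x : OG * d.-tuple R) :=
  (\1_E x.1 * \prod_k bump (b k) (Y k x.1 + c k * tnth x.2 k))%:E.
have mE : measurable (E : set OG) by exact/measurable_gE.
have mE1 : measurable_fun setT (\1_E : OG -> R) by exact: measurable_indic.
have mg : measurable_fun setT g.
  apply/measurable_EFinP; apply: measurable_funM.
    exact: (measurableT_comp mE1 measurable_fst).
  apply: measurable_prod => k _; apply: (measurableT_comp (measurable_bump _)).
  apply: measurable_funD; first exact: (measurableT_comp (mY k) measurable_fst).
  apply: measurable_funM => //.
  exact: (measurableT_comp (measurable_tnth k) measurable_snd).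
have g0 x : (0 <= g x)%E.
  by rewrite lee_fin mulr_ge0//; apply: prodr_ge0 => k _; exact: bump_ge0.
have bt0 k : 0 < b k + c k ^+ 2 * t by rewrite ltr_wpDr// mulr_ge0 ?sqr_ge0// ltW.
rewrite (@integral_freeze _ _ _ P G sG Gm _ _ V g mV ind mg g0) /g /=.
transitivity (\int[P]_w ((\prod_k Num.sqrt (b k / (b k + c k ^+ 2 * t)))%:E *
    (\1_E w * \prod_k bump (b k + c k ^+ 2 * t) (Y k w))%:E))%E.
  apply: eq_integral => w _.
  transitivity ((\1_E w)%:E * (\int[P]_u
      (\prod_k bump (b k) (Y k w + c k * tnth (V u) k))%:E))%E.
    rewrite -ge0_integralZl//.
    - by apply/measurable_EFinP; apply: measurable_prod => k _;
        apply: (measurableT_comp (measurable_bump _)); apply: measurable_funD => //;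
        apply: measurable_funM => //; exact: (measurableT_comp (measurable_tnth k) mV).
    - by move=> u _; rewrite lee_fin; apply: prodr_ge0 => k _; exact: bump_ge0.
  rewrite (@integral_prod_law _ _ R d P (normal_prob 0 (Num.sqrt t))
    (fun k u => tnth (V u) k) _ lawV
    (fun k x => bump (b k) (Y k w + c k * x))
    (fun k => Num.sqrt (b k / (b k + c k ^+ 2 * t)) * bump (b k + c k ^+ 2 * t) (Y k w))).
  - by rewrite big_split /= -!EFinM mulrCA.
  - by move=> k; exact: (measurableT_comp (measurable_tnth k) mV).
  - move=> k; apply: (measurableT_comp (measurable_bump _)).
    by apply: measurable_funD => //; exact: measurable_funM.
  - by move=> k x; exact: bump_ge0.
  - by move=> k; exact: integral_normal_bump.
rewrite ge0_integralZl//.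
- apply: (measurable_fun_of_g sG Gm); apply/measurable_EFinP; apply: measurable_funM.
    exact: measurable_indic.
  by apply: measurable_prod => k _; exact: (measurableT_comp (measurable_bump _) (mY k)).
- by move=> w _; rewrite lee_fin mulr_ge0//; apply: prodr_ge0 => k _; exact: bump_ge0.
- by rewrite lee_fin; apply: prodr_ge0 => k _; exact: sqrtr_ge0.
Qed.

End BumpIncrement.

(** * Wiener increments along a partition *)

Section WienerChain.
Context {R : realType} {dis : measure_display} {Omega : measurableType dis}.
Variable P : probability Omega R.
Variables (Ft : R -> set_system Omega) (d : nat) (W : 'I_d -> R -> {RV P >-> R}).
Hypotheses (hFt : filtration Ft) (hW : wiener_process W Ft).
Implicit Types (s t u : R) (us : seq R).

Definition past s : set_system Omega := prob_closure P (Ft s).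

Definition adapted s (Y : Omega -> R) : Prop :=
  measurable_fun setT (Y : g_sigma_algebraType (past s) -> R).

Lemma sigma_algebra_past s : 0 <= s -> sigma_algebra setT (past s).
Proof. by move=> s0; apply: sigma_algebra_prob_closure; have [] := hFt.1 s s0. Qed.

Lemma past_measurable s : past s `<=` measurable. Proof. by move=> E []. Qed.

Lemma past_mono s t : 0 <= s -> s <= t -> past s `<=` past t.
Proof.
move=> s0 st E [mE EG]; split=> // e e0; have [B FB PB] := EG e e0.
by exists B => //; exact: hFt.2 s0 st B FB.
Qed.

Lemma measurable_pastP s (E : set (g_sigma_algebraType (past s))) :
  0 <= s -> measurable E <-> past s E.
Proof. by move=> s0; apply: measurable_gE; exact: sigma_algebra_past. Qed.

Lemma adapted_mono s t Y : 0 <= s -> s <= t -> adapted s Y -> adapted t Y.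
Proof.
move=> s0 st aY _ A mA; rewrite setTI; apply/(measurable_pastP _ (le_trans s0 st)).
apply: (past_mono s0 st); apply/(measurable_pastP _ s0).
by rewrite -[X in measurable X]setTI; exact: aY.
Qed.

Lemma adapted_W s t k : 0 <= t -> t <= s -> adapted s (W k t).
Proof.
move=> t0 ts; apply: (adapted_mono t0 ts) => _ A mA; rewrite setTI.
apply/(measurable_pastP _ t0); apply: sub_prob_closure.
  by have [] := hFt.1 t t0.
by have [h _ _ _ _] := hW; exact: h.
Qed.

Lemma measurable_adapted s Y : 0 <= s -> adapted s Y -> measurable_fun setT Y.
Proof.
by move=> s0; apply: (@measurable_fun_of_g _ _ _ (sigma_algebra_past s0) (@past_measurable s)).
Qed.

Lemma measurable_increment s t : measurable_fun setT (increment W s t).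
Proof.
apply/measurable_fun_tnthP => k.
rewrite (_ : _ \o _ = (fun w => W k t w - W k s w)); last first.
  by apply/funext => w; rewrite /= tnth_mktuple.
by apply: measurable_funB; exact: measurable_funP.
Qed.

Lemma increment_indep s t B A : 0 <= s -> s < t -> past s B -> measurable A ->
  (P (B `&` increment W s t @^-1` A) = P B * P (increment W s t @^-1` A))%E.
Proof.
move=> s0 st pB mA; apply: indep_prob_closure pB.
- by rewrite -[X in measurable X]setTI; exact: measurable_increment.
- by have [] := hFt.1 s s0.
- by move=> B' FB'; have [_ _ _ h _] := hW; exact: h.
Qed.

(** The integral of a step function c over a partition s < u_1 < ... < u_n and
    its variance; the value of c on an interval is read at the right endpoint,
    since step functions are built from intervals closed on the right. *)
Fixpoint chain_sum (B : R -> R) (c : R -> R) s us : R :=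
  if us is u :: us' then c u * (B u - B s) + chain_sum B c u us' else 0.

Fixpoint chain_var (c : R -> R) s us : R :=
  if us is u :: us' then c u ^+ 2 * (u - s) + chain_var c u us' else 0.

Lemma chain_var_ge0 c s us : path <%R s us -> 0 <= chain_var c s us.
Proof.
elim: us s => //= u us IH s /andP[su pu]; rewrite addr_ge0 ?IH//.
by rewrite mulr_ge0 ?sqr_ge0// subr_ge0 ltW.
Qed.

(** The last increment is independent of the rest and is integrated first, which
    turns a bump of variance b into one of variance b plus that of the increment;
    iterating, the constants telescope. *)
Lemma integral_bump_chain us s (E : set Omega) (Y : 'I_d -> Omega -> R)
    (b : 'I_d -> R) (c : 'I_d -> R -> R) :
  0 <= s -> path <%R s us -> past s E -> (forall k, adapted s (Y k)) ->
  (forall k, 0 < b k) ->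
  (\int[P]_w (\1_E w *
     \prod_k bump (b k) (Y k w + chain_sum (fun t => W k t w) (c k) s us))%:E =
   (\prod_k Num.sqrt (b k / (b k + chain_var (c k) s us)))%:E *
   \int[P]_w (\1_E w * \prod_k bump (b k + chain_var (c k) s us) (Y k w))%:E)%E.
Proof.
elim: us s E Y b => [|u us IH] s E Y b s0 /=.
  move=> _ pE aY b0.
  rewrite big1 ?mul1e; last by move=> k _; rewrite addr0 divff ?sqrtr1// gt_eqF.
  by apply: eq_integral => w _; congr (_ * _)%:E; apply: eq_bigr => k _; rewrite !addr0.
move=> /andP[su pu] pE aY b0.
have u0 : 0 <= u by rewrite (le_trans s0)// ltW.
have v0 k := chain_var_ge0 (c k) pu.
have bv0 k : 0 < b k + chain_var (c k) u us by rewrite ltr_pwDl.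
transitivity (\int[P]_w (\1_E w * \prod_k bump (b k)
   ((Y k w + c k u * (W k u w - W k s w)) +
     chain_sum (fun t => W k t w) (c k) u us))%:E)%E.
  by apply: eq_integral => w _; congr (_ * _)%:E; apply: eq_bigr => k _; rewrite addrA.
rewrite (IH u E (fun k w => Y k w + c k u * (W k u w - W k s w)))//; last 2 first.
- exact: (past_mono s0 (ltW su)).
- move=> k; apply: measurable_funD; first exact: (adapted_mono s0 (ltW su)).
  apply: measurable_funM => //; apply: measurable_funB; first exact: adapted_W.
  by apply: adapted_W => //; exact: ltW.
have := @integral_bump_increment _ _ _ P (past s) d (increment W s u) (u - s) E Y
  (fun k => b k + chain_var (c k) u us) (fun k => c k u) (sigma_algebra_past s0)
  (@past_measurable s).
move=> /(_ _ (measurable_increment s u) _ _ pE aY bv0) H.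
have -> : (\int[P]_w (\1_E w * \prod_k bump (b k + chain_var (c k) u us)
      (Y k w + c k u * (W k u w - W k s w)))%:E =
    \int[P]_w (\1_E w * \prod_k bump (b k + chain_var (c k) u us)
      (Y k w + c k u * tnth (increment W s u w) k))%:E)%E.
  apply: eq_integral => w _; congr (_ * _)%:E; apply: eq_bigr => k _.
  by rewrite tnth_mktuple.
rewrite H ?subr_gt0//; last 2 first.
- by move=> B A pB mA; exact: increment_indep.
- by move=> A mA; have [_ _ _ _ h] := hW; exact: h.
rewrite muleA -EFinM -big_split/=; congr (_%:E * _)%E.
  apply: eq_bigr => k _; rewrite -sqrtrM; last by rewrite divr_ge0// ltW.
  congr Num.sqrt; rewrite mulrA divfK ?gt_eqF//.
  by rewrite -addrA [_ * _ + _]addrC.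
apply: eq_integral => w _; congr (_ * _)%:E; apply: eq_bigr => k _.
by rewrite -addrA [_ * _ + _]addrC.
Qed.

End WienerChain.

Section StepFunctions.
Context {R : realType}.
Implicit Types (a b s t u x : R) (us : seq R) (p : step (R := R)) (B c : R -> R).

Lemma path_le_last s us x : path <%R s us -> x \in s :: us -> x <= last s us.
Proof.
elim: us s x => [|u us IH] s x /=; first by rewrite inE => _ /eqP ->.
move=> /andP[su pu]; rewrite inE => /predU1P[->|xu]; last exact: IH.
by apply: le_trans (ltW su) _; apply: IH => //; rewrite mem_head.
Qed.

Lemma path_lt_mem s us x : path <%R s us -> x \in us -> s < x.
Proof.
by move=> /(order_path_min lt_trans)/allP h xu; exact: h.
Qed.

Lemma exists_partition a b (S : seq R) : a < b -> all (fun x => a <= x <= b) S ->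
  exists us, [/\ path <%R a us, last a us = b & {subset S <= a :: us}].
Proof.
move=> ab /allP Sab.
pose us := sort <=%R (undup (b :: [seq x <- S | a < x])).
have mus x : x \in us = (x == b) || (a < x) && (x \in S).
  by rewrite mem_sort mem_undup inE mem_filter.
have pus : path <%R a us.
  rewrite path_sortedE; last exact: lt_trans.
  rewrite sort_lt_sorted undup_uniq andbT; apply/allP => x.
  by rewrite mus => /predU1P[->//|/andP[]].
exists us; split=> //.
- apply/eqP; rewrite eq_le path_le_last ?inE ?mus ?eqxx ?orbT// andbT.
  have : last a us \in a :: us by rewrite mem_last.
  rewrite inE => /predU1P[->|]; first exact: ltW.
  by rewrite mus => /predU1P[->//|/andP[_ /Sab/andP[]]].
- move=> x xS; rewrite inE mus xS andbT.
  by have /andP[+ _] := Sab _ xS; rewrite le_eqVlt eq_sym => /predU1P[->|->];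
    rewrite ?eqxx ?orbT.
Qed.

(** The indicator of t <= x integrates to B x - B s; differences of such indicators
    are those of the intervals of a step function. *)
Lemma chain_sum_le B s us x : path <%R s us -> x \in s :: us ->
  chain_sum B (fun t => (t <= x)%R%:R) s us = B x - B s.
Proof.
elim: us s => [|u us IH] s /=.
  by rewrite inE => _ /eqP ->; rewrite subrr.
move=> /andP[su pu]; rewrite inE => /predU1P[->|xu].
  rewrite leNgt su mul0r add0r subrr.
  have z s' us' : path <%R s' us' -> s <= s' ->
      chain_sum B (fun t => (t <= s)%R%:R) s' us' = 0.
    elim: us' s' => //= u' us' IH' s' /andP[su' pu'] ss'.
    have h : s < u' by exact: le_lt_trans su'.
    by rewrite leNgt h mul0r add0r IH'// ltW.
  by rewrite z// ltW.
rewrite IH// (_ : u <= x) ?mul1r; first by rewrite addrC addrA subrK.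
move: xu; rewrite inE => /predU1P[->//|xu].
exact/ltW/(path_lt_mem pu).
Qed.

(** With ordered endpoints, an interval is a difference of two half-lines; the
    latter are determined by one point of the partition each. *)
Lemma step_funE p t :
  (forall q, q \in p -> q.2.1 <= q.2.2) ->
  step_fun p t = \sum_(q <- p) q.1 * ((t <= q.2.2)%R%:R - (t <= q.2.1)%R%:R).
Proof.
move=> pq; rewrite /step_fun !big_seq; apply: eq_bigr => q /pq q12.
congr (_ * _); rewrite indicE.
have [/set_mem|/negP h] := boolP (t \in _).
  rewrite /= in_itv/= => /andP[h1 h2].
  by rewrite h2 leNgt h1 subr0.
have {h} : ~~ (q.2.1 < t <= q.2.2).
  by apply/negP => h'; apply: h; apply/mem_set; rewrite /= in_itv.
rewrite negb_and -leNgt -ltNge => /orP[h|h].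
  by rewrite h (le_trans h)// subrr.
by rewrite [t <= q.2.2]leNgt h [t <= q.2.1]leNgt (le_lt_trans q12)// subrr.
Qed.

Lemma eq_chain_sum B c c' s us : c =1 c' -> chain_sum B c s us = chain_sum B c' s us.
Proof. by move=> cc'; elim: us s => //= u us IH s; rewrite cc' IH. Qed.

Lemma chain_sum_linear B s us (I : Type) (r : seq I) (g : I -> R) (f : I -> R -> R) :
  chain_sum B (fun t => \sum_(i <- r) g i * f i t) s us =
  \sum_(i <- r) g i * chain_sum B (f i) s us.
Proof.
elim: us s => [|u us IH] s /=; first by rewrite big1// => i _; rewrite mulr0.
rewrite IH mulr_suml -big_split; apply: eq_bigr => i _ /=.
by rewrite [RHS]mulrDr mulrA.
Qed.

Lemma chain_sumB B c c' s us :
  chain_sum B (fun t => c t - c' t) s us = chain_sum B c s us - chain_sum B c' s us.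
Proof.
elim: us s => [|u us IH] s /=; first by rewrite subr0.
by rewrite IH mulrBl opprD addrACA.
Qed.

Lemma sum_step_chain B p s us : path <%R s us ->
  (forall q, q \in p -> [/\ q.2.1 <= q.2.2, q.2.1 \in s :: us & q.2.2 \in s :: us]) ->
  \sum_(q <- p) q.1 * (B q.2.2 - B q.2.1) = chain_sum B (step_fun p) s us.
Proof.
move=> pus pq.
rewrite (@eq_chain_sum _ _ (fun t =>
  \sum_(q <- p) q.1 * ((t <= q.2.2)%R%:R - (t <= q.2.1)%R%:R))); last first.
  by move=> t; rewrite step_funE// => q /pq[].
rewrite (@chain_sum_linear B s us _ p (fun q => q.1)
  (fun q t => (t <= q.2.2)%R%:R - (t <= q.2.1)%R%:R)).
rewrite !big_seq; apply: eq_bigr => q /pq[q12 q1 q2]; congr (_ * _).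
by rewrite chain_sumB !chain_sum_le// opprB addrA subrK.
Qed.

Lemma measurable_step_fun p : measurable_fun setT (step_fun p).
Proof.
by apply: measurable_sum => q; exact: measurable_funM.
Qed.

(** A step function close to f in L^2 has a variance bounded below: integrate
    kappa^2 <= f^2 <= 2 (f - c)^2 + 2 c^2, where c is constant on each interval
    of the partition. *)
Lemma chain_var_lower (f : R -> R) (kappa : R) p s us :
  measurable_fun setT f -> 0 <= kappa ->
  (forall t, s < t -> t <= last s us -> kappa <= f t) ->
  path <%R s us ->
  (forall q, q \in p -> [/\ q.2.1 <= q.2.2,
     (q.2.1 <= s) || (q.2.1 \in us) & (q.2.2 <= s) || (q.2.2 \in us)]) ->
  ((kappa ^+ 2 * (last s us - s))%:E <=
   2%:E * \int[lebesgue_measure]_(t in `]s, last s us]) ((f t - step_fun p t) ^+ 2)%:E +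
   (2 * chain_var (step_fun p) s us)%:E)%E.
Proof.
move=> mf k0.
have msq D : measurable D -> measurable_fun D (fun t => ((f t - step_fun p t) ^+ 2)%:E).
  move=> mD; apply/measurable_EFinP; apply: (measurable_funS measurableT) => //.
  apply: measurable_funX; apply: measurable_funB => //; exact: measurable_step_fun.
elim: us s => [|u us IH] s /=.
  move=> _ _ _; rewrite subrr !mulr0 adde0 mule_ge0//.
  by apply: integral_ge0 => t _; rewrite lee_fin sqr_ge0.
move=> fk /andP[su pu] pq.
have ul : u <= last u us by apply: path_le_last => //; exact: mem_head.
have cst_c t : s < t -> t <= u -> step_fun p t = step_fun p u.
  move=> st tu; rewrite !step_funE; [|by move=> q /pq[]..].
  have key x : (x <= s) || (x \in u :: us) -> (t <= x) = (u <= x).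
    case/orP => [xs|]; first by rewrite !leNgt (le_lt_trans xs st) (le_lt_trans xs su).
    rewrite inE => /predU1P[->|xu]; first by rewrite tu lexx.
    have ux := path_lt_mem pu xu.
    by rewrite (ltW ux) (le_trans tu (ltW ux)).
  rewrite !big_seq; apply: eq_bigr => q /pq[_ /key -> /key ->//].
have split_itv : `]s, last u us]%classic = `]s, u] `|` `]u, last u us] :> set R.
  by rewrite -itv_bndbnd_setU ?bnd_simp// ltW.
rewrite split_itv ge0_integral_setU//=; last 3 first.
- by apply: msq; exact: measurableU.
- by move=> t _; rewrite lee_fin sqr_ge0.
- apply/disj_setPRL => t /=; rewrite !in_itv/= => /andP[ut _].
  by apply/negP; rewrite negb_and -ltNge ut orbT.
have IHu : ((kappa ^+ 2 * (last u us - u))%:E <=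
   2%:E * \int[lebesgue_measure]_(t in `]u, last u us]) ((f t - step_fun p t) ^+ 2)%:E +
   (2 * chain_var (step_fun p) u us)%:E)%E.
  apply: IH => // [t ut tl|q /pq[q12 q1 q2]].
    by apply: fk => //; exact: lt_trans ut.
  have key x : (x <= s) || (x \in u :: us) -> (x <= u) || (x \in us).
    case/orP => [xs|]; first by rewrite (le_trans xs)// ltW.
    by rewrite inE => /predU1P[->|->]; rewrite ?lexx ?orbT.
  by split=> //; exact: key.
have leb : lebesgue_measure (`]s, u]%classic : set R) = (u - s)%:E.
  by rewrite lebesgue_measure_itv/= lte_fin su -EFinB.
have first_piece : ((kappa ^+ 2 * (u - s))%:E <=
   2%:E * \int[lebesgue_measure]_(t in `]s, u]) ((f t - step_fun p t) ^+ 2)%:E +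
   (2 * (step_fun p u ^+ 2 * (u - s)))%:E)%E.
  pose k2 t : R := 2 * step_fun p u ^+ 2.
  apply: (@le_trans _ _ (\int[lebesgue_measure]_(t in `]s, u])
    (2%:E * ((f t - step_fun p t) ^+ 2)%:E + (2 * step_fun p u ^+ 2)%:E))%E).
    rewrite EFinM -leb -integral_cst//; apply: ge0_le_integral => //.
    - by move=> t _; rewrite lee_fin sqr_ge0.
    - apply: emeasurable_funD => //; apply: emeasurable_funM => //; exact: msq.
    - move=> t /=; rewrite in_itv/= => /andP[st tu].
      rewrite -EFinM -EFinD lee_fin -(cst_c t st tu).
      apply: le_trans (_ : f t ^+ 2 <= _).
        by rewrite lerXn2r ?nnegrE ?(le_trans k0)// fk// (le_trans tu).
      have := sqr_ge0 (f t - 2 * step_fun p t).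
      by set x := f t; set y := step_fun p t => h; nra.
  rewrite ge0_integralD//; last 3 first.
  - by move=> t _; rewrite -EFinM lee_fin mulr_ge0// sqr_ge0.
  - by apply: emeasurable_funM => //; exact: msq.
  - by move=> t _; rewrite lee_fin mulr_ge0// sqr_ge0.
  rewrite ge0_integralZl//.
  - by apply: leeD2l; rewrite integral_cst// [X in (_ * X)%E]leb -EFinM mulrA.
  - exact: msq.
  - by move=> t _; rewrite lee_fin sqr_ge0.
have I0 (D : set R) : (0 <= \int[lebesgue_measure]_(t in D) ((f t - step_fun p t) ^+ 2)%:E)%E.
  by apply: integral_ge0 => t _; rewrite lee_fin sqr_ge0.
rewrite ge0_muleDr//.
have := leeD first_piece IHu.
rewrite -EFinD -mulrDr [(u - s) + _]addrC addrA subrK => /le_trans; apply.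
by rewrite addeACA -EFinD -mulrDr.
Qed.

End StepFunctions.

(** * Small balls for Wiener integrals *)

Lemma cvge_le_eventually (R : realType) (u : nat -> \bar R) (l : R) (e : R) :
  u n @[n --> \oo] --> l%:E -> l < e ->
  exists N, forall n, (N <= n)%N -> (u n <= e%:E)%E.
Proof.
move=> ul le.
have : nbhs l%:E [set y : \bar R | (y < e%:E)%E].
  suff : nbhs l [set x : R | x%:E < e%:E]%E by [].
  apply: (@cvgr_lt _ _ (nbhs l) _ id l) le; exact: cvg_id.
by move=> /ul[N _ h]; exists N => n Nn; apply/ltW/h.
Qed.

Section WienerIntegral.
Context {R : realType} {dis : measure_display} {Omega : measurableType dis}.
Variable P : probability Omega R.

(** Chebyshev's inequality. *)
Lemma prob_second_moment (Z : Omega -> R) (e v : R) :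
  measurable_fun setT Z -> 0 < e ->
  ('E_P[fun w => (Z w ^+ 2)%R] <= (e ^+ 2 * v)%:E)%E ->
  (P [set w | (e <= `|Z w|)%R] <= v%:E)%E.
Proof.
move=> mZ e0; rewrite unlock => EZ.
have mD : measurable [set w | e <= `|Z w|].
  rewrite -[X in measurable X]setTI; apply: measurable_fun_le => //.
  exact: measurableT_comp.
have mZ2 : measurable_fun setT (fun w => (Z w ^+ 2)%:E).
  by apply/measurable_EFinP; exact: measurable_funX.
rewrite -(@lee_pmul2l _ (e ^+ 2)%:E) ?lte_fin ?exprn_gt0// -EFinM.
apply: le_trans EZ; rewrite -integral_cst//.
apply: (@le_trans _ _ (\int[P]_(w in [set w | (e <= `|Z w|)%R]) (Z w ^+ 2)%:E)%E).
  apply: ge0_le_integral => //.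
  - by move=> w _; rewrite lee_fin sqr_ge0.
  - exact: (measurable_funS measurableT).
  - by move=> w /= ew; rewrite lee_fin -[leRHS]real_normK ?num_real// lerXn2r// nnegrE ltW.
by apply: ge0_subset_integral => // w _; rewrite lee_fin sqr_ge0.
Qed.

Lemma prob_closure_idem (G : set_system Omega) (E : set Omega) :
  G `<=` measurable -> prob_closure P (prob_closure P G) E -> prob_closure P G E.
Proof.
move=> Gm [mE EG]; split=> // e e0.
have e20 : 0 < e / 2 by rewrite divr_gt0.
have [B [mB BG] PB] := EG _ e20; have [D GD PD] := BG _ e20.
exists D => //; have mD := Gm _ GD.
have mY A A' : measurable A -> measurable A' -> measurable (A `+` A' : set Omega).
  by move=> mA mA'; apply: measurableU; exact: measurableD.
apply: le_trans (_ : P ((E `+` B) `|` (B `+` D)) <= _)%E.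
  apply: le_measure; rewrite ?inE; [exact: mY|by apply: measurableU; exact: mY|].
  move=> w [[wE nD]|[wD nE]]; have [wB|nB] := pselect (B w).
  - by right; left.
  - by left; left.
  - by left; right.
  - by right; right.
apply: le_trans (measureU2 _ (mY _ _ mE mB) (mY _ _ mB mD)) _.
by rewrite (splitr e) EFinD leeD.
Qed.

(** The events x <= J are approximated by the events x - dl <= Z: they differ only
    if J and Z are dl apart or if J lies in [x - 2 dl, x[, and the probability of
    the latter vanishes with dl. *)
Lemma adapted_prob_limit (Ft : R -> set_system Omega) s (J : Omega -> R) :
  filtration Ft -> 0 <= s -> measurable_fun setT J ->
  (forall e : R, 0 < e -> exists2 Z, adapted P Ft s Z &
     (P [set w | (e <= `|J w - Z w|)%R] <= e%:E)%E) ->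
  adapted P Ft s J.
Proof.
move=> hFt s0 mJ appr.
apply: (measurability (@RGenCInfty.G R)); first exact: RGenCInfty.measurableE.
move=> _ [_ [x ->] <-]; rewrite setTI.
apply/(measurable_pastP hFt _ s0).
apply: prob_closure_idem; first by have [] := hFt.1 s s0.
have mJx (A : set R) : measurable A -> measurable (J @^-1` A).
  by move=> mA; rewrite -[X in measurable X]setTI; exact: mJ.
split=> [|e e0]; first exact: mJx.
have e20 : 0 < e / 2 by rewrite divr_gt0.
have [dl dl0 Pdl] : exists2 dl : R, 0 < dl &
    (P (J @^-1` `[(x - 2 * dl)%R, x[%classic) <= (e / 2)%:E)%E.
  pose F (k : nat) := J @^-1` `[(x - 2 * k.+1%:R^-1)%R, x[%classic.
  have cF : P (F k) @[k --> \oo] --> P (\bigcap_k F k).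
    apply: nonincreasing_cvg_mu.
    - by rewrite (le_lt_trans (probability_le1 _ _))// ?ltry//; exact: mJx.
    - by move=> k; exact: mJx.
    - by apply: bigcapT_measurable => k; exact: mJx.
    - move=> k l kl; apply/subsetPset => w; rewrite /F /= !in_itv/= => /andP[h ->].
      rewrite andbT (le_trans _ h)// lerD2l lerN2 ler_pM2l// lef_pV2 ?posrE//.
      by rewrite ler_nat.
  have F0 : \bigcap_k F k = set0.
    rewrite -subset0 => w Fw.
    have : J w < x by have := Fw 0%N I; rewrite /F /= in_itv/= => /andP[].
    rewrite -subr_gt0 => Jx.
    have [k kx] : exists k : nat, 2 * k.+1%:R^-1 < x - J w.
      exists (Num.truncn (2 / (x - J w))).
      by rewrite ltr_pdivrMr// mulrC -ltr_pdivrMr// truncnS_gt.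
    have := Fw k I; rewrite /F /= in_itv/= => /andP[+ _].
    by rewrite leNgt ltrBrDl -ltrBrDr kx.
  rewrite F0 measure0 in cF.
  have [k /(_ k (leqnn _)) Fk] := cvge_le_eventually cF e20.
  by exists (k.+1%:R^-1); rewrite ?invr_gt0.
pose dl' := Num.min dl (e / 2).
have dl'0 : 0 < dl' by rewrite lt_min dl0.
have [Z aZ PZ] := appr _ dl'0.
have mZ := measurable_adapted hFt s0 aZ.
exists (Z @^-1` `[(x - dl)%R, +oo[%classic).
  apply/(measurable_pastP hFt _ s0).
  by rewrite -[X in measurable X]setTI; exact: aZ.
have mZx : measurable (Z @^-1` `[(x - dl)%R, +oo[%classic).
  by rewrite -[X in measurable X]setTI; exact: mZ.
have mD : measurable [set w | dl' <= `|J w - Z w|].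
  rewrite -[X in measurable X]setTI; apply: measurable_fun_le => //.
  by apply: measurableT_comp => //; exact: measurable_funB.
apply: le_trans (_ : P ([set w | (dl' <= `|J w - Z w|)%R] `|`
    J @^-1` `[(x - 2 * dl)%R, x[%classic) <= _)%E.
  apply: le_measure; rewrite ?inE//.
  - by apply: measurableU; apply: measurableD => //; exact: mJx.
  - by apply: measurableU => //; exact: mJx.
  move=> w [|] /=; rewrite !in_itv/= !andbT => -[].
    move=> xJ /negP; rewrite -ltNge => Zx; left; rewrite ge_min; apply/orP; left.
    rewrite ler_normr; apply/orP; left; lra.
  move=> xZ /negP; rewrite -ltNge => Jx.
  have [h|h] := leP (x - 2 * dl) (J w); first by right; rewrite Jx.
  left; rewrite ge_min; apply/orP; left.
  rewrite ler_normr; apply/orP; right; lra.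
apply: le_trans (measureU2 _ mD (mJx _ _)) _; first by [].
rewrite (splitr e) EFinD leeD//; apply: le_trans PZ _.
by rewrite lee_fin ge_min lexx orbT.
Qed.

End WienerIntegral.

Lemma measurable_forall_norm_le d (T : measurableType d) (R : realType) (I : finType)
    (Y : I -> T -> R) (r : R) : (forall i, measurable_fun setT (Y i)) ->
  measurable [set w | forall i, `|Y i w| <= r].
Proof.
move=> mY; have -> : [set w | forall i, `|Y i w| <= r] =
    \bigcap_(i in [set: I]) [set w | `|Y i w| <= r].
  by apply/seteqP; split=> w Yr i; [move=> _; exact: Yr|exact: Yr].
apply: fin_bigcap_measurable => // i _; rewrite -[X in measurable X]setTI.
by apply: measurable_fun_le => //; exact: measurableT_comp.
Qed.

Lemma measure_union_le d (T : measurableType d) (R : realType)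
    (mu : {measure set T -> \bar R}) (I : finType) (A : I -> set T) :
  (forall i, measurable (A i)) -> (mu [set x | exists i, A i x] <= \sum_i mu (A i))%E.
Proof.
move=> mA.
have -> : [set x | exists i, A i x] = \big[setU/set0]_(i <- index_enum I) A i.
  rewrite -bigcup_seq; apply/seteqP; split=> x.
    by move=> [i Ai]; exists i => //=; rewrite mem_index_enum.
  by move=> [i _ Ai]; exists i.
elim: (index_enum I) => [|i r IH]; first by rewrite !big_nil measure0.
rewrite !big_cons; apply: le_trans (measureU2 _ _ _) _ => //.
  exact: bigsetU_measurable.
exact: leeD2l.
Qed.

Section SmallBall.
Context {R : realType} {dis : measure_display} {Omega : measurableType dis}.
Variable P : probability Omega R.
Variables (Ft : R -> set_system Omega) (d : nat) (W : 'I_d -> R -> {RV P >-> R}).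
Hypotheses (hFt : filtration Ft) (hW : wiener_process W Ft).

Lemma adapted_step_integral k (p : step (R := R)) (a b : R) :
  0 <= a -> step_on a b p -> adapted P Ft b (step_integral (fun t => W k t) p).
Proof.
move=> a0 /allP pab.
rewrite /adapted /step_integral.
have -> : (fun w => \sum_(q <- p) q.1 * (W k q.2.2 w - W k q.2.1 w)) =
    (fun w => \sum_(q <- p) (if q \in p then q.1 * (W k q.2.2 w - W k q.2.1 w) else 0)).
  by apply/funext => w; apply: eq_big_seq => q ->.
apply: measurable_sum => q; case: (boolP (q \in p)) => // /pab /and3P[aq q12 qb].
apply: measurable_funM => //; apply: measurable_funB.
- by apply: (adapted_W hFt hW) => //; rewrite (le_trans a0)// (le_trans aq).
- by apply: (adapted_W hFt hW); rewrite ?(le_trans a0)// (le_trans q12).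
Qed.

Lemma adapted_wiener_integral k (a b : R) (f : R -> R) (J : Omega -> R) :
  0 <= a -> a <= b -> measurable_fun setT J ->
  is_wiener_integral P (W k) a b f J -> adapted P Ft b J.
Proof.
move=> a0 ab mJ [p [pab _ pJ]].
have b0 := le_trans a0 ab.
apply: adapted_prob_limit => // e e0.
have [N /(_ N (leqnn _)) JN] : exists N, forall n, (N <= n)%N ->
    ('E_P[fun w => ((J w - step_integral (fun t => W k t) (p n) w) ^+ 2)%R] <=
     (e ^+ 2 * e)%:E)%E.
  by apply: cvge_le_eventually pJ _; rewrite mulr_gt0// exprn_gt0.
have aS := adapted_step_integral k a0 (pab N).
exists (step_integral (fun t => W k t) (p N)) => //.
apply: prob_second_moment JN => //.
by apply: measurable_funB => //; exact: measurable_adapted aS.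
Qed.

(** On the cube of radius r each bump of variance r^2 is at least expR (- 1 / 2). *)
Lemma prob_le_bump (Z : 'I_d -> Omega -> R) (E : set Omega) (r : R) :
  measurable E -> (forall k, measurable_fun setT (Z k)) -> 0 < r ->
  (P (E `&` [set w | forall k, (`|Z k w| <= r)%R]) <=
   (expR (2^-1) ^+ d)%:E * \int[P]_w (\1_E w * \prod_k bump (r ^+ 2) (Z k w))%:E)%E.
Proof.
move=> mE mZ r0.
have mD := measurable_forall_norm_le r mZ.
have mb : measurable_fun setT (fun w => (\1_E w * \prod_k bump (r ^+ 2) (Z k w))%:E).
  apply/measurable_EFinP; apply: measurable_funM; first exact: measurable_indic.
  by apply: measurable_prod => k _; exact: (measurableT_comp (measurable_bump _)).
have b0 w : 0 <= \prod_k bump (r ^+ 2) (Z k w) by apply: prodr_ge0 => k _; exact: bump_ge0.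
rewrite -ge0_integralZl//; last by move=> w _; rewrite lee_fin mulr_ge0.
set D := [set w | _] in mD *.
have mED : measurable (E `&` D) by exact: measurableI.
apply: (@le_trans _ _ (\int[P]_w (\1_(E `&` D) w)%:E)%E).
  by rewrite integral_indic// setIT.
apply: ge0_le_integral => //.
- exact/measurable_EFinP/measurable_indic.
- exact: emeasurable_funM.
move=> w _; rewrite -EFinM lee_fin !indicE in_setI.
have [wE|] := boolP (w \in E); last by rewrite !mul0r mulr0.
rewrite !mul1r; have [/set_mem wD|] := boolP (w \in _); last first.
  by rewrite mulr_ge0// exprn_ge0// expR_ge0.
rewrite -[d in X in _ ^+ X]card_ord -prodr_const -big_split/=.
apply: (big_ind (fun x : R => 1 <= x)) => [//|x y|k _]; first exact: mulr_ege1.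
rewrite /bump -expRD -[leLHS]expR0 ler_expR.
rewrite mulNr subr_ge0 ler_pdivrMr ?mulr_gt0 ?exprn_gt0// mulrA mulVf// mul1r.
by rewrite -real_normK ?num_real// lerXn2r// nnegrE// ltW.
Qed.

Lemma chain_small_ball us (a v0 : R) (c : 'I_d -> R -> R) :
  0 <= a -> path <%R a us -> 0 < v0 -> (forall k, v0 <= chain_var (c k) a us) ->
  forall (E : set Omega) (Y : 'I_d -> Omega -> R) (r : R),
  past P Ft a E -> (forall k, adapted P Ft a (Y k)) -> 0 < r ->
  (P (E `&` [set w | forall k,
      (`|Y k w + chain_sum (fun t => W k t w) (c k) a us| <= r)%R]) <=
   ((expR (2^-1) * (r / Num.sqrt v0)) ^+ d)%:E * P E)%E.
Proof.
move=> a0 pus v00 v0c E Y r pE aY r0.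
have mE : measurable E by have [] := pE.
have mS k : measurable_fun setT (fun w => chain_sum (fun t => W k t w) (c k) a us).
  elim: us a {a0 pus v0c pE aY} => //= u us IH a.
  apply: measurable_funD; last exact: IH.
  by apply: measurable_funM => //; apply: measurable_funB; exact: measurable_funP.
have mY k := measurable_adapted hFt a0 (aY k).
apply: le_trans (prob_le_bump mE _ r0) _.
  by move=> k; exact: measurable_funD.
rewrite (integral_bump_chain hFt hW)//; last by move=> k; rewrite exprn_gt0.
rewrite muleA -EFinM.
have i1 : (\int[P]_w (\1_E w * \prod_k bump (r ^+ 2 + chain_var (c k) a us) (Y k w))%:E
    <= P E)%E.
  apply: (@le_trans _ _ (\int[P]_w (\1_E w)%:E)%E); last first.
    by rewrite integral_indic// setIT.
  apply: ge0_le_integral => //.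
  - move=> w _; rewrite lee_fin mulr_ge0//; apply: prodr_ge0 => k _; exact: bump_ge0.
  - apply/measurable_EFinP; apply: measurable_funM; first exact: measurable_indic.
    by apply: measurable_prod => k _; exact: (measurableT_comp (measurable_bump _)).
  - by apply/measurable_EFinP; exact: measurable_indic.
  - move=> w _; rewrite lee_fin ler_piMr// prodr_ile1// => k _.
    rewrite bump_ge0 bump_le1// ltr_wpDr ?exprn_gt0//.
    exact: le_trans (ltW v00) (v0c k).
apply: lee_pmul => //.
- by rewrite lee_fin mulr_ge0 ?exprn_ge0 ?expR_ge0// prodr_ge0// => k _; exact: sqrtr_ge0.
- apply: integral_ge0 => w _; rewrite lee_fin mulr_ge0//.
  by apply: prodr_ge0 => k _; exact: bump_ge0.
rewrite lee_fin exprMn ler_pM2l ?exprn_gt0 ?expR_gt0//.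
have -> : (r / Num.sqrt v0) ^+ d = \prod_(k < d) (r / Num.sqrt v0).
  by rewrite prodr_const card_ord.
apply: ler_prod => k _; rewrite sqrtr_ge0/=.
have -> : r / Num.sqrt v0 = Num.sqrt (r ^+ 2 / v0).
  by rewrite sqrtrM ?sqr_ge0// sqrtr_sqr gtr0_norm// sqrtrV// ltW.
have vk := v0c k.
have vk0 : 0 < chain_var (c k) a us by exact: lt_le_trans vk.
rewrite ler_wsqrtr// ler_pM2l ?exprn_gt0// lef_pV2 ?posrE//.
- by rewrite (le_trans vk)// lerDr sqr_ge0.
- by rewrite addr_gt0// exprn_gt0.
Qed.

(** Conditionally on the past the J_k are independent Gaussian variables of variance
    at least kappa^2 (b - a), so that a ball of radius r has probability O(r^d)
    wherever it is centred. The estimate is proved for step functions, for which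
    it follows from the bump integrals, and passes to the limit in probability
    at the price of doubling r. *)
Lemma wiener_integral_small_ball (a b kappa : R) (f : R -> R) (J : 'I_d -> Omega -> R) :
  0 <= a -> a < b -> measurable_fun setT f -> 0 < kappa ->
  (forall t, a < t -> t <= b -> kappa <= f t) ->
  (forall k, measurable_fun setT (J k)) ->
  (forall k, is_wiener_integral P (W k) a b f (J k)) ->
  exists2 C : R, 0 <= C & forall (E : set Omega) (Y : 'I_d -> Omega -> R) (r : R),
  past P Ft a E -> (forall k, adapted P Ft a (Y k)) -> 0 < r ->
  (P (E `&` [set w | forall k, (`|Y k w + J k w| <= r)%R]) <=
   ((C * r) ^+ d)%:E * P E)%E.
Proof.
move=> a0 ab mf kappa0 fkappa mJ intJ.
have b0 : 0 <= b by rewrite (le_trans a0)// ltW.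
(* an approximant within v0 of f in L^2 has a variance of at least v0 *)
pose v0 := kappa ^+ 2 * (b - a) / 4.
have v00 : 0 < v0 by rewrite divr_gt0// mulr_gt0 ?exprn_gt0// subr_gt0.
have [p pP] := choice intJ.
exists (expR (2^-1) * (2 / Num.sqrt v0)).
  by rewrite mulr_ge0 ?expR_ge0// divr_ge0// sqrtr_ge0.
move=> E Y r pE aY r0.
have mE : measurable E by have [] := pE.
apply/lee_addgt0Pr => e e0.
(* the approximants are taken close enough for all components at once *)
have [j jP] : exists j, forall k,
    (\int[lebesgue_measure]_(t in `[a, b]) ((f t - step_fun (p k j) t) ^+ 2)%:E <= v0%:E)%E /\
    ('E_P[fun w => ((J k w - step_integral (fun t => W k t) (p k j) w) ^+ 2)%R] <=
     (r ^+ 2 * (e / d.+1%:R))%:E)%E.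
  have ex k : exists N, forall n, (N <= n)%N ->
      (\int[lebesgue_measure]_(t in `[a, b]) ((f t - step_fun (p k n) t) ^+ 2)%:E <= v0%:E)%E /\
      ('E_P[fun w => ((J k w - step_integral (fun t => W k t) (p k n) w) ^+ 2)%R] <=
       (r ^+ 2 * (e / d.+1%:R))%:E)%E.
    have [_ p1 p2] := pP k.
    have [N1 h1] := cvge_le_eventually p1 v00.
    have e1 : 0 < r ^+ 2 * (e / d.+1%:R) by rewrite mulr_gt0 ?exprn_gt0// divr_gt0.
    have [N2 h2] := cvge_le_eventually p2 e1.
    exists (maxn N1 N2) => n; rewrite geq_max => /andP[n1 n2].
    by split; [exact: h1|exact: h2].
  have [N NP] := choice ex.
  by exists (\max_k N k)%N => k; apply: NP; exact: leq_bigmax.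
pose pts := flatten [seq [seq q.2.1 | q <- p k j] ++ [seq q.2.2 | q <- p k j] | k <- enum 'I_d].
have ptsP k q : q \in p k j -> (q.2.1 \in pts) /\ (q.2.2 \in pts).
  move=> qp; split; apply/flatten_mapP; exists k; rewrite ?mem_enum// mem_cat.
    by rewrite (map_f (fun q : R * (R * R) => q.2.1) qp).
  by rewrite (map_f (fun q : R * (R * R) => q.2.2) qp) orbT.
have pts_ab : all (fun x => a <= x <= b) pts.
  apply/allP => x /flatten_mapP[k _]; rewrite mem_cat.
  have [/(_ j)/allP pab _ _] := pP k.
  case/orP => /mapP[q /pab/and3P[q1 q12 q2] ->].
    by rewrite q1 (le_trans q12).
  by rewrite q2 (le_trans q1).
have [us [pus lus sub]] := exists_partition ab pts_ab.
have q_us k q : q \in p k j -> [/\ q.2.1 <= q.2.2, q.2.1 \in a :: us & q.2.2 \in a :: us].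
  move=> qp; have [/(_ j)/allP pab _ _] := pP k.
  have /and3P[_ q12 _] := pab _ qp; have [q1 q2] := ptsP _ _ qp.
  by split=> //; exact: sub.
pose c k := step_fun (p k j).
have chainE k w : chain_sum (fun t => W k t w) (c k) a us =
    step_integral (fun t => W k t) (p k j) w.
  by rewrite /step_integral (sum_step_chain (fun t => W k t w) pus (q_us k)).
have v0c k : v0 <= chain_var (c k) a us.
  have qw q : q \in p k j -> [/\ q.2.1 <= q.2.2,
      (q.2.1 <= a) || (q.2.1 \in us) & (q.2.2 <= a) || (q.2.2 \in us)].
    move=> /q_us[q12]; rewrite !inE => q1 q2; split=> //.
      by case/orP: q1 => [/eqP->|->]; rewrite ?lexx ?orbT.
    by case/orP: q2 => [/eqP->|->]; rewrite ?lexx ?orbT.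
  have h := @chain_var_lower R f kappa (p k j) a us mf (ltW kappa0) _ pus qw.
  rewrite lus in h; have {}h := h fkappa.
  have [+ _] := jP k.
  set I1 := (X in (X <= _)%E) => hI1.
  have : ((kappa ^+ 2 * (b - a))%:E <= 2%:E * v0%:E + (2 * chain_var (c k) a us)%:E)%E.
    apply: le_trans h _; rewrite leeD2r// lee_pmul2l//.
    apply: le_trans hI1; apply: ge0_subset_integral => //.
    - apply/measurable_EFinP; apply: measurable_funX; apply: measurable_funB.
        exact: (measurable_funS measurableT).
      exact: (measurable_funS measurableT _ (measurable_step_fun _)).
    - by move=> t _; rewrite lee_fin sqr_ge0.
    - by move=> t /=; rewrite !in_itv/= => /andP[/ltW -> ->].
  rewrite -EFinM -EFinD lee_fin /v0; lra.
have aS k : adapted P Ft b (step_integral (fun t => W k t) (p k j)).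
  by apply: (adapted_step_integral _ a0); have [] := pP k.
have mS k := measurable_adapted hFt b0 (aS k).
have mYk k := measurable_adapted hFt a0 (aY k).
pose far k := [set w | (r <= `|J k w - step_integral (fun t => W k t) (p k j) w|)%R].
have mfar k : measurable (far k).
  rewrite -[X in measurable X]setTI; apply: measurable_fun_le => //.
  by apply: measurableT_comp => //; exact: measurable_funB.
have Pfar k : (P (far k) <= (e / d.+1%:R)%:E)%E.
  apply: prob_second_moment => //; first exact: measurable_funB.
  by have [_] := jP k.
pose near := E `&` [set w | forall k,
  (`|Y k w + chain_sum (fun t => W k t w) (c k) a us| <= 2 * r)%R].
have mnear : measurable near.
  apply: measurableI => //; apply: measurable_forall_norm_le => k; apply: measurable_funD => //.
  by rewrite (_ : (fun w => _) = step_integral (fun t => W k t) (p k j))//; apply/funext.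
have mFar : measurable [set w | exists k, far k w].
  have -> : [set w | exists k, far k w] = \bigcup_(k in [set: 'I_d]) far k.
    by apply/seteqP; split=> w [k]; exists k.
  exact: fin_bigcup_measurable.
apply: le_trans (_ : P (near `|` [set w | exists k, far k w]) <= _)%E.
  apply: le_measure; rewrite ?inE.
  - by apply: measurableI => //; apply: measurable_forall_norm_le => k; exact: measurable_funD.
  - exact: measurableU.
  move=> w [wE wJ].
  have [wfar|nfar] := pselect (exists k, far k w); first by right.
  left; split=> // k; rewrite chainE.
  have nk : `|J k w - step_integral (fun t => W k t) (p k j) w| < r.
    by rewrite ltNge; apply/negP => h; apply: nfar; exists k.
  have := wJ k; rewrite (_ : Y k w + step_integral _ _ w = (Y k w + J k w) -
    (J k w - step_integral (fun t => W k t) (p k j) w)); last by ring.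
  move=> h; apply: le_trans (ler_normB _ _) _; lra.
apply: le_trans (measureU2 _ _ _) _ => //.
apply: leeD.
  have r20 : 0 < 2 * r by rewrite mulr_gt0.
  apply: le_trans (chain_small_ball a0 pus v00 v0c pE aY r20) _.
  rewrite (_ : expR _ * (2 * r / _) = expR 2^-1 * (2 / Num.sqrt v0) * r)//.
  by rewrite -!mulrA; congr (_ * (_ * _)); rewrite mulrC.
apply: le_trans (measure_union_le _ mfar) _.
apply: (@le_trans _ _ (\sum_(k < d) (e / d.+1%:R)%:E)%E); first by apply: lee_sum => k _; exact: Pfar.
rewrite sumEFin lee_fin sumr_const card_ord -(mulr_natr _ d) mulrAC ler_pdivrMr//.
by rewrite ler_pM2l// ler_nat.
Qed.

End SmallBall.

(** * Differential calculus in several variables *)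

Section LineDerivative.
Context {R : realType} {m : nat}.
Implicit Types (f F : 'rV[R]_m -> R) (x y v : 'rV[R]_m).

Lemma is_derive_line f y v (t : R) : derivable f (y + t *: v) v ->
  is_derive t 1 (fun s : R => f (y + s *: v)) ('D_v f (y + t *: v)).
Proof.
have E : (fun h : R => h^-1 *: (((fun s : R => f (y + s *: v)) \o shift t) (h *: 1) -
      f (y + t *: v))) =
    (fun h : R => h^-1 *: ((f \o shift (y + t *: v)) (h *: v) - f (y + t *: v))).
  apply/funext => h /=; congr (_ *: (f _ - _)).
  by rewrite /= [h *: 1]mulr1 scalerDl addrCA.
move=> df; apply: DeriveDef; first by rewrite /derivable E.
by rewrite /derive E.
Qed.

Lemma line_MVT f y v (a b : R) : a <= b ->
  (forall z, derivable f z v) ->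
  exists2 c, a <= c <= b &
    f (y + b *: v) - f (y + a *: v) = (b - a) * 'D_v f (y + c *: v).
Proof.
move=> ab df.
have dl t := is_derive_line (df (y + t *: v)).
have [|c] := @MVT_segment R (fun s => f (y + s *: v)) (fun s => 'D_v f (y + s *: v)) a b ab.
- apply: derivable_within_continuous => t _.
  by have := dl t => -[].
- by rewrite in_itv/= => cab E; exists c => //; rewrite E mulrC.
Qed.

Lemma line_MVT0 f y v (h : R) : (forall z, derivable f z v) ->
  exists2 c, `|c| <= `|h| & f (y + h *: v) - f y = h * 'D_v f (y + c *: v).
Proof.
move=> df; have [h0|/ltW h0] := leP 0 h.
  have [c /andP[c0 ch]] := line_MVT y h0 df.
  rewrite scale0r addr0 subr0 => E; exists c => //.
  by rewrite !ger0_norm.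
have [c /andP[hc c0]] := line_MVT y h0 df.
rewrite scale0r addr0 sub0r => E; exists c; first by rewrite !ler0_norm// lerN2.
by apply/eqP; rewrite -opprB E mulNr opprK.
Qed.

Lemma rV_norm_leP x (c : R) : 0 <= c -> (`|x| <= c <-> forall i, `|x 0 i| <= c).
Proof.
move=> c0; rewrite [`|x|]mx_normrE; split=> [h i|h].
  by apply: le_trans h; apply: (le_bigmax _ (fun ij => `|x ij.1 ij.2|) (0, i)).
by apply: bigmax_le => // -[i j] _ /=; rewrite ord1.
Qed.

Lemma rV_coord_le x i : `|x 0 i| <= `|x|.
Proof. by have /(rV_norm_leP x (normr_ge0 x))/(_ i) := lexx `|x|. Qed.

Lemma norm_delta_le (i : 'I_m) (c : R) : `|c *: (delta_mx 0 i : 'rV[R]_m)| <= `|c|.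
Proof.
apply/rV_norm_leP => // j; rewrite !mxE eqxx /=.
by case: (j == i); rewrite ?mulr1// mulr0 normr0.
Qed.

Lemma continuous_eps f y (e : R) : continuous f -> 0 < e ->
  exists2 dl : R, 0 < dl & forall z, `|z - y| < dl -> `|f z - f y| < e.
Proof.
move=> cf e0.
have /nbhs_ballP[dl /= dl0 h] : nbhs y [set z | `|f z - f y| < e].
  exact: (@cvgr_distC_lt _ _ _ (nbhs y) (nbhs_filter y) f (f y) (cf y) e e0).
by exists dl => // z zy; apply: h; rewrite -ball_normE /ball_ /= distrC.
Qed.

Lemma close_limits (a b p q e : R) : a = b ->
  `|a - p| < e / 2 -> `|b - q| < e / 2 -> `|q - p| <= e.
Proof.
move=> ->; rewrite !ltr_distlC => /andP[? ?] /andP[? ?].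
rewrite ler_norml; apply/andP; split; lra.
Qed.

Lemma second_difference_swap (a b c d : R) : a - b - (c - d) = a - c - (b - d).
Proof. ring. Qed.

Lemma double_quarter_lt (e : R) : 0 < e -> 2 * (e / 4) < e.
Proof. lra. Qed.

(** Schwarz: the second difference of F over a small square is h^2 times either
    mixed derivative at some point of the square. *)
Lemma mixed_partials F (i j : 'I_m) y : class_C 2 F ->
  partial i (partial j F) y = partial j (partial i F) y.
Proof.
move=> CF.
have dF z k : derivable F z (delta_mx 0 k) by have [_ /(_ isT)] := CF [::] isT; apply.
have dpF k z l : derivable (partial k F) z (delta_mx 0 l).
  by have [_ /(_ isT)] := CF [:: k] isT; apply.
have cont k l : continuous (partial k (partial l F)).
  by have [] := CF [:: k; l] isT.
pose e k : 'rV[R]_m := delta_mx 0 k.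
have diff2 k l (h : R) : 0 <= h -> exists2 z, `|z - y| <= 2 * h &
    F (y + h *: e k + h *: e l) - F (y + h *: e k) - (F (y + h *: e l) - F y) =
    h ^+ 2 * partial l (partial k F) z.
  move=> h0.
  have dG z : derivable (fun z => F (z + h *: e l) - F z) z (e k) /\
      'D_(e k) (fun z => F (z + h *: e l) - F z) z =
      partial k F (z + h *: e l) - partial k F z.
    have dsh : is_derive z (e k) (fun z => F (z + h *: e l)) (partial k F (z + h *: e l)).
      have E : (fun t : R => t^-1 *: (((fun z => F (z + h *: e l)) \o shift z) (t *: e k) -
            F (z + h *: e l))) =
          (fun t : R => t^-1 *: ((F \o shift (z + h *: e l)) (t *: e k) - F (z + h *: e l))).
        by apply/funext => t /=; rewrite addrA.
      by apply: DeriveDef; [rewrite /derivable E; exact: dF|rewrite /derive E].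
    have dz : is_derive z (e k) F (partial k F z) by apply: DeriveDef; first exact: dF.
    have dd := is_deriveB dsh dz.
    by split; [case: dd|exact: derive_val].
  have [c /andP[c0 ch] E] := line_MVT y h0 (fun z => (dG z).1).
  rewrite scale0r addr0 subr0 in E.
  have [c' /andP[c'0 c'h] E'] := line_MVT (y + c *: e k) h0 (fun z => dpF k z l).
  rewrite scale0r addr0 subr0 in E'.
  exists (y + c *: e k + c' *: e l).
    rewrite -[y + _ + _]addrA [y + _]addrC addrK mulr2n mulrDl !mul1r.
    apply: le_trans (ler_normD _ _) _; apply: lerD;
      by apply: le_trans (norm_delta_le _ _) _; rewrite ger0_norm.
  by rewrite E (dG _).2 E' expr2 mulrA.
apply/eqP; rewrite -subr_eq0 -normr_le0; apply/ler_addgt0Pl => eps eps0; rewrite addr0.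
have e20 : 0 < eps / 2 by rewrite divr_gt0.
have [d1 d10 b1] := continuous_eps y (cont i j) e20.
have [d2 d20 b2] := continuous_eps y (cont j i) e20.
pose dl := Num.min d1 d2.
have dl0 : 0 < dl by rewrite lt_min d10.
pose h := dl / 4.
have h0 : 0 < h by rewrite divr_gt0.
have [z1 z1y E1] := diff2 i j h (ltW h0).
have [z2 z2y E2] := diff2 j i h (ltW h0).
have near_y z : `|z - y| <= 2 * h -> `|z - y| < d1 /\ `|z - y| < d2.
  by move=> zy; apply/andP; rewrite -lt_min; apply: le_lt_trans zy _; exact: double_quarter_lt.
have h1 := b2 _ (near_y _ z1y).2.
have h2 := b1 _ (near_y _ z2y).1.
have E : partial j (partial i F) z1 = partial i (partial j F) z2.
  have E12 : h ^+ 2 * partial j (partial i F) z1 = h ^+ 2 * partial i (partial j F) z2.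
    apply: etrans (esym E1) _; apply: etrans E2.
    have -> : y + h *: e j + h *: e i = y + h *: e i + h *: e j by rewrite addrAC.
    exact: second_difference_swap.
  by have := mulfI (lt0r_neq0 (exprn_gt0 2 h0)) E12.
exact: (close_limits E h1 h2).
Qed.

End LineDerivative.

Lemma measurable_rV_norm_le d (T : measurableType d) (R : realType) n
    (Y : T -> 'rV[R]_n) (r : R) : 0 <= r -> (forall i, measurable_fun setT (fun w => Y w 0 i)) ->
  measurable [set w | `|Y w| <= r].
Proof.
move=> r0 mY; rewrite [X in measurable X](_ : _ = [set w | forall i, `|Y w 0 i| <= r]).
  exact: measurable_forall_norm_le.
by apply/seteqP; split=> w /(rV_norm_leP _ r0).
Qed.

Lemma norm_lsubmx_le (R : realType) m n (x : 'rV[R]_(m + n)) : `|lsubmx x| <= `|x|.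
Proof. by apply/rV_norm_leP => // i; rewrite mxE rV_coord_le. Qed.

Lemma norm_rsubmx_le (R : realType) m n (x : 'rV[R]_(m + n)) : `|rsubmx x| <= `|x|.
Proof. by apply/rV_norm_leP => // i; rewrite mxE rV_coord_le. Qed.

Lemma finite_pos_lower (R : realType) (I : finType) (dl : I -> R) :
  (forall i, 0 < dl i) -> exists2 e : R, 0 < e & forall i, e <= dl i.
Proof.
move=> dl0; exists (\big[Num.min/1]_i dl i); first by apply/lt_bigmin.
by move=> i; exact: bigmin_le.
Qed.

Section DirectionalDerivative.
Context {R : realType} {m : nat}.
Implicit Types (F : 'rV[R]_m -> R) (y v : 'rV[R]_m).

(** The path from y to y + h v along the coordinate axes, on which only the partial
    derivatives are needed. *)
Let trunc (k : nat) v : 'rV[R]_m := \row_i (if (i < k)%N then v 0 i else 0).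

Let truncS (k : 'I_m) v : trunc k.+1 v = trunc k v + v 0 k *: delta_mx 0 k.
Proof.
apply/rowP => i; rewrite !mxE eqxx ltnS leq_eqVlt /= eq_sym.
have [->|ik] := eqVneq k i.
  by rewrite eqxx ltnn add0r mulr1.
rewrite (_ : (k : nat) == i = false) ?mulr0 ?addr0//.
by apply/negbTE; rewrite val_eqE.
Qed.

Let trunc_le (k : nat) v : `|trunc k v| <= `|v|.
Proof.
apply/rV_norm_leP => // i; rewrite mxE; case: ifP => _.
  exact: rV_coord_le.
by rewrite normr0.
Qed.

Lemma directional_derivative F y v : class_C 1 F ->
  is_derive y v F (\sum_i v 0 i * partial i F y).
Proof.
move=> CF.
have dF k z : derivable F z (delta_mx 0 k) by have [_ /(_ isT)] := CF [::] isT; apply.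
have cont k : continuous (partial k F) by have [] := CF [:: k] isT.
set S := \sum_i _.
suff cvgS : (fun h : R => h^-1 *: ((F \o shift y) (h *: v) - F y)) @ 0^' --> S.
  by apply: DeriveDef; [apply/cvg_ex; exists S|exact: cvg_lim].
apply/cvgrPdist_le => e e0.
pose M := \sum_i `|v 0 i| + 1.
have M0 : 0 < M by rewrite ltr_wpDl// sumr_ge0.
have eM : 0 < e / M by rewrite divr_gt0.
have ex k : exists x : R, 0 < x /\
    forall z, `|z - y| < x -> `|partial k F z - partial k F y| < e / M.
  by have [x x0 xP] := continuous_eps y (cont k) eM; exists x.
have [dl dlP] := choice ex.
have [d0 d00 d0le] := finite_pos_lower (fun k => (dlP k).1).
pose V := 2 * `|v| + 1.
have V0 : 0 < V by rewrite ltr_wpDl// mulr_ge0.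
exists (d0 / V); first by rewrite /= divr_gt0.
move=> h /=; rewrite sub0r normrN ltr_pdivlMr// => hd h0.
have step (k : 'I_m) : exists2 z, `|z - y| < d0 &
    F (y + h *: trunc k.+1 v) - F (y + h *: trunc k v) = h * v 0 k * partial k F z.
  have [c ck E] := line_MVT0 (y + h *: trunc k v) (h * v 0 k) (dF k).
  exists (y + h *: trunc k v + c *: delta_mx 0 k).
    rewrite -[y + _ + _]addrA [y + _]addrC addrK.
    apply: le_lt_trans hd; apply: le_trans (ler_normD _ _) _.
    rewrite /V mulrDr mulr1; apply: le_trans (_ : `|h| * (2 * `|v|) <= _); last by rewrite lerDl.
    rewrite mulr2n mulrDl mul1r mulrDr; apply: lerD.
      by rewrite normrZ ler_wpM2l// trunc_le.
    apply: le_trans (norm_delta_le _ _) _; apply: le_trans ck _.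
    by rewrite normrM ler_wpM2l// rV_coord_le.
  by rewrite truncS scalerDr scalerA addrA E.
have exz (k : 'I_m) : exists z, `|z - y| < d0 /\
    F (y + h *: trunc k.+1 v) - F (y + h *: trunc k v) = h * v 0 k * partial k F z.
  by have [z z1 z2] := step k; exists z.
have [z zP] := choice exz.
have tele : F (h *: v + y) - F y = \sum_(k < m) h * v 0 k * partial k F (z k).
  rewrite -(eq_bigr _ (fun k _ => (zP k).2)).
  rewrite -(big_mkord xpredT (fun k => F (y + h *: trunc k.+1 v) - F (y + h *: trunc k v))).
  rewrite (telescope_sumr (fun k => F (y + h *: trunc k v)))//.
  have -> : trunc m v = v by apply/rowP => i; rewrite mxE ltn_ord.
  have -> : trunc 0 v = 0 by apply/rowP => i; rewrite !mxE ltn0.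
  by rewrite scaler0 addr0 [h *: v + y]addrC.
rewrite /= tele /S.
have -> : h^-1 *: (\sum_(k < m) h * v 0 k * partial k F (z k)) =
    \sum_(k < m) v 0 k * partial k F (z k).
  rewrite [_ *: _]mulr_sumr; apply: eq_bigr => k _.
  by rewrite -mulrA mulKf.
rewrite -sumrB; apply: le_trans (ler_norm_sum _ _ _) _.
apply: (@le_trans _ _ (\sum_(k < m) `|v 0 k| * (e / M))).
  apply: ler_sum => k _; rewrite -mulrBr normrM ler_wpM2l// distrC ltW//.
  by apply: (dlP k).2; apply: lt_le_trans (zP k).1 _; exact: d0le.
rewrite -mulr_suml mulrCA ler_piMr// ?(ltW e0)// ler_pdivrMr// mul1r.
by rewrite /M lerDl.
Qed.

End DirectionalDerivative.

(** * Lower Hessian bounds and monotone gradients *)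

Lemma continuous_sumR (R : realType) (T : topologicalType) (I : Type) (r : seq I)
    (f : I -> T -> R) :
  (forall i, continuous (f i)) -> continuous (fun x => \sum_(i <- r) f i x).
Proof.
move=> cf; elim: r => [|i r IH].
  by rewrite (_ : (fun _ => _) = fun=> 0); [move=> x; exact: cvg_cst|
    apply/funext => x; rewrite big_nil].
rewrite (_ : (fun _ => _) = fun x => f i x + \sum_(j <- r) f j x); last first.
  by apply/funext => x; rewrite big_cons.
by move=> x; apply: cvgD; [exact: cf|exact: IH].
Qed.

Lemma continuous_mulR (R : realType) (T : topologicalType) (f g : T -> R) :
  continuous f -> continuous g -> continuous (fun x => f x * g x).
Proof. by move=> cf cg x; apply: cvgM; [exact: cf|exact: cg]. Qed.

(** For small t < 0 the linear term dominates. *)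
Lemma quadratic_tangent (R : realType) (a b : R) : 0 < a ->
  (forall t, 0 <= 2 * t * a + t ^+ 2 * b) -> False.
Proof.
move=> a0 h; have := h (- a / (`|b| + 1)).
have b1 : 0 < `|b| + 1 by rewrite ltr_wpDl.
have bb : b <= `|b| := ler_norm b.
have -> : 2 * (- a / (`|b| + 1)) * a + (- a / (`|b| + 1)) ^+ 2 * b =
    (a / (`|b| + 1)) ^+ 2 * (b - 2 * (`|b| + 1)).
  by field; rewrite gt_eqF.
rewrite pmulr_rge0 ?exprn_gt0 ?divr_gt0//; lra.
Qed.

Section Rayleigh.
Context {R : realType} {m : nat}.
Implicit Types (A : 'M[R]_m) (x y : 'rV[R]_m).

Definition qform A x y : R := (x *m A *m y^T) 0 0.

Lemma qformE A x y : qform A x y = \sum_i \sum_j x 0 i * A i j * y 0 j.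
Proof.
rewrite /qform mxE exchange_big /=; apply: eq_bigr => j _.
by rewrite !mxE mulr_suml.
Qed.

Lemma qform_sym A x y : A^T = A -> qform A x y = qform A y x.
Proof.
move=> sA; rewrite /qform -(trmxK (y *m A *m x^T)) [RHS]mxE.
by rewrite !trmx_mul trmxK sA mulmxA.
Qed.

Lemma qformDl A x x' y : qform A (x + x') y = qform A x y + qform A x' y.
Proof. by rewrite /qform !mulmxDl mxE. Qed.

Lemma qformZl A (t : R) x y : qform A (t *: x) y = t * qform A x y.
Proof. by rewrite /qform -!scalemxAl mxE. Qed.

Lemma qformDr A x y y' : qform A x (y + y') = qform A x y + qform A x y'.
Proof. by rewrite /qform linearD mulmxDr mxE. Qed.

Lemma qformZr A (t : R) x y : qform A x (t *: y) = t * qform A x y.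
Proof. by rewrite /qform linearZ -scalemxAr mxE. Qed.

Lemma qform1 x : qform 1%:M x x = \sum_i x 0 i ^+ 2.
Proof.
rewrite /qform mulmx1 mxE; apply: eq_bigr => i _.
by rewrite mxE expr2.
Qed.

Lemma qform1_ge0 x : 0 <= qform 1%:M x x.
Proof. by rewrite qform1 sumr_ge0// => i _; exact: sqr_ge0. Qed.

Lemma qform1_eq0 x : qform 1%:M x x = 0 -> x = 0.
Proof.
rewrite qform1 => /eqP; rewrite psumr_eq0 => [/allP h|i _]; last exact: sqr_ge0.
apply/rowP => i; rewrite mxE; apply/eqP; rewrite -sqrf_eq0.
by apply: h; rewrite mem_index_enum.
Qed.

Lemma continuous_qform A : continuous (fun x => qform A x x).
Proof.
under eq_fun do rewrite qformE.
have cc i : continuous (fun x : 'rV[R]_m => x 0 i) by exact: coord_continuous.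
apply: continuous_sumR => i; apply: continuous_sumR => j.
apply: continuous_mulR; last exact: cc.
by apply: continuous_mulR; [exact: cc|exact: cst_continuous].
Qed.

(** The minimum mu of the quadratic form on the unit sphere is an eigenvalue: the
    form A - mu is nonnegative and vanishes at the minimiser, so its gradient
    vanishes there as well. No eigenvalue is smaller. *)
Lemma lambda_min_le_qform A x : A^T = A ->
  lambda_min A * qform 1%:M x x <= qform A x x.
Proof.
move=> sA; have [->|x0] := eqVneq x 0; first by rewrite -[0](scale0r 0) !qformZl !mul0r mulr0.
have q0 y : y != 0 -> 0 < qform 1%:M y y.
  by move=> y0; rewrite lt_def qform1_ge0 andbT; apply: contra y0 => /eqP/qform1_eq0 ->.
pose sphere := [set y : 'rV[R]_m | qform 1%:M y y = 1].
have normalise y : y != 0 -> sphere ((Num.sqrt (qform 1%:M y y))^-1 *: y).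
  move=> y0; rewrite /sphere /= qformZl qformZr mulrA -invfM -expr2.
  by rewrite sqr_sqrtr ?qform1_ge0// mulVf// gt_eqF// q0.
have csphere : compact sphere.
  apply: bounded_closed_compact.
    exists 1; split=> // M M1 y /= y1; apply: le_trans (ltW M1).
    apply/rV_norm_leP => // i; rewrite -(@ler_pXn2r _ 2)// ?nnegrE//.
    rewrite expr1n real_normK ?num_real// -y1 qform1 (bigD1 i)//= lerDl.
    by apply: sumr_ge0 => j _; exact: sqr_ge0.
  apply: (@closed_comp _ _ (fun y => qform 1%:M y y) [set 1]) => [y _|].
    exact: continuous_qform.
  exact: closed_eq.
have [c /set_mem c1 cmin] := @EVT_min_rV R m (fun y => qform A y y) sphere
  (ex_intro _ _ (normalise x x0)) csphere
  (continuous_subspaceT (@continuous_qform A)).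
set mu := qform A c c in cmin.
have mu_le y : mu * qform 1%:M y y <= qform A y y.
  have [->|y0] := eqVneq y 0; first by rewrite -[0](scale0r 0) !qformZl !mul0r mulr0.
  have := cmin _ (mem_set (normalise y y0)); rewrite qformZl qformZr mulrA -invfM -expr2.
  by rewrite sqr_sqrtr ?qform1_ge0// mulrC ler_pdivlMr ?q0.
have eig : eigenvalue A mu.
  have c0 : c != 0.
    apply: contra_eq_neq c1 => ->; rewrite -[0](scale0r 0) qformZl mul0r.
    by rewrite eq_sym oner_eq0.
  apply/eigenvalueP; exists c => //.
  pose u := c *m A - mu *: c.
  suff : u = 0 by move/eqP; rewrite subr_eq0 => /eqP.
  apply: qform1_eq0; apply/eqP; rewrite eq_le qform1_ge0 andbT leNgt; apply/negP => u0.
  have grad_u : qform A c u - mu * qform 1%:M c u = qform 1%:M u u.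
    rewrite /qform !mulmx1 /u [in RHS]mulmxBl -scalemxAl.
    by rewrite !mxE; congr (_ - _); rewrite mulr_sumr; apply: eq_bigr => i _; rewrite !mxE mulrA.
  clearbody u.
  have quad t : 0 <= 2 * t * qform 1%:M u u + t ^+ 2 * (qform A u u - mu * qform 1%:M u u).
    have := mu_le (c + t *: u); rewrite !(qformDl, qformDr, qformZl, qformZr).
    rewrite (qform_sym u c sA) (qform_sym u c (trmx1 _ _)) -/mu.
    rewrite [qform 1%:M c c]c1 -subr_ge0 => h; apply: le_trans h _.
    by rewrite le_eqVlt; apply/orP; left; apply/eqP; rewrite -grad_u; ring.
  exact: (quadratic_tangent u0 quad).
apply: le_trans (mu_le x); apply: ler_wpM2r; first exact: qform1_ge0.
apply: ge_inf => //; exists mu => l /= /eigenvalueP[w wl w0].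
have := mu_le w; rewrite [leRHS](_ : _ = l * qform 1%:M w w) ?ler_pM2r ?q0//.
by rewrite /qform wl -scalemxAl mulmx1 mxE.
Qed.

End Rayleigh.

Section UnitIntegral.
Context {R : realType}.
Implicit Types f g : R -> R.

Definition unit_integral f : R :=
  (\int[lebesgue_measure]_(tau in `[0%R, 1%R]) f tau)%R.

Lemma unit_integrable f : continuous f ->
  lebesgue_measure.-integrable `[0%R, 1%R] (EFin \o f).
Proof.
move=> cf; apply: continuous_compact_integrable; first exact: segment_compact.
exact: continuous_subspaceT.
Qed.

Let lebesgue01 : fine (lebesgue_measure (`[0%R, 1%R]%classic : set R)) = 1.
Proof. by rewrite lebesgue_measure_itv/= lte01 /= oppr0 addr0. Qed.

Lemma unit_integral_cst c : unit_integral (fun=> c) = c.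
Proof. by rewrite /unit_integral Rintegral_cst// lebesgue01 mulr1. Qed.

Lemma le_unit_integral f g : continuous f -> continuous g ->
  (forall t, 0 <= t <= 1 -> f t <= g t) -> unit_integral f <= unit_integral g.
Proof.
move=> cf cg fg; apply: le_Rintegral; [by []|exact: unit_integrable|exact: unit_integrable|].
by move=> t /=; rewrite in_itv/=; exact: fg.
Qed.

Lemma unit_integralB f g : continuous f -> continuous g ->
  unit_integral (fun t => f t - g t) = unit_integral f - unit_integral g.
Proof. by move=> cf cg; apply: RintegralB => //; exact: unit_integrable. Qed.

Lemma unit_integralZ c f : continuous f ->
  unit_integral (fun t => c * f t) = c * unit_integral f.
Proof. by move=> cf; apply: RintegralZl => //; exact: unit_integrable. Qed.

Lemma unit_integral_sum (n : nat) (f : 'I_n -> R -> R) : (forall i, continuous (f i)) ->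
  unit_integral (fun t => \sum_i f i t) = \sum_i unit_integral (f i).
Proof.
move=> cf; elim: (index_enum _) => [|i r IH].
  rewrite big_nil (_ : (fun _ => _) = fun=> 0) ?unit_integral_cst//.
  by apply/funext => t; rewrite big_nil.
rewrite big_cons -IH (_ : (fun _ => _) = fun t => f i t + \sum_(j <- r) f j t).
  apply: RintegralD => //; apply: unit_integrable => //; exact: continuous_sumR.
by apply/funext => t; rewrite big_cons.
Qed.

Lemma unit_integral_le_cst f c : continuous f ->
  (forall t, 0 <= t <= 1 -> `|f t| <= c) -> `|unit_integral f| <= c.
Proof.
move=> cf fc; rewrite ler_norml -[- c](unit_integral_cst) -[X in _ && (_ <= X)](unit_integral_cst c).
apply/andP; split; apply: le_unit_integral => //; try exact: cst_continuous.
  by move=> t /fc; rewrite ler_norml => /andP[].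
by move=> t /fc; rewrite ler_norml => /andP[].
Qed.

Lemma unit_integral_id : unit_integral id = 2^-1.
Proof.
rewrite /unit_integral /Rintegral.
rewrite (@continuous_FTC2 R id (fun x => x ^+ 2 / 2) 0 1)//=.
- by rewrite expr1n expr0n/= !mul0r subr0 mul1r.
- by apply: continuous_subspaceT => x; exact: cvg_id.
- have cF : continuous (fun x : R => x ^+ 2 / 2).
    by apply: continuous_mulR; [exact: sqr_continuous|exact: cst_continuous].
  by split=> [x _||]; [|apply: cvg_at_right_filter; exact: cF|
    apply: cvg_at_left_filter; exact: cF].
- move=> x _; rewrite derive1E; have -> : (fun x : R => x ^+ 2 / 2) = 2^-1 \*: (fun x : R => x ^+ 2).
    by apply/funext => y /=; rewrite mulrC.
  rewrite deriveZ//= exp_derive/= expr1.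
  by rewrite -[LHS]/(2^-1 * ((2 * x) * 1)) mulr1 mulrA mulVf// mul1r.
Qed.

End UnitIntegral.

Section GradientEstimates.
Context {R : realType} {m : nat}.
Implicit Types (F : 'rV[R]_m -> R) (x y w q a : 'rV[R]_m).

Lemma class_C_partial k F i : class_C k.+1 F -> class_C k (partial i F).
Proof.
move=> CF s sk; have E : pderivs s (partial i F) = pderivs (rcons s i) F.
  by rewrite /pderivs -cats1 foldr_cat.
have si : (size (rcons s i) <= k.+1)%N by rewrite size_rcons.
have [c d] := CF (rcons s i) si.
by rewrite E; split=> [|sk']; [exact: c|apply: d; rewrite size_rcons].
Qed.

Lemma is_derive_C1_line F y w (t : R) : class_C 1 F ->
  is_derive t 1 (fun s : R => F (y + s *: w)) (\sum_i w 0 i * partial i F (y + t *: w)).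
Proof.
move=> CF; have dF := directional_derivative (y + t *: w) w CF.
rewrite -(@derive_val _ _ _ _ _ _ _ dF); apply: is_derive_line.
by case: dF.
Qed.

Lemma continuous_C1_line F y w : class_C 1 F -> continuous (fun s : R => F (y + s *: w)).
Proof.
move=> CF t; have [d _] := is_derive_C1_line y w t CF.
by apply: differentiable_continuous; exact/derivable1_diffP.
Qed.

Lemma segment_MVT F x y : class_C 1 F ->
  exists2 c : R, 0 <= c <= 1 &
    F x - F y = \sum_i (x - y) 0 i * partial i F (y + c *: (x - y)).
Proof.
move=> CF.
have [|c] := @MVT_segment R (fun s => F (y + s *: (x - y)))
  (fun s => \sum_i (x - y) 0 i * partial i F (y + s *: (x - y))) 0 1 ler01
  (fun t _ => is_derive_C1_line y (x - y) t CF).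
  by apply: continuous_subspaceT; exact: continuous_C1_line.
rewrite in_itv/= => c01; rewrite scale1r scale0r addr0 subr0 mulr1 [y + (_ - _)]addrC subrK => E.
by exists c.
Qed.

Lemma norm_segment_le x y (c r : R) : 0 <= c <= 1 -> `|x| <= r -> `|y| <= r ->
  `|y + c *: (x - y)| <= r.
Proof.
move=> /andP[c0 c1] xr yr.
have -> : y + c *: (x - y) = (1 - c) *: y + c *: x.
  by rewrite scalerBr scalerBl scale1r addrA addrAC.
apply: le_trans (ler_normD _ _) _; rewrite !normrZ (ger0_norm c0) ger0_norm ?subr_ge0//.
rewrite -[leRHS]mul1r -[X in X * r](subrK c 1) [leRHS]mulrDl.
by apply: lerD; apply: ler_wpM2l => //; rewrite subr_ge0.
Qed.

Lemma continuous_bounded_ball F (r : R) : continuous F -> 0 <= r ->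
  exists2 M : R, 0 <= M & forall x, `|x| <= r -> `|F x| <= M.
Proof.
move=> cF r0.
pose A := [set x : 'rV[R]_m | `|x| <= r].
have cA : compact A.
  apply: bounded_closed_compact.
    exists r; split=> [|M rM x /= xr]; first exact: num_real.
    exact: le_trans (ltW rM).
  apply: (@closed_comp _ _ (fun x : 'rV[R]_m => `|x|) [set t | t <= r]) => [x _|].
    exact: norm_continuous.
  exact: closed_le.
have A0 : A !=set0 by exists 0; rewrite /A /= normr0.
have cnF : continuous (fun x => `|F x|).
  by move=> x; apply: (cvg_comp _ _ (cF x)); exact: norm_continuous.
have [c _ cmax] := @EVT_max_rV R m (fun x => `|F x|) A A0 cA (continuous_subspaceT cnF).
by exists `|F c| => // x xr; apply: cmax; exact/mem_set.
Qed.

Lemma C1_lipschitz_ball F (r : R) : class_C 1 F -> 0 <= r ->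
  exists2 L : R, 0 <= L & forall x y, `|x| <= r -> `|y| <= r ->
    `|F x - F y| <= L * `|x - y|.
Proof.
move=> CF r0.
have ex i : exists M : R, 0 <= M /\ forall x, `|x| <= r -> `|partial i F x| <= M.
  have [] := @continuous_bounded_ball (partial i F) r _ r0.
    by have [] := CF [:: i] isT.
  by move=> M M0 MP; exists M.
have [M MP] := choice ex.
exists (\sum_i M i); first by apply: sumr_ge0 => i _; exact: (MP i).1.
move=> x y xr yr; have [c c01 ->] := segment_MVT x y CF.
apply: le_trans (ler_norm_sum _ _ _) _; rewrite mulr_suml; apply: ler_sum => i _.
rewrite normrM mulrC; apply: ler_pM => //; last exact: rV_coord_le.
by apply: (MP i).2; exact: norm_segment_le.
Qed.

(** By the mean value theorem along the segment, the right-hand side is the Hessian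
    form at an intermediate point. Symmetry of the Hessian enters
    through the variational characterisation of its smallest eigenvalue. *)
Lemma gradient_monotone F (K : R) x y : class_C 2 F ->
  (forall z, - K <= lambda_min (hessian F z)) ->
  - K * qform 1%:M (x - y) (x - y) <=
  \sum_i (x - y) 0 i * (partial i F x - partial i F y).
Proof.
move=> CF hK; set w := x - y.
have C1 i := class_C_partial i CF.
have dsum (t : R) : is_derive t 1 (fun s : R => \sum_i w 0 i * partial i F (y + s *: w))
    (\sum_i w 0 i * \sum_j w 0 j * partial j (partial i F) (y + t *: w)).
  have := @is_derive_sum R R^o R^o m (fun i s => w 0 i * partial i F (y + s *: w)) t 1
    (fun i => w 0 i * \sum_j w 0 j * partial j (partial i F) (y + t *: w)).
  rewrite [in X in _ -> X](_ : (fun _ => _) =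
    \sum_(i < m) (fun s : R => w 0 i * partial i F (y + s *: w))); last first.
    by apply/funext => s; rewrite fct_sumE.
  apply => i; have h := is_derive_C1_line y w t (C1 i).
  exact: (is_deriveZ (w 0 i) h).
have cont : continuous (fun s : R => \sum_i w 0 i * partial i F (y + s *: w)).
  apply: continuous_sumR => i; apply: continuous_mulR; first exact: cst_continuous.
  exact: continuous_C1_line.
have [|c _] := @MVT_segment R _ _ 0 1 ler01 (fun t _ => dsum t).
  exact: continuous_subspaceT.
rewrite scale1r scale0r addr0 subr0 mulr1 /w [y + _]addrC subrK -/w => E.
rewrite (_ : \sum_i w 0 i * (partial i F x - partial i F y) =
  \sum_i w 0 i * partial i F x - \sum_i w 0 i * partial i F y); last first.
  by rewrite -sumrB; apply: eq_bigr => i _; rewrite mulrBr.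
rewrite E.
have -> : \sum_i w 0 i * (\sum_j w 0 j * partial j (partial i F) (y + c *: w)) =
    qform (hessian F (y + c *: w)) w w.
  rewrite qformE; apply: eq_bigr => i _; rewrite mulr_sumr; apply: eq_bigr => j _.
  rewrite [RHS]mulrAC -[RHS]mulrA; congr (_ * (_ * _)).
  by rewrite /hessian mxE; apply/esym; exact: mixed_partials.
have symH : (hessian F (y + c *: w))^T = hessian F (y + c *: w).
  by apply/matrixP => i j; rewrite !mxE; exact: mixed_partials.
apply: le_trans (lambda_min_le_qform w symH).
by apply: ler_wpM2r; [exact: qform1_ge0|exact: hK].
Qed.

End GradientEstimates.

(** * The implicit step *)

Section ImplicitStep.
Context {R : realType} {m : nat}.
Variables (F : 'rV[R]_m -> R) (K h : R).
Hypotheses (CF : class_C 2 F) (h0 : 0 < h).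
Hypothesis hessK : forall z, - K <= lambda_min (hessian F z).
Hypothesis hK4 : h ^+ 2 * K < 4.
Implicit Types (p q a b xi : 'rV[R]_m).

Definition mean_gradient q a : 'rV[R]_m :=
  \row_i unit_integral (fun tau => grad F (q + tau *: (a - q)) 0 i).

(** The implicit equation for Q_(n+1), solved for h P_n: the step goes backwards
    explicitly, h P_n = Phi(Q_n, Q_(n+1)) with Phi this map. *)
Definition momentum_map q a : 'rV[R]_m := a - q + (h ^+ 2 / 2) *: mean_gradient q a.

(** Eliminating the intermediate momentum: its mean with P_n is the velocity that
    moves Q_n to Q_(n+1). *)
Lemma avf_step_momentum v p q xi p' q' : avf_step F v h p q xi p' q' ->
  h *: p = momentum_map q q' /\
  p' = expR (- v * h) *: ((2 / h) *: (q' - q) - p) + xi.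
Proof.
move=> [pbar [qbar [Ep Eq -> ->]]].
have hn : h != 0 by rewrite gt_eqF.
have Epq : (2 / h) *: (qbar - q) - p = pbar.
  by rewrite {1}Eq [q + _]addrC addrK scalerA mulrA divfK// divff// scale1r addrK.
split; last by rewrite Epq.
rewrite /momentum_map {1}Eq [q + _]addrC addrK -[X in (h / 2) *: (X + p)]Epq.
have Emean : (h ^+ 2 / 2) *: mean_gradient q qbar = (h / 2) *: (p - pbar).
  by rewrite {1}Ep opprB addrCA subrr addr0 scalerA expr2 mulrAC.
rewrite Epq Emean -scalerDr [pbar + p]addrC addrACA subrr addr0 -mulr2n.
by rewrite -scalerMnr scalerMnl -(mulr_natr (h / 2)) divfK.
Qed.

Lemma mean_gradientE q a i : mean_gradient q a 0 i =
  unit_integral (fun tau => grad F (q + tau *: (a - q)) 0 i).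
Proof. by rewrite mxE. Qed.

Lemma continuous_grad_line q w i : continuous (fun tau : R => grad F (q + tau *: w) 0 i).
Proof.
have -> : (fun tau : R => grad F (q + tau *: w) 0 i) = (fun tau => partial i F (q + tau *: w)).
  by apply/funext => tau; rewrite mxE.
by apply: continuous_C1_line; exact: class_C_partial.
Qed.

Lemma mean_gradientB q a q' a' i :
  mean_gradient q a 0 i - mean_gradient q' a' 0 i = unit_integral (fun tau =>
    grad F (q + tau *: (a - q)) 0 i - grad F (q' + tau *: (a' - q')) 0 i).
Proof.
have E1 := mean_gradientE q a i; have E2 := mean_gradientE q' a' i.
apply: etrans (congr2 (fun x y => x - y) E1 E2) _.
by apply/esym; apply: unit_integralB; exact: continuous_grad_line.
Qed.

(** The constant K is halved because two segments with the same origin q are at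
    distance tau |a - b| at time tau, and tau has mean 1 / 2. *)
Lemma mean_gradient_monotone q a b :
  - (K / 2) * qform 1%:M (a - b) (a - b) <=
  \sum_i (a - b) 0 i * (mean_gradient q a 0 i - mean_gradient q b 0 i).
Proof.
set w := a - b; set s := qform _ _ _.
pose f i tau := grad F (q + tau *: (a - q)) 0 i - grad F (q + tau *: (b - q)) 0 i.
have cf i : continuous (f i).
  by move=> t; apply: cvgB; exact: continuous_grad_line.
have -> : \sum_i w 0 i * (mean_gradient q a 0 i - mean_gradient q b 0 i) =
    unit_integral (fun tau => \sum_i w 0 i * f i tau).
  rewrite unit_integral_sum => [|i]; last first.
    by apply: continuous_mulR; [exact: cst_continuous|exact: cf].
  apply: eq_bigr => i _; rewrite unit_integralZ//; congr (_ * _).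
  exact: mean_gradientB.
have -> : - (K / 2) * s = unit_integral (fun tau => - (K * s) * tau).
  by rewrite unit_integralZ ?unit_integral_id; [ring|move=> t; exact: cvg_id].
apply: le_unit_integral.
- by apply: continuous_mulR; [exact: cst_continuous|move=> t; exact: cvg_id].
- apply: continuous_sumR => i.
  by apply: continuous_mulR; [exact: cst_continuous|exact: cf].
move=> t /andP[t0 t1]; have [->|tn0] := eqVneq t 0.
  rewrite mulr0 big1// => i _; rewrite /f !scale0r !addr0 subrr mulr0//.
have tp : 0 < t by rewrite lt_def tn0.
have := gradient_monotone (q + t *: (a - q)) (q + t *: (b - q)) CF hessK.
have -> : q + t *: (a - q) - (q + t *: (b - q)) = t *: w.
  by rewrite opprD addrACA subrr add0r -scalerBr /w opprB addrA subrK.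
rewrite qformZl qformZr -/s => H.
rewrite -(@ler_pM2l _ t)//; apply: le_trans (le_trans _ H) _.
  by rewrite le_eqVlt; apply/orP; left; apply/eqP; ring.
rewrite mulr_sumr; apply: ler_sum => i _.
by rewrite /f /grad !mxE mulrA.
Qed.

Let c := 1 - h ^+ 2 * K / 4.

Lemma monotonicity_constant_gt0 : 0 < c.
Proof. by rewrite /c subr_gt0 ltr_pdivrMr// mul1r. Qed.

(** Pairing the difference of the two values with a - b gives at least
    c |a - b|^2 for the Euclidean norm; the factor m comes from the sup norm. *)
Lemma momentum_map_expansive q a b :
  c * `|a - b| <= m%:R * `|momentum_map q a - momentum_map q b|.
Proof.
set w := a - b; set D := _ - momentum_map q b.
have c0 := monotonicity_constant_gt0.
have [->|wn0] := eqVneq w 0; first by rewrite normr0 mulr0 mulr_ge0.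
have w0 : 0 < `|w| by rewrite normr_gt0.
have D_E i : D 0 i = w 0 i + h ^+ 2 / 2 * (mean_gradient q a 0 i - mean_gradient q b 0 i).
  rewrite /D /w /momentum_map.
  by move: (mean_gradient q a) (mean_gradient q b) => Ga Gb; rewrite !mxE; ring.
have sup_le : `|w| ^+ 2 <= qform 1%:M w w.
  have [i wi] : exists i, `|w| = `|w 0 i|.
    have /mx_norm_neq0[[i0 i] /= wi] : mx_norm w != 0 by rewrite gt_eqF.
    by exists i; rewrite [LHS]wi ord1.
  rewrite wi real_normK ?num_real// qform1 (bigD1 i)//= lerDl.
  by apply: sumr_ge0 => j _; exact: sqr_ge0.
have lower : c * qform 1%:M w w <= \sum_i w 0 i * D 0 i.
  have := mean_gradient_monotone q a b; rewrite -/w => H.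
  have h2 : 0 <= h ^+ 2 / 2 by rewrite divr_ge0// exprn_ge0// ltW.
  have {}H := ler_wpM2l h2 H.
  have -> : \sum_i w 0 i * D 0 i = qform 1%:M w w + h ^+ 2 / 2 *
      \sum_i w 0 i * (mean_gradient q a 0 i - mean_gradient q b 0 i).
    rewrite qform1 mulr_sumr -big_split; apply: eq_bigr => i _ /=.
    by rewrite D_E expr2 mulrDr; congr (_ + _); rewrite mulrCA.
  have -> : c * qform 1%:M w w = qform 1%:M w w +
      h ^+ 2 / 2 * (- (K / 2) * qform 1%:M w w) by rewrite /c; field.
  by rewrite lerD2l.
have upper : \sum_i w 0 i * D 0 i <= m%:R * (`|w| * `|D|).
  apply: le_trans (_ : \sum_(i < m) `|w| * `|D| <= _); last first.
    by rewrite sumr_const card_ord mulr_natl.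
  apply: ler_sum => i _; apply: le_trans (ler_norm _) _.
  by rewrite normrM; apply: ler_pM => //; exact: rV_coord_le.
rewrite -(@ler_pM2r _ `|w|)// -mulrA -expr2.
apply: le_trans (_ : c * qform 1%:M w w <= _); first by rewrite ler_pM2l.
by apply: le_trans lower _; apply: le_trans upper _; rewrite -mulrA [`|w| * _]mulrC.
Qed.

Lemma momentum_map_lipschitz (r : R) : 0 <= r -> exists2 L : R, 0 <= L &
  forall q a q' a', `|q| <= r -> `|a| <= r -> `|q'| <= r -> `|a'| <= r ->
  `|momentum_map q a - momentum_map q' a'| <= L * (`|q - q'| + `|a - a'|).
Proof.
move=> r0.
have ex i : exists L : R, 0 <= L /\ forall x y, `|x| <= r -> `|y| <= r ->
    `|partial i F x - partial i F y| <= L * `|x - y|.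
  by have [L L0 LP] := C1_lipschitz_ball (class_C_partial i CF) r0; exists L.
have [L LP] := choice ex.
pose S := \sum_i L i.
have S0 : 0 <= S by apply: sumr_ge0 => i _; exact: (LP i).1.
have h2 : 0 <= h ^+ 2 / 2 by rewrite divr_ge0// exprn_ge0// ltW.
exists (1 + h ^+ 2 / 2 * S); first by rewrite addr_ge0// mulr_ge0.
move=> q a q' a' qr ar q'r a'r.
have mg : `|mean_gradient q a - mean_gradient q' a'| <= S * (`|q - q'| + `|a - a'|).
  have N0 : 0 <= `|q - q'| + `|a - a'| by rewrite addr_ge0.
  apply/rV_norm_leP; first by rewrite mulr_ge0.
  move=> i; rewrite [X in `|X|](_ : _ = unit_integral (fun tau =>
    grad F (q + tau *: (a - q)) 0 i - grad F (q' + tau *: (a' - q')) 0 i)); last first.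
    by rewrite -mean_gradientB mxE [X in _ + X]mxE.
  apply: unit_integral_le_cst => [t|t t01].
    by apply: cvgB; exact: continuous_grad_line.
  rewrite /grad !mxE; apply: le_trans ((LP i).2 _ _ _ _) _; [exact: norm_segment_le..|].
  apply: ler_pM => //; first exact: (LP i).1.
    by rewrite /S (bigD1 i)//= lerDl; apply: sumr_ge0 => j _; exact: (LP j).1.
  have /andP[t0 t1] := t01.
  have -> : q + t *: (a - q) - (q' + t *: (a' - q')) = (1 - t) *: (q - q') + t *: (a - a').
    by apply/rowP => k; rewrite !mxE; ring.
  apply: le_trans (ler_normD _ _) _; rewrite !normrZ (ger0_norm t0) ger0_norm ?subr_ge0//.
  by apply: lerD; apply: ler_piMl => //; rewrite gerBl.
have -> : momentum_map q a - momentum_map q' a' = (a - a') - (q - q') +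
    (h ^+ 2 / 2) *: (mean_gradient q a - mean_gradient q' a').
  rewrite /momentum_map; move: (mean_gradient q a) (mean_gradient q' a') => Ga Gb.
  by apply/rowP => k; rewrite !mxE; ring.
apply: le_trans (ler_normD _ _) _; rewrite [leRHS]mulrDl mul1r; apply: lerD.
  by apply: le_trans (ler_normB _ _) _; rewrite addrC.
by rewrite normrZ ger0_norm// -mulrA ler_wpM2l.
Qed.

(** Q_(n+1) is a continuous function of (P_n, Q_n): Phi(q, .) expands distances, and
    Phi is locally Lipschitz in q. This is what replaces a measurable solution
    operator of the implicit equation. *)
Lemma position_update_continuous p q a (e : R) : h *: p = momentum_map q a -> 0 < e ->
  exists2 dl : R, 0 < dl & forall p' q' a', h *: p' = momentum_map q' a' ->
    `|p' - p| < dl -> `|q' - q| < dl -> `|a' - a| < e.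
Proof.
move=> Ep e0; have c0 := monotonicity_constant_gt0.
pose r := `|q| + `|a| + 1.
have r0 : 0 <= r by rewrite !addr_ge0.
have [L L0 LP] := momentum_map_lipschitz r0.
pose B := m%:R * (h + L) + 1.
have B0 : 0 < B by rewrite ltr_wpDl// mulr_ge0// addr_ge0// ltW.
pose dl := Num.min 1 (c * e / B).
have dl0 : 0 < dl by rewrite lt_min ltr01 divr_gt0// mulr_gt0.
exists dl => // p' q' a' Ep' pp' qq'.
have q'r : `|q'| <= r.
  rewrite -(subrK q q'); apply: le_trans (ler_normD _ _) _; rewrite /r addrC -addrA lerD2l.
  by apply: le_trans (ltW qq') _; rewrite ge_min (_ : 1 <= _) ?lerDr.
have step : c * `|a' - a| <= m%:R * ((h + L) * dl).
  apply: le_trans (momentum_map_expansive q' a' a) _; apply: ler_wpM2l => //.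
  rewrite -Ep' (_ : _ - _ = h *: (p' - p) + (momentum_map q a - momentum_map q' a)); last first.
    by rewrite -Ep scalerBr addrA subrK.
  apply: le_trans (ler_normD _ _) _; rewrite mulrDl; apply: lerD.
    by rewrite normrZ gtr0_norm// ler_wpM2l// ltW.
  apply: le_trans (LP _ _ _ _ _ _ _ _) _ => //.
  - by rewrite /r -addrA lerDl addr_ge0.
  - by rewrite /r -addrA addrCA lerDl addr_ge0.
  - by rewrite /r -addrA addrCA lerDl addr_ge0.
  by rewrite subrr normr0 addr0 ler_wpM2l// distrC ltW.
rewrite -(@ltr_pM2l _ c)//; apply: le_lt_trans step _.
apply: lt_le_trans (_ : B * dl <= _); first by rewrite mulrA ltr_pM2r// /B ltrDl.
by rewrite -ler_pdivlMl// mulrC /dl ge_min lexx orbT.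
Qed.

End ImplicitStep.

(** * Implicitly defined adapted variables *)

Section ContinuousRelation.
Context {R : realType} {dT : measure_display} {T : measurableType dT} {n : nat}.
Variables (X : T -> 'rV[R]_n) (y : T -> R) (D : set T).
Hypothesis mX : forall i, measurable_fun setT (fun w => X w 0 i).
Hypothesis mD : measurable D.

(** By continuity the part of D on which y > x is the union of the events, X in a
    rational cube, on which it holds throughout; there are countably many. *)
Lemma measurable_continuous_dependence :
  (forall w (e : R), D w -> 0 < e -> exists2 dl : R, 0 < dl &
     forall w', D w' -> `|X w' - X w| < dl -> `|y w' - y w| < e) ->
  measurable_fun D y.
Proof.
move=> ydep; apply: (measurability (@RGenOInfty.G R)); first exact: RGenOInfty.measurableE.
move=> _ [_ [x ->] <-].
pose cube (qk : 'rV[rat]_n * nat) :=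
  [set w | forall i, `|X w 0 i - ratr (qk.1 0 i)| <= qk.2.+1%:R^-1].
have mcube qk : measurable (cube qk).
  have -> : cube qk = \bigcap_(i in [set: 'I_n])
      [set w | `|X w 0 i - ratr (qk.1 0 i)| <= qk.2.+1%:R^-1].
    by apply/seteqP; split=> w h i; [move=> _; exact: h|exact: h].
  apply: fin_bigcap_measurable => // i _; rewrite -[X in measurable X]setTI.
  apply: measurable_fun_le => //; apply: measurableT_comp => //.
  exact: measurable_funB.
pose S := [set qk | forall w, D w -> cube qk w -> x < y w].
have -> : D `&` y @^-1` `]x, +oo[ = \bigcup_qk (if qk \in S then D `&` cube qk else set0).
  apply/seteqP; split=> w; last first.
    move=> [qk _]; case: ifPn => // /set_mem Sqk [Dw cw].
    by split=> //=; rewrite in_itv/= andbT; exact: Sqk.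
  rewrite /= in_itv/= andbT => -[Dw xy].
  have yx0 : 0 < y w - x by rewrite subr_gt0.
  have [dl dl0 ydl] := ydep w _ Dw yx0.
  pose k := Num.truncn (2 / dl).
  have k0 : 0 < k.+1%:R^-1 :> R by rewrite invr_gt0.
  have kdl : k.+1%:R^-1 + k.+1%:R^-1 < dl.
    rewrite -div1r -mulrDl ltr_pdivrMr// mulrC -ltr_pdivrMr//; exact: truncnS_gt.
  have rat_near (t : R) : exists q : rat, `|t - ratr q| <= k.+1%:R^-1.
    have tk : t < t + k.+1%:R^-1 by rewrite ltrDl.
    have [q] := rat_in_itvoo tk; rewrite in_itv/= => /andP[q1 q2]; exists q.
    by rewrite ler_distlC (ltW q2) andbT lerBlDr (le_trans (ltW q1))// lerDl ltW.
  have [qf qfP] := choice (fun i => rat_near (X w 0 i)).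
  pose q : 'rV[rat]_n := \row_i qf i.
  have cqk : cube (q, k) w by move=> i; rewrite /= mxE.
  exists (q, k) => //; rewrite mem_set//= => w' Dw' cw'.
  have : `|y w' - y w| < y w - x.
    apply: ydl => //; apply: le_lt_trans kdl.
    apply/rV_norm_leP => [|i]; first by rewrite addr_ge0// ltW.
    rewrite !mxE (_ : X w' 0 i - X w 0 i = (X w' 0 i - ratr (q 0 i)) -
      (X w 0 i - ratr (q 0 i))); last by ring.
    by apply: le_trans (ler_normB _ _) _; apply: lerD; [exact: cw'|exact: cqk].
  by rewrite ltr_distlC => /andP[_ +]; lra.
apply: countable_bigcupT_measurable; first exact: countableP.
by move=> qk; case: ifP => // _; exact: measurableI.
Qed.

End ContinuousRelation.

Section AdaptedDependence.
Context {R : realType} {dis : measure_display} {Omega : measurableType dis}.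
Variables (P : probability Omega R) (Ft : R -> set_system Omega).
Hypothesis hFt : filtration Ft.

Lemma past_null s (N : set Omega) : 0 <= s -> measurable N -> P N = 0%E -> past P Ft s N.
Proof.
move=> s0 mN PN; split=> // e e0; exists set0.
  by have [[]] := hFt.1 s s0.
by rewrite setY0 PN lee_fin ltW.
Qed.

Lemma adapted_continuous_dependence n s (X : Omega -> 'rV[R]_n) (y : Omega -> R)
    (N : set Omega) :
  0 <= s -> measurable N -> P N = 0%E -> measurable_fun setT y ->
  (forall i, adapted P Ft s (fun w => X w 0 i)) ->
  (forall w (e : R), ~ N w -> 0 < e -> exists2 dl : R, 0 < dl &
     forall w', ~ N w' -> `|X w' - X w| < dl -> `|y w' - y w| < e) ->
  adapted P Ft s y.
Proof.
move=> s0 mN PN my aX ydep.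
have mgP E := measurable_pastP hFt E s0.
have pN : past P Ft s N by exact: past_null.
have mNC : measurable (~` N : set (g_sigma_algebraType (past P Ft s))).
  by apply: measurableC; exact/mgP.
have myN := measurable_continuous_dependence aX mNC ydep.
move=> _ A mA; rewrite setTI.
have -> : y @^-1` A = (~` N `&` y @^-1` A) `|` (N `&` y @^-1` A).
  by rewrite -setIUl setUC setUCr setTI.
apply: measurableU; first exact: myN.
have mNA : measurable (N `&` y @^-1` A : set Omega).
  by apply: measurableI => //; rewrite -[X in measurable X]setTI; exact: my.
apply/mgP; apply: past_null => //.
apply/eqP; rewrite eq_le measure_ge0 andbT -PN.
by apply: le_measure; rewrite ?inE//; exact: subIsetl.
Qed.

End AdaptedDependence.

(** * Small balls for vector noise *)

Section DualFamily.
Context {R : realType} {m d : nat}.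
Variables (sigma : 'I_d -> 'rV[R]_m) (A : {set 'I_d}).
Hypothesis freeA : free [seq sigma k | k in A].

(** A right inverse of the matrix whose rows are the sigma_k, k in A. *)
Lemma dual_family : exists phi : 'I_d -> 'cV[R]_m, forall j k, j \in A -> k \in A ->
  (sigma j *m phi k) 0 0 = (j == k)%:R.
Proof.
pose S : 'M[R]_(#|A|, m) := \matrix_(i, l) sigma (enum_val i) 0 l.
have sz : size [seq sigma k | k in A] == #|A| by rewrite size_map -cardE.
have rowS i : row i S = sigma (enum_val i) by apply/rowP => l; rewrite !mxE.
have nthS (i : 'I_#|A|) : [seq sigma k | k in A]`_i = sigma (enum_val i).
  rewrite (nth_map (enum_val i)); last by rewrite -cardE.
  by rewrite -enum_val_nth.
have freeS : row_free S.
  rewrite -kermx_eq0; apply/eqP/row_matrixP => i; rewrite row0.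
  set u := row i _.
  have uS : u *m S = 0 by rewrite /u -row_mul mulmx_ker row0.
  have us0 : \sum_j u 0 j *: (Tuple sz)`_j = 0.
    apply: etrans uS; rewrite mulmx_sum_row; apply: eq_bigr => j _.
    by rewrite rowS nthS.
  have fT : free (Tuple sz) by [].
  by apply/rowP => j; rewrite [RHS]mxE; exact: (freeP fT _ us0).
have [B SB] := row_freeP freeS.
exists (fun k => \col_l \sum_(i < #|A| | enum_val i == k) B l i).
move=> j k jA kA.
pose ij := enum_rank_in jA j; pose ik := enum_rank_in kA k.
have Ej : enum_val ij = j by exact: enum_rankK_in.
have Ek : enum_val ik = k by exact: enum_rankK_in.
have := congr1 (fun X : 'M[R]_(#|A|) => X ij ik) SB; rewrite !mxE.
have -> : (ij == ik) = (j == k).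
  by rewrite -Ej -Ek (inj_eq enum_val_inj).
move=> <-; apply: eq_bigr => l _; rewrite !mxE Ej; congr (_ * _).
rewrite (bigD1 ik) ?Ek//= big1 ?addr0// => i /andP[/eqP ik1 /negP []].
by apply/eqP/enum_val_inj; rewrite ik1.
Qed.

End DualFamily.

Section VectorSmallBall.
Context {R : realType} {dis : measure_display} {Omega : measurableType dis}.
Variables (P : probability Omega R) (Ft : R -> set_system Omega).
Hypothesis hFt : filtration Ft.
Context {m d : nat}.
Variables (s C : R) (J : 'I_d -> Omega -> R).
Hypotheses (s0 : 0 <= s) (C0 : 0 <= C).
Hypothesis mJ : forall k, measurable_fun setT (J k).
Hypothesis ball : forall (E : set Omega) (Y : 'I_d -> Omega -> R) (r : R),
  past P Ft s E -> (forall k, adapted P Ft s (Y k)) -> 0 < r ->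
  (P (E `&` [set w | forall k, (`|Y k w + J k w| <= r)%R]) <=
   ((C * r) ^+ d)%:E * P E)%E.
Variables (sigma : 'I_d -> 'rV[R]_m) (A : {set 'I_d}).
Hypotheses (freeA : free [seq sigma k | k in A]) (mA : (m <= #|A|)%N).

(** The components J_l, l \notin A, are confined to a bounded set, which is cut into
    O(r ^ - (d - #|A|)) cells of size r. On each cell the components J_k, k \in A,
    are confined to intervals of length O(r) by means of the dual family, so that
    the cell has probability O(r ^ d). *)
Lemma vector_small_ball (b : R) : 0 <= b -> exists2 C' : R, 0 <= C' &
  forall (E : set Omega) (Y : Omega -> 'rV[R]_m) (r : R),
  past P Ft s E -> (forall i, adapted P Ft s (fun w => Y w 0 i)) -> 0 < r <= 1 ->
  (P (E `&` [set w | (`|Y w + \sum_k J k w *: sigma k| <= r)%R /\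
                     forall k, (`|J k w| <= b)%R]) <= (C' * r ^+ m)%:E * P E)%E.
Proof.
move=> b0; have [phi phiP] := dual_family freeA.
pose beta := \sum_k \sum_i `|phi k i 0|.
pose gamma := \sum_l \sum_k `|(sigma l *m phi k) 0 0|.
pose c1 := beta + gamma + 1.
have beta0 : 0 <= beta by apply: sumr_ge0 => k _; apply: sumr_ge0.
have gamma0 : 0 <= gamma by apply: sumr_ge0 => k _; apply: sumr_ge0.
have c10 : 0 < c1 by rewrite ltr_wpDl// addr_ge0.
have dualE (u : 'rV[R]_m) k : (u *m phi k) 0 0 = \sum_i u 0 i * phi k i 0 by rewrite mxE.
have dual_le (u : 'rV[R]_m) k : `|(u *m phi k) 0 0| <= beta * `|u|.
  rewrite dualE; apply: le_trans (ler_norm_sum _ _ _) _.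
  apply: (@le_trans _ _ (\sum_i `|phi k i 0| * `|u|)).
    by apply: ler_sum => i _; rewrite normrM mulrC ler_wpM2l// rV_coord_le.
  rewrite -mulr_suml ler_wpM2r// /beta (bigD1 k)//= lerDl.
  by apply: sumr_ge0 => j _; apply: sumr_ge0.
pose T := {l : 'I_d | l \notin A}.
have cardT : #|{: T}| = (d - #|A|)%N.
  rewrite card_sig; have /esym := cardsC A; rewrite card_ord => E.
  by rewrite [X in (X - _)%N]E addKn; apply: eq_card => l; rewrite !inE.
exists ((2 * b + 1) ^+ (d - #|A|) * (C * c1) ^+ d).
  by rewrite mulr_ge0 ?exprn_ge0 ?addr_ge0 ?mulr_ge0// ltW.
move=> E Y r pE aY /andP[r0 r1].
have mE : measurable E by have [] := pE.
pose M := (Num.truncn (2 * b / r)).+1.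
pose grid (g : {ffun T -> 'I_M}) (l : 'I_d) : R :=
  if insub l is Some t then (g t : nat)%:R * r - b else 0.
pose Z (g : {ffun T -> 'I_M}) (k : 'I_d) w : R :=
  if k \in A then (Y w *m phi k) 0 0 + \sum_(l | l \notin A) grid g l * (sigma l *m phi k) 0 0
  else - grid g k.
have aZ g k : adapted P Ft s (Z g k).
  rewrite /adapted /Z; case: (k \in A) => //.
  apply: measurable_funD => //.
  under eq_fun do rewrite dualE.
  by apply: measurable_sum => i; apply: measurable_funM => //; exact: aY.
pose cell g := E `&` [set w | forall k, (`|Z g k w + J k w| <= c1 * r)%R].
have Pcell g : (P (cell g) <= ((C * (c1 * r)) ^+ d)%:E * P E)%E.
  by apply: ball => //; rewrite mulr_gt0.
have mZ g k : measurable_fun setT (Z g k) by exact: (measurable_adapted hFt s0 (aZ g k)).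
have mcell g : measurable (cell g).
  apply: measurableI => //.
  by apply: measurable_forall_norm_le => k; exact: measurable_funD.
have mY i := measurable_adapted hFt s0 (aY i).
have mV i : measurable_fun setT (fun w => (Y w + \sum_k J k w *: sigma k) 0 i).
  rewrite (_ : (fun w => _) = fun w => Y w 0 i + \sum_k J k w * sigma k 0 i); last first.
    by apply/funext => w; rewrite mxE summxE; congr (_ + _); apply: eq_bigr => k _; rewrite mxE.
  apply: measurable_funD => //; apply: measurable_sum => k.
  exact: measurable_funM.
have cover : E `&` [set w | (`|Y w + \sum_k J k w *: sigma k| <= r)%R /\
    forall k, (`|J k w| <= b)%R] `<=` [set w | exists g, cell g w].
  move=> w [wE [wV wJ]].
  have near_grid (l : 'I_d) : exists n : 'I_M, `|J l w - (n%:R * r - b)| <= r.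
    have Jb0 : 0 <= (J l w + b) / r.
      rewrite divr_ge0 ?(ltW r0)// -lerBlDr sub0r.
      by have := wJ l; rewrite ler_norml => /andP[].
    have nM : (Num.truncn ((J l w + b) / r) < M)%N.
      rewrite /M ltnS truncn_le_nat.
      apply: le_lt_trans (truncnS_gt _).
      rewrite ler_pM2r ?invr_gt0// mulr2n mulrDl mul1r lerD2r.
      by have := wJ l; rewrite ler_norml => /andP[].
    exists (Ordinal nM) => /=.
    have /andP[t1 t2] := truncn_itv Jb0.
    rewrite ler_pdivlMr// in t1; rewrite ltr_pdivrMr// -natr1 mulrDl mul1r in t2.
    rewrite ler_norml; apply/andP; split; lra.
  have [nl nlP] := choice near_grid.
  exists [ffun t : T => nl (val t)]; split=> // k.
  have gridE l : l \notin A -> grid [ffun t : T => nl (val t)] l = (nl l)%:R * r - b.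
    by move=> lA; rewrite /grid insubT ffunE.
  rewrite /Z; case: ifPn => [kA|kA]; last first.
    rewrite gridE// addrC; apply: le_trans (nlP k) _.
    by rewrite ler_peMl ?(ltW r0)// /c1 lerDr addr_ge0.
  have decomp : (Y w *m phi k) 0 0 + J k w =
      ((Y w + \sum_j J j w *: sigma j) *m phi k) 0 0 -
      \sum_(l | l \notin A) J l w * (sigma l *m phi k) 0 0.
    have -> : ((Y w + \sum_j J j w *: sigma j) *m phi k) 0 0 =
        (Y w *m phi k) 0 0 + \sum_j J j w * (sigma j *m phi k) 0 0.
      rewrite mulmxDl mulmx_suml [LHS]mxE summxE; congr (_ + _).
      by apply: eq_bigr => j _; rewrite -scalemxAl [LHS]mxE.
    rewrite [\sum_j _](bigID (mem A)) /= (bigD1 k)//= phiP// eqxx mulr1.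
    rewrite big1 ?addr0 ?addrA ?addrK// => j /andP[jA jk].
    by rewrite phiP// (negPf jk) mulr0.
  set G := grid _ in gridE *.
  have -> : (Y w *m phi k) 0 0 + \sum_(l | l \notin A) G l * (sigma l *m phi k) 0 0 + J k w =
      ((Y w + \sum_j J j w *: sigma j) *m phi k) 0 0 -
      \sum_(l | l \notin A) (J l w - G l) * (sigma l *m phi k) 0 0.
    have -> : \sum_(l | l \notin A) (J l w - G l) * (sigma l *m phi k) 0 0 =
        \sum_(l | l \notin A) J l w * (sigma l *m phi k) 0 0 -
        \sum_(l | l \notin A) G l * (sigma l *m phi k) 0 0.
      by rewrite -sumrB; apply: eq_bigr => l _; rewrite mulrBl.
    by rewrite addrAC decomp opprB addrA [RHS]addrAC.
  rewrite /c1 -addrA mulrDl; apply: le_trans (ler_normB _ _) _; apply: lerD.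
    by apply: le_trans (dual_le _ _) _; rewrite ler_wpM2l.
  apply: le_trans (_ : gamma * r <= _); last by rewrite ler_wpM2r ?(ltW r0)// lerDl.
  apply: le_trans (ler_norm_sum _ _ _) _; rewrite /gamma mulr_suml.
  rewrite [leRHS](bigID (mem A)) /=.
  apply: le_trans (_ : \sum_(l | l \notin A) (\sum_k `|(sigma l *m phi k) 0 0|) * r <= _); last first.
    rewrite lerDr; apply: sumr_ge0 => l _; rewrite mulr_ge0 ?(ltW r0)//.
    by apply: sumr_ge0.
  apply: ler_sum => l lA; rewrite normrM mulrC; apply: ler_pM => //; last first.
    by rewrite gridE.
  by rewrite (bigD1 k)//= lerDl; apply: sumr_ge0.
have mbig : measurable [set w | exists g, cell g w].
  have -> : [set w | exists g, cell g w] = \bigcup_(g in [set: {ffun T -> 'I_M}]) cell g.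
    by apply/seteqP; split=> w [g]; exists g.
  by apply: countable_bigcupT_measurable; [exact: countableP|exact: mcell].
have m1 := measurable_rV_norm_le (ltW r0) mV.
have m2 := measurable_forall_norm_le b mJ.
apply: (@le_trans _ _ (P [set w | exists g, cell g w])).
  by apply: le_measure; rewrite ?inE//; apply: measurableI => //; exact: measurableI m1 m2.
apply: le_trans (measure_union_le _ mcell) _.
apply: (@le_trans _ _ (\sum_(g : {ffun T -> 'I_M}) ((C * (c1 * r)) ^+ d)%:E * P E)%E).
  by apply: lee_sum => g _; exact: Pcell.
have pE1 : P E = (fine (P E))%:E by rewrite fineK// fin_num_measure.
rewrite pE1 -EFinM sumEFin lee_fin sumr_const card_ffun card_ord cardT -(mulr_natr _ (M ^ _)).
rewrite mulrAC; apply: ler_wpM2r; first exact: fine_ge0.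
have Ad : (#|A| <= d)%N by rewrite -[d in (_ <= d)%N]card_ord max_card.
have Mr : M%:R * r <= 2 * b + 1.
  rewrite /M -natr1 mulrDl mul1r lerD// -ler_pdivlMr//.
  by rewrite truncn_le// divr_ge0 ?mulr_ge0// ltW.
set n := (d - #|A|)%N.
have rd : r ^+ d = r ^+ n * r ^+ #|A| by rewrite -exprD subnK.
have -> : (C * (c1 * r)) ^+ d * (M ^ n)%:R =
    (M%:R * r) ^+ n * (C * c1) ^+ d * r ^+ #|A|.
  rewrite natrX mulrA [(C * c1 * r) ^+ d]exprMn rd [(M%:R * r) ^+ n]exprMn.
  by rewrite mulrAC mulrA [X in X * r ^+ #|A|]mulrC mulrAC -!mulrA; congr (_ * (_ * _)); rewrite mulrC.
have r0' := ltW r0.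
apply: ler_pM.
- by rewrite mulr_ge0// exprn_ge0// mulr_ge0// ltW.
- exact: exprn_ge0.
- apply: ler_wpM2r; first by rewrite exprn_ge0// mulr_ge0// ltW.
  by apply: lerXn2r Mr; rewrite nnegrE ?addr_ge0 ?mulr_ge0.
- exact: ler_wiXn2l.
Qed.

End VectorSmallBall.

(** * The law of the scheme *)

Section SchemeLaw.
Context {R : realType} {dis : measure_display} {Omega : measurableType dis}.
Variables (P : probability Omega R) (Ft : R -> set_system Omega) (m d : nat).
Variable W : 'I_d -> R -> {RV P >-> R}.
Hypotheses (hFt : filtration Ft) (hW : wiener_process W Ft).
Variables (F : 'rV[R]_m -> R) (K h v : R).
Hypotheses (CF : class_C 2 F) (h0 : 0 < h) (v0 : 0 < v).
Hypothesis hessK : forall z, - K <= lambda_min (hessian F z).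
Hypothesis hK4 : h ^+ 2 * K < 4.
Variables (sigma : 'I_d -> 'rV[R]_m) (A : {set 'I_d}).
Hypotheses (freeA : free [seq sigma k | k in A]) (mA : (m <= #|A|)%N).
Variables (N : nat) (X0 : 'rV[R]_(m + m)) (X : nat -> Omega -> 'rV[R]_(m + m)).
Variable J : nat -> 'I_d -> {RV P >-> R}.
Hypothesis hXm : forall n, (n <= N)%N -> random_vector (X n).
Hypothesis intJ : forall n k, (n < N)%N ->
  is_wiener_integral P (W k) (n%:R * h) (n.+1%:R * h)
    (fun t => expR (- v * (n.+1%:R * h - t))) (J n k).
Variable Z : set Omega.
Hypotheses (mZ : measurable Z) (PZ : P Z = 0%E).
Hypothesis X_init : forall w, ~ Z w -> X 0%N w = X0.
Hypothesis X_step : forall w n, ~ Z w -> (n < N)%N ->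
  avf_step F v h (lsubmx (X n w)) (rsubmx (X n w)) (\sum_k J n k w *: sigma k)
    (lsubmx (X n.+1 w)) (rsubmx (X n.+1 w)).

Let time n : R := n%:R * h.
Let mom n w : 'rV[R]_m := lsubmx (X n w).
Let pos n w : 'rV[R]_m := rsubmx (X n w).

Let time_ge0 n : 0 <= time n. Proof. by rewrite mulr_ge0// ltW. Qed.

Let time_lt n : time n < time n.+1.
Proof. by rewrite /time ltr_pM2r// ltr_nat. Qed.

Let measurable_X n i : (n <= N)%N -> measurable_fun setT (fun w => X n w 0 i).
Proof.
move=> nN; have mt := measurableT_comp (measurable_tnth i) (hXm nN).
rewrite (_ : (fun w => _) = (@tnth _ _)^~ i \o (fun w => row_tuple (X n w)))//.
by apply/funext => w; rewrite /= tnth_mktuple.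
Qed.

(** Null events belong to every past. *)
Lemma adapted_ae_eq s (y z : Omega -> R) : 0 <= s -> measurable_fun setT y ->
  adapted P Ft s z -> (forall w, ~ Z w -> y w = z w) -> adapted P Ft s y.
Proof.
move=> s0 my az yz.
apply: (@adapted_continuous_dependence _ _ _ _ _ hFt 1 s (fun w => \row_i z w) y Z) => //.
  by move=> i; rewrite (_ : (fun w => _) = z)//; apply/funext => w; rewrite mxE.
move=> w e Zw e0; exists e => // w' Zw'; apply: le_lt_trans.
by have := rV_coord_le (\row_(i < 1) z w' - \row_i z w) 0; rewrite !mxE !yz.
Qed.

Let adapted_J n k : (n < N)%N -> adapted P Ft (time n.+1) (J n k).
Proof.
move=> nN; apply: (adapted_wiener_integral hFt hW (time_ge0 n) (ltW (time_lt n)) _ (intJ k nN)).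
exact: measurable_funP.
Qed.

(** Q_(n+1) is determined by X_n, hence known one step before P_(n+1). *)
Let adapted_pos n i : (n < N)%N ->
  (forall j, adapted P Ft (time n) (fun w => X n w 0 j)) ->
  adapted P Ft (time n) (fun w => pos n.+1 w 0 i).
Proof.
move=> nN aX.
apply: (@adapted_continuous_dependence _ _ _ _ _ hFt (m + m) _ (X n) _ Z) => //.
  rewrite (_ : (fun w => _) = fun w => X n.+1 w 0 (rshift m i)); first exact: measurable_X.
  by apply/funext => w; rewrite /pos mxE.
move=> w e Zw e0.
have [Ep _] := avf_step_momentum h0 (X_step Zw nN).
have [dl dl0 dlP] := position_update_continuous CF h0 hessK hK4 Ep e0.
exists dl => // w' Zw' ww'.
have [Ep' _] := avf_step_momentum h0 (X_step Zw' nN).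
have := dlP _ _ _ Ep'.
rewrite -!linearB /= => /(_ (le_lt_trans (norm_lsubmx_le _) ww') (le_lt_trans (norm_rsubmx_le _) ww')).
apply: le_lt_trans; rewrite /pos.
have := rV_coord_le (rsubmx (X n.+1 w' - X n.+1 w)) i.
by rewrite linearB /= [X in `|X|]mxE [X in `|_ + X|]mxE.
Qed.

(** The part of P_(n+1) that is known at time n. *)
Let kick n w := expR (- v * h) *: ((2 / h) *: (pos n.+1 w - pos n w) - mom n w).

Let momentum_step w n : ~ Z w -> (n < N)%N ->
  mom n.+1 w = kick n w + \sum_k J n k w *: sigma k.
Proof. by move=> Zw nN; have [] := avf_step_momentum h0 (X_step Zw nN). Qed.

Let kickE n w i : kick n w 0 i = expR (- v * h) *
  ((2 / h) * (pos n.+1 w 0 i - X n w 0 (rshift m i)) - X n w 0 (lshift m i)).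
Proof. by rewrite /kick /mom /pos !mxE. Qed.

Let adapted_kick n i : (n < N)%N ->
  (forall j, adapted P Ft (time n) (fun w => X n w 0 j)) ->
  adapted P Ft (time n) (fun w => kick n w 0 i).
Proof.
move=> nN aX; have aQ := adapted_pos i nN aX.
rewrite /adapted; under eq_fun do rewrite kickE.
apply: measurable_funM => //; apply: measurable_funB; last exact: aX.
by apply: measurable_funM => //; apply: measurable_funB => //; exact: aX.
Qed.

Let adapted_X n : (n <= N)%N -> forall i, adapted P Ft (time n) (fun w => X n w 0 i).
Proof.
elim: n => [_ i|n IH nN].
  apply: (adapted_ae_eq (z := fun=> X0 0 i)) => //.
  - exact: measurable_X.
  - exact: measurable_cst.
  - by move=> w Zw; rewrite X_init.
have aX := IH (ltnW nN).
have tt := ltW (time_lt n).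
move=> i; rewrite -[i]splitK; case: (fintype.split i) => j /=; last first.
  apply: (adapted_ae_eq (z := fun w => pos n.+1 w 0 j)) => //.
  - exact: measurable_X.
  - exact: (adapted_mono hFt (time_ge0 n) tt (adapted_pos j nN aX)).
  by move=> w _; rewrite /pos mxE.
apply: (adapted_ae_eq (z := fun w => kick n w 0 j + \sum_k J n k w * sigma k 0 j)) => //.
- exact: measurable_X.
- apply: measurable_funD; first exact: (adapted_mono hFt (time_ge0 n) tt (adapted_kick j nN aX)).
  by apply: measurable_sum => k; apply: measurable_funM => //; exact: adapted_J.
move=> w Zw; have := congr1 (fun x : 'rV[R]_m => x 0 j) (momentum_step Zw nN).
rewrite /mom [LHS]mxE [X in _ = X]mxE summxE => ->; congr (_ + _).
by apply: eq_bigr => k _; rewrite mxE.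
Qed.

Let measurable_mom n i : (n <= N)%N -> measurable_fun setT (fun w => mom n w 0 i).
Proof.
move=> nN; rewrite (_ : (fun w => _) = fun w => X n w 0 (lshift m i)); first exact: measurable_X.
by apply/funext => w; rewrite /mom mxE.
Qed.

Let measurable_pos n i : (n <= N)%N -> measurable_fun setT (fun w => pos n w 0 i).
Proof.
move=> nN; rewrite (_ : (fun w => _) = fun w => X n w 0 (rshift m i)); first exact: measurable_X.
by apply/funext => w; rewrite /pos mxE.
Qed.

Let noise_small_ball n (b : R) : (n < N)%N -> 0 <= b -> exists2 C : R, 0 <= C &
  forall (E : set Omega) (Y : Omega -> 'rV[R]_m) (r : R),
  past P Ft (time n) E -> (forall i, adapted P Ft (time n) (fun w => Y w 0 i)) ->
  0 < r <= 1 ->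
  (P (E `&` [set w | (`|Y w + \sum_k J n k w *: sigma k| <= r)%R /\
                     forall k, (`|J n k w| <= b)%R]) <= (C * r ^+ m)%:E * P E)%E.
Proof.
move=> nN b0.
have mf : measurable_fun setT (fun t : R => expR (- v * (n.+1%:R * h - t))).
  apply: measurableT_comp => //; apply: measurable_funM => //.
  exact: measurable_funB.
have f_lower t : time n < t -> t <= time n.+1 ->
    expR (- v * h) <= expR (- v * (n.+1%:R * h - t)).
  move=> nt _; rewrite ler_expR !mulNr lerN2 ler_pM2l// lerBlDl -lerBlDr.
  by apply: le_trans (ltW nt); rewrite /time -(natr1 n) mulrDl mul1r addrK.
have mJ k : measurable_fun setT (J n k) by exact: measurable_funP.
have [C C_ge0 ball] := wiener_integral_small_ball hFt hW (time_ge0 n) (time_lt n) mf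
  (expR_gt0 (- v * h)) f_lower mJ (fun k => intJ k nN).
exact: (vector_small_ball hFt (time_ge0 n) C_ge0 mJ ball freeA mA b0).
Qed.

(** If Q_(n+2) is close to c, then h P_(n+1) is close to Phi(Q_(n+1), c), and this
    target is known at time n. *)
Let adapted_target n (c : 'rV[R]_m) i : (n < N)%N ->
  adapted P Ft (time n) (fun w => momentum_map F h (pos n.+1 w) c 0 i).
Proof.
move=> nN.
apply: (@measurable_continuous_dependence _ _ (g_sigma_algebraType (past P Ft (time n))) _
  (pos n.+1) _ setT _ measurableT) => [j|].
  by apply: adapted_pos => // l; apply: adapted_X; exact: ltnW.
move=> w e _ e0.
have r0 : 0 <= `|pos n.+1 w| + `|c| + 1 by rewrite !addr_ge0.
have [L L0 LP] := momentum_map_lipschitz CF h0 r0.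
have L1 : 0 < L + 1 by rewrite ltr_wpDl.
exists (Num.min 1 (e / (L + 1))); first by rewrite lt_min ltr01 divr_gt0.
move=> w' _; rewrite lt_min => /andP[d1 d2].
have := rV_coord_le (momentum_map F h (pos n.+1 w') c - momentum_map F h (pos n.+1 w) c) i.
have -> : (momentum_map F h (pos n.+1 w') c - momentum_map F h (pos n.+1 w) c) 0 i =
    momentum_map F h (pos n.+1 w') c 0 i - momentum_map F h (pos n.+1 w) c 0 i.
  by move: (momentum_map F h _ _) (momentum_map F h _ _) => U V; rewrite !mxE.
move/le_lt_trans; apply.
apply: le_lt_trans (LP _ _ _ _ _ _ _ _) _.
- rewrite -(subrK (pos n.+1 w) (pos n.+1 w')); apply: le_trans (ler_normD _ _) _.
  by rewrite addrC -addrA lerD2l; apply: le_trans (ltW d1) _; rewrite lerDr.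
- by rewrite -addrA addrCA lerDl addr_ge0.
- by rewrite -addrA lerDl addr_ge0.
- by rewrite -addrA addrCA lerDl addr_ge0.
rewrite subrr normr0 addr0; apply: le_lt_trans (_ : (L + 1) * `|pos n.+1 w' - pos n.+1 w| < _).
  by rewrite ler_wpM2r// lerDl.
by rewrite -ltr_pdivlMl// mulrC.
Qed.

(** Phi is only locally Lipschitz, and the small ball estimate for the vector noise
    needs bounded components; the events for b = 0, 1, 2, ... exhaust the space. *)
Let bounded_event n (b : R) := [set w | [/\ ~ Z w, `|X n.+2 w| <= b, `|X n.+1 w| <= b,
  forall k, `|J n k w| <= b & forall k, `|J n.+1 k w| <= b]].

Let measurable_bounded_event n b : (n.+2 <= N)%N -> 0 <= b -> measurable (bounded_event n b).
Proof.
move=> nN b0.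
have -> : bounded_event n b = ~` Z `&` [set w | `|X n.+2 w| <= b] `&` [set w | `|X n.+1 w| <= b]
    `&` [set w | forall k, `|J n k w| <= b] `&` [set w | forall k, `|J n.+1 k w| <= b].
  by apply/seteqP; split=> w /=; [move=> []|move=> [[[[]]]]].
have mJ l k : measurable_fun setT (J l k) by exact: measurable_funP.
apply: measurableI; last exact: measurable_forall_norm_le.
apply: measurableI; last exact: measurable_forall_norm_le.
apply: measurableI; first (apply: measurableI; first exact: measurableC).
  by apply: measurable_rV_norm_le => // i; exact: measurable_X.
by apply: measurable_rV_norm_le => // i; apply: measurable_X; exact: ltnW.
Qed.

Let measurable_near n (a c : 'rV[R]_m) (r : R) : (n <= N)%N -> 0 <= r ->
  measurable [set w | `|mom n w - a| <= r /\ `|pos n w - c| <= r].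
Proof.
move=> nN r0.
apply: measurableI; apply: (measurable_rV_norm_le (Y := fun w => _ - _) r0) => i.
  rewrite (_ : (fun w => _) = fun w => mom n w 0 i - a 0 i); last first.
    by apply/funext => w; rewrite [LHS]mxE [X in _ + X]mxE.
  by apply: measurable_funB => //; exact: measurable_mom.
rewrite (_ : (fun w => _) = fun w => pos n w 0 i - c 0 i); last first.
  by apply/funext => w; rewrite [LHS]mxE [X in _ + X]mxE.
by apply: measurable_funB => //; exact: measurable_pos.
Qed.

(** The two noises are used for one half of the coordinates each: the first one has
    to bring P_(n+1) within O(r) of the target determined by c, the second one has
    to bring P_(n+2) within r of a. Each costs O(r ^ m), given the past. *)
Let two_step_small_ball n b : (n.+2 <= N)%N -> 0 <= b -> exists2 C : R, 0 <= C &
  forall (a c : 'rV[R]_m) (r : R), 0 < r <= 1 ->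
  (P (bounded_event n b `&` [set w | (`|mom n.+2 w - a| <= r)%R /\ (`|pos n.+2 w - c| <= r)%R])
   <= (C * r ^+ (m + m))%:E)%E.
Proof.
move=> nN b0.
have nN1 : (n < N)%N by exact: ltnW.
have b10 : 0 <= b + 1 by rewrite addr_ge0.
have [L L0 LP] := momentum_map_lipschitz CF h0 b10.
have [C C_ge0 ballC] := noise_small_ball nN1 b0.
have [D D_ge0 ballD] := noise_small_ball nN b0.
pose L1 := L / h + 1.
have L10 : 0 < L1 by rewrite /L1 ltr_wpDl// divr_ge0// ltW.
exists (D * (C * L1 ^+ m) + L1 ^+ (m + m)).
  by rewrite addr_ge0 ?mulr_ge0 ?exprn_ge0// ltW.
move=> a c r /andP[r0 r1].
set S := [set w | _ /\ _].
have L1r : 0 <= L1 * r by rewrite mulr_ge0// ltW.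
have rm0 : 0 <= r ^+ (m + m) by rewrite exprn_ge0// ltW.
have mS : measurable S by exact: measurable_near (ltW r0).
have mBS : measurable (bounded_event n b `&` S).
  by apply: measurableI => //; exact: measurable_bounded_event.
(* the small ball estimate is for radii at most 1; above, the bound is trivial *)
have [r'1|r'1] := ltP 1 (L1 * r).
  apply: le_trans (probability_le1 P mBS) _.
  rewrite lee_fin mulrDl; apply: (@le_trans _ _ (L1 ^+ (m + m) * r ^+ (m + m))).
    by rewrite -exprMn exprn_ege1// ltW.
  by rewrite lerDr !mulr_ge0 ?exprn_ge0// ltW.
(* a ball centred outside of the bounded region is not met *)
have [cb|cb] := leP `|c| (b + 1); last first.
  rewrite (_ : _ `&` _ = set0).
    by rewrite measure0 lee_fin mulr_ge0// addr_ge0 ?mulr_ge0 ?exprn_ge0// ltW.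
  rewrite -subset0 => w [[_ Xb _ _ _] [_ wc]].
  move: cb; apply/negP; rewrite -leNgt -(subrK (pos n.+2 w) c).
  apply: le_trans (ler_normD _ _) _; rewrite addrC lerD//; last first.
    by rewrite distrC (le_trans wc).
  exact: le_trans (norm_rsubmx_le _) Xb.
pose Y0 w := kick n w - h^-1 *: momentum_map F h (pos n.+1 w) c.
pose Y1 w := kick n.+1 w - a.
have aY0 i : adapted P Ft (time n) (fun w => Y0 w 0 i).
  have Y0E w : Y0 w 0 i = kick n w 0 i - h^-1 * momentum_map F h (pos n.+1 w) c 0 i.
    by rewrite /Y0; move: (kick n w) (momentum_map F h _ _) => U V; rewrite !mxE.
  rewrite /adapted; under eq_fun do rewrite Y0E.
  apply: measurable_funB; first exact: adapted_kick nN1 (adapted_X (ltnW nN1)).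
  by apply: measurable_funM => //; exact: adapted_target.
have aY1 i : adapted P Ft (time n.+1) (fun w => Y1 w 0 i).
  have Y1E w : Y1 w 0 i = kick n.+1 w 0 i - a 0 i.
    by rewrite /Y1; move: (kick n.+1 w) => U; rewrite !mxE.
  rewrite /adapted; under eq_fun do rewrite Y1E.
  by apply: measurable_funB => //; exact: adapted_kick nN (adapted_X nN1).
pose E1 := [set w | (`|Y0 w + \sum_k J n k w *: sigma k| <= L1 * r)%R /\
                     forall k, (`|J n k w| <= b)%R].
have tt := ltW (time_lt n).
have pE1 : past P Ft (time n.+1) E1.
  apply/(measurable_pastP hFt _ (time_ge0 n.+1)).
  have aJ k := adapted_J k nN1.
  apply: measurableI; last exact: measurable_forall_norm_le.
  apply: (@measurable_rV_norm_le _ (g_sigma_algebraType (past P Ft (time n.+1))) _ _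
    (fun w => Y0 w + \sum_k J n k w *: sigma k) _ L1r) => i.
  rewrite (_ : (fun w => _) = fun w => Y0 w 0 i + \sum_k J n k w * sigma k 0 i); last first.
    apply/funext => w; rewrite [LHS]mxE summxE; congr (_ + _).
    by apply: eq_bigr => k _; rewrite mxE.
  apply: measurable_funD; first exact: (adapted_mono hFt (time_ge0 n) tt (aY0 i)).
  by apply: measurable_sum => k; apply: measurable_funM => //; exact: aJ.
have PE1 : (P E1 <= (C * (L1 * r) ^+ m)%:E)%E.
  have pT : past P Ft (time n) setT.
    by apply/(measurable_pastP hFt _ (time_ge0 n)); exact: measurableT.
  have := ballC setT Y0 (L1 * r) pT aY0.
  by rewrite setTI probability_setT mule1; apply; rewrite r'1 mulr_gt0.
have rr : 0 < r <= 1 by rewrite r0.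
have := ballD E1 Y1 r pE1 aY1 rr.
set E2 := E1 `&` _ => PE2.
have mE2 : measurable E2.
  have aJ k := measurable_adapted hFt (time_ge0 n.+2) (adapted_J k nN).
  have mY1 i := measurable_adapted hFt (time_ge0 n.+1) (aY1 i).
  apply: measurableI; first by have [] := pE1.
  apply: measurableI; last exact: measurable_forall_norm_le.
  apply: (measurable_rV_norm_le (Y := fun w => Y1 w + \sum_k J n.+1 k w *: sigma k) (ltW r0)) => i.
  rewrite (_ : (fun w => _) = fun w => Y1 w 0 i + \sum_k J n.+1 k w * sigma k 0 i); last first.
    apply/funext => w; rewrite [LHS]mxE summxE; congr (_ + _).
    by apply: eq_bigr => k _; rewrite mxE.
  apply: measurable_funD => //.
  by apply: measurable_sum => k; apply: measurable_funM => //; exact: aJ.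
apply: (@le_trans _ _ (P E2)).
  apply: le_measure; rewrite ?inE// => w [[Zw X2b X1b J0b J1b] [wa wc]].
  have hn : h != 0 by rewrite gt_eqF.
  split; last first.
    split=> //; rewrite /Y1 addrAC; move: wa; rewrite (momentum_step Zw nN).
    by [].
  split=> //.
  have -> : Y0 w + \sum_k J n k w *: sigma k =
      h^-1 *: (momentum_map F h (pos n.+1 w) (pos n.+2 w) - momentum_map F h (pos n.+1 w) c).
    rewrite /Y0 addrAC -(momentum_step Zw nN1) scalerBr; congr (_ - _).
    have [<- _] := avf_step_momentum h0 (X_step Zw nN).
    by rewrite scalerA mulVf// scale1r.
  rewrite normrZ gtr0_norm ?invr_gt0//.
  apply: (@le_trans _ _ (L / h * r)); last by rewrite ler_pM2r// /L1 lerDl.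
  rewrite mulrAC mulrC ler_pM2r ?invr_gt0//.
  apply: le_trans (LP _ _ _ _ _ _ _ _) _ => //.
  - by apply: le_trans (norm_rsubmx_le _) _; rewrite (le_trans X1b)// lerDl.
  - by apply: le_trans (norm_rsubmx_le _) _; rewrite (le_trans X2b)// lerDl.
  - by apply: le_trans (norm_rsubmx_le _) _; rewrite (le_trans X1b)// lerDl.
  by rewrite subrr normr0 add0r ler_wpM2l.
apply: le_trans PE2 _.
apply: (@le_trans _ _ ((D * r ^+ m)%:E * (C * (L1 * r) ^+ m)%:E)%E).
  by apply: lee_wpmul2l => //; rewrite lee_fin mulr_ge0// exprn_ge0// ltW.
rewrite -EFinM lee_fin !exprD exprMn mulrDl.
rewrite (_ : D * r ^+ m * (C * (L1 ^+ m * r ^+ m)) = D * (C * L1 ^+ m) * (r ^+ m * r ^+ m)).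
  by rewrite lerDl !mulr_ge0 ?exprn_ge0// ltW.
by ring.
Qed.

(** A cube of side r is contained in the ball of radius r around its corner, and a
    set that is null for all the localised laws is null for the law. *)
Lemma scheme_law_dominated n : (n.+2 <= N)%N -> law P (X n.+2) `<< @lebesgue_tuple R (m + m).
Proof.
move=> nN; have mX := hXm nN.
have b0 (b : nat) : 0 <= b%:R :> R by [].
have mB b := measurable_bounded_event nN (b0 b).
have dominated b : pushforward (mrestr P (mB b)) (fun w => row_tuple (X n.+2 w)) `<<
    @lebesgue_tuple R (m + m).
  pose nu : {measure set ((m + m).-tuple R) -> \bar R} :=
    measure_function_pushforward__canonical__measure_function_Measure (mrestr P (mB b)) mX.
  have [C C_ge0 CP] := two_step_small_ball nN (b0 b).
  apply: (dominates_lebesgue_tuple (nu := nu) C_ge0) => j z.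
  pose x0 : 'rV[R]_(m + m) := \row_i ((tnth z i)%:~R * 2 ^- j).
  have r01 : 0 < (2 ^- j : R) <= 1.
    by rewrite invr_gt0 exprn_gt0//= invf_le1 ?exprn_gt0// exprn_ege1// ler1n.
  apply: le_trans (CP (lsubmx x0) (rsubmx x0) _ r01).
  have cube_ball w : dyadic_cube j z (row_tuple (X n.+2 w)) -> `|X n.+2 w - x0| <= 2 ^- j.
    move=> cube; apply/rV_norm_leP => [|i]; first by case/andP: r01 => /ltW.
    have := cube i; rewrite tnth_mktuple => /andP[c1 c2].
    have p0 : 0 < 2 ^+ j :> R by rewrite exprn_gt0.
    have -> : (X n.+2 w - x0) 0 i = (2 ^+ j * X n.+2 w 0 i - (tnth z i)%:~R) * 2 ^- j.
      by rewrite mulrBl mulrAC mulfV ?gt_eqF// mul1r !mxE.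
    rewrite normrM (gtr0_norm (x := 2 ^- j)) ?invr_gt0// ger_pMl ?invr_gt0//.
    by rewrite ger0_norm ?subr_ge0// lerBlDl -[1]/(1%:~R) -intrD ltW.
  rewrite /nu /= /pushforward /mrestr; apply: le_measure; rewrite ?inE.
  - apply: measurableI => //; rewrite -[X in measurable X]setTI.
    exact: (mX measurableT _ (measurable_dyadic_cube _ _)).
  - by apply: measurableI => //; apply: measurable_near => //; case/andP: r01 => /ltW.
  move=> w [/cube_ball xw Bw]; split=> //; split.
    by rewrite /mom -linearB (le_trans (norm_lsubmx_le _)).
  by rewrite /pos -linearB (le_trans (norm_rsubmx_le _)).
move=> U nullU V mV VU; rewrite /law /pushforward.
have mXV : measurable ((fun w => row_tuple (X n.+2 w)) @^-1` V).
  by rewrite -[X in measurable X]setTI; exact: mX.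
apply/(negligibleP P mXV).
apply: (@negligibleS _ _ _ P (Z `|` \bigcup_b ((fun w => row_tuple (X n.+2 w)) @^-1` V `&`
    bounded_event n b%:R))).
  move=> w Vw; have [Zw|Zw] := pselect (Z w); [by left|right].
  pose M := `|X n.+2 w| + `|X n.+1 w| + \sum_k `|J n k w| + \sum_k `|J n.+1 k w|.
  have S0 l : 0 <= \sum_k `|J l k w| by apply: sumr_ge0.
  have Jle l k : `|J l k w| <= \sum_k `|J l k w|.
    by rewrite [leRHS](bigD1 k)//= lerDl; apply: sumr_ge0.
  have MT : M <= (Num.truncn M).+1%:R by rewrite ltW// truncnS_gt.
  exists (Num.truncn M).+1 => //; split=> //; split=> //.
  - by apply: le_trans MT; rewrite /M -!addrA lerDl !addr_ge0.
  - by apply: le_trans MT; rewrite /M -!addrA addrCA lerDl !addr_ge0.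
  - move=> k; apply: le_trans MT; apply: le_trans (Jle _ _) _.
    by rewrite /M -addrA [leRHS]addrC -addrA lerDl !addr_ge0.
  - move=> k; apply: le_trans MT; apply: le_trans (Jle _ _) _.
    by rewrite /M lerDr !addr_ge0.
apply: negligibleU; first by exists Z; split.
apply: negligible_bigcup => b; apply/negligibleP; first exact: measurableI.
exact: (dominated b U nullU V mV VU).
Qed.

End SchemeLaw.

Unset Implicit Arguments.

Theorem theorem4p5 (R : realType) (m d : nat) (hm : (0 < m)%N) (hd : (0 < d)%N)
  (dis : measure_display) (Omega : measurableType dis) (P : probability Omega R)
  (hP : measure_is_complete P)
  (Ft : R -> set_system Omega) (hFt : filtration Ft)
  (W : 'I_d -> R -> {RV P >-> R}) (hW : wiener_process W Ft)
  (Tf v : R) (hTf : 0 < Tf) (hv : 0 < v)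
  (sigma : 'I_d -> 'rV[R]_m) (X0 : 'rV[R]_(m + m))
  (F : 'rV[R]_m -> R) (C0 K : R) (hF : standing_assumptions F C0 K)
  (hFp : class_Cpinfty F)
  (C1 C2 C3 eps : R) (l : 'I_m -> nat)
  (hC1 : 0 < C1) (hC2 : 0 < C2) (hC3 : 0 < C3) (heps : 0 < eps)
  (hl : forall i, (1 <= l i)%N)
  (hgrowth : growth_conditions F C1 C2 C3 eps l)
  (hderiv : derivative_bounds F l)
  (hsigma : exists A : {set 'I_d},
    (m <= #|A|)%N /\ free [seq sigma k | k in A])
  (N : nat) (hN : (0 < N)%N)
  (hK : 0 < K -> Tf / N%:R < 2 / Num.sqrt K)
  (X : nat -> Omega -> 'rV[R]_(m + m))
  (hXm : forall n, (n <= N)%N -> random_vector (X n))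
  (hX : splitting_avf W F v sigma (Tf / N%:R) N X0 X) :
  forall n : nat, (2 <= n)%N -> (n <= N)%N ->
    law P (X n) `<< @lebesgue_tuple R (m + m).
Proof.
move=> [//|[//|n]] _ nN.
have [CF _ _ K0 hessK] := hF.
have [A [mA freeA]] := hsigma.
have h0 : 0 < Tf / N%:R by rewrite divr_gt0// ltr0n.
have hK4 : (Tf / N%:R) ^+ 2 * K < 4.
  move: K0; rewrite le_eqVlt => /orP[/eqP <-|Kp]; first by rewrite mulr0.
  have sK : 0 < Num.sqrt K by rewrite sqrtr_gt0.
  rewrite -[K]sqr_sqrtr ?ltW// -exprMn.
  have -> : 4 = 2 ^+ 2 :> R by rewrite -natrX.
  have lt2 : Tf / N%:R * Num.sqrt K < 2 by rewrite -ltr_pdivlMr// hK.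
  by rewrite ltr_pXn2r// nnegrE; [rewrite mulr_ge0 ?(ltW h0) ?(ltW sK)|].
have [J [intJ [Z [mZ PZ badZ]]]] := hX.
have good w : ~ Z w -> X 0%N w = X0 /\ forall n, (n < N)%N ->
    avf_step F v (Tf / N%:R) (lsubmx (X n w)) (rsubmx (X n w))
      (\sum_k J n k w *: sigma k) (lsubmx (X n.+1 w)) (rsubmx (X n.+1 w)).
  by move=> Zw; apply: contrapT => bad; apply: Zw; exact: badZ.
have init w : ~ Z w -> X 0%N w = X0 by move=> /good[].
have := scheme_law_dominated hFt hW CF h0 hv hessK hK4 freeA mA hXm intJ mZ PZ init.
apply; last exact: nN.
by move=> w k /good[_]; apply.
Qed.
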